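(* Let $s\in(0,1)$ and $\beta>0$, and let $\mathbb{P}_{N,\beta}$ be the circular Riesz gas defined in the context. Let $\varepsilon\in(0,1)$ and $\delta=\frac{\varepsilon}{4(s+2)}$. There exist constants $C(\beta)>0$ and $c(\beta)>0$ (depending only on $s,\varepsilon,\beta$, locally uniform in $\beta$, and independent of $N,i,k$) such that for every $N$, every $i\in\{1,\ldots,N\}$ and every integer $1\leq k\leq \frac{N}{2}$, $$\mathbb{P}_{N,\beta}\bigl(|N(x_{i+k}-x_i)-k|\leq k^{\frac{s}{2}+\varepsilon}\bigr)\geq 1-C(\beta)e^{-c(\beta)k^{\delta}}.$$ Similarly, for every $\varepsilon\in(0,1)$, setting $\delta=\frac{\varepsilon}{2(s+2)}$, there exist constants $C(\beta)>0$, $c(\beta)>0$ (locally uniform in $\beta$, independent of $N,a,\ell_N$) such that for all $a\in\mathbb{T}$ and all $\ell_N\in(0,\frac14)$, $$\mathbb{P}_{N,\beta}\Bigl(\Bigl|\sum_{i=1}^N \mathds{1}_{(a-\ell_N,a+\ell_N)}(x_i)-2N\ell_N\Bigr|\leq (N\ell_N)^{\frac{s}{2}+\varepsilon}\Bigr)\geq 1-C(\beta)e^{-c(\beta)(N\ell_N)^{\delta}}.$$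
   Context: Fix $s\in(0,1)$ and let $\mathbb{T}=\mathbb{R}/\mathbb{Z}$. For $x\in\mathbb{T}\setminus\{0\}$, identified with its representative in $(0,1)$, let $g(x)=\zeta(s,x)+\zeta(s,1-x)=\lim_{n\to\infty}\bigl(\sum_{k=-n}^n|k+x|^{-s}-\frac{2}{1-s}n^{1-s}\bigr)$, where $\zeta(s,a)$ is the Hurwitz zeta function; $g$ is the fundamental solution of the fractional Laplace equation $(-\Delta)^{\frac{1-s}{2}}g=c_s(\delta_0-1)$ on $\mathbb{T}$. Let $D_N=\{X_N=(x_1,\ldots,x_N)\in\mathbb{T}^N: x_2-x_1<\cdots<x_N-x_1\}$, where differences in $\mathbb{T}$ are compared through their representatives in $[0,1)$ (configurations ordered counterclockwise). Let $\mathcal{H}_N(X_N)=N^{-s}\sum_{i\neq j}g(x_i-x_j)$ and, for $\beta>0$, $d\mathbb{P}_{N,\beta}=Z_{N,\beta}^{-1}e^{-\beta\mathcal{H}_N(X_N)}\mathds{1}_{D_N}(X_N)\,dX_N$ with $Z_{N,\beta}$ the normalizing constant. Indices are understood modulo $N$, and for $1\le k\le N-1$, $x_{i+k}-x_i$ denotes the representative in $[0,1)$ of the difference in $\mathbb{T}$ (the length of the counterclockwise arc from $x_i$ to $x_{i+k}$). ''Locally uniform in $\beta$'' means the constants stay bounded (and bounded away from $0$) when $\beta$ ranges over compact subsets of $(0,\infty)$. *)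

(* Defs.v *)
From mathcomp Require Import all_boot all_order all_algebra.
From mathcomp Require Import all_classical all_reals all_analysis.
Set Implicit Arguments. Unset Strict Implicit. Unset Printing Implicit Defensive.
Import Order.TTheory GRing.Theory Num.Theory.
Import numFieldNormedType.Exports.
Local Open Scope classical_set_scope.
Local Open Scope ring_scope.

Section Riesz.
Variable R : realType.

(* representative in [0,1) of a point of T = R/Z *)
Definition trep (x : R) : R := x - (Num.floor x)%:~R.

Definition hz_partial (s x : R) (n : nat) : R :=
  \sum_(0 <= j < (2 * n).+1) (`| (j%:R - n%:R) + x | `^ (- s))
  - 2 / (1 - s) * (n%:R `^ (1 - s)).

(* g(x) = zeta(s,x) + zeta(s,1-x) for x in (0,1), as the limit in the context *)
Definition gfun (s x : R) : R := limn (hz_partial s x).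

Definition gT (s x : R) : R := gfun s (trep x).

(* configurations X = (x_0,...,x_{N-1}) (0-indexed), coordinates in [0,1) *)
Definition HN (s : R) (N : nat) (X : seq R) : R :=
  (N%:R `^ (- s)) * \sum_(i < N) \sum_(j < N | i != j) gT s (X`_i - X`_j).

Definition inDN (N : nat) (X : seq R) : bool :=
  [forall j : 'I_N, ((0 < j)%N && (j.+1 < N)%N) ==>
     (trep (X`_j - X`_0) < trep (X`_j.+1 - X`_0))].

Definition gibbs_w (s beta : R) (N : nat) (X : seq R) : \bar R :=
  (if inDN N X then expR (- beta * HN s N X) else 0)%:E.

Fixpoint iint (n : nat) (F : seq R -> \bar R) : \bar R :=
  match n with
  | 0 => F [::]
  | n'.+1 => (\int[@lebesgue_measure R]_(x in [set y : R | (0 <= y < 1)%R])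
               iint n' (fun t => F (x :: t)))%E
  end.

Definition PNbeta (s beta : R) (N : nat) (A : seq R -> bool) : R :=
  fine (iint N (fun X => if A X then gibbs_w s beta N X else 0%E))
  / fine (iint N (gibbs_w s beta N)).

(* the tarc (a - l, a + l) in T, as a subset of R (periodic) *)
Definition tarc (a l : R) : set R :=
  [set x | exists m : int, a - l < x + m%:~R < a + l].

Definition loc_unif (C : R -> R) : Prop :=
  forall a b : R, 0 < a -> a <= b ->
    exists M m : R, 0 < m /\ forall beta, a <= beta <= b -> m <= C beta <= M.

End Riesz.

(* Main.v *)
(** The arc length [F = N (x_k - x_0)] has mean [k] by rotation invariance, and
  in the coordinates [x_j - x_0] the Gibbs weight is log-concave on the ordered
  configurations, so the midpoint form of Prekopa-Leindler applies.  Applied to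
  [F > a] it gives [P (F > a) <= P (F > a / 2)^2], hence exponential tails for
  gaps.  Applied to [F] tilted by [exp (+- t (F - k))] on the event [K] that the
  first [k] gaps are at most [T], it gives
    [E (1_K exp (t (F - k))) * E (1_K exp (- t (F - k))) <= exp (C t^2 k^s T^(s+2) / beta)]:
  on [K] the energy is uniformly convex, with Hessian bounded below by
  [T^(-s-2)] times a discrete fractional Sobolev seminorm, and this seminorm
  controls [(psi_k - psi_0)^2 / k^s].  Since [exp x >= 1 + x] and [E F = k],
  each factor is at least [1/2], so both are sub-Gaussian; [T] is a small power
  of [k].

  For the number of points in an arc [(c, c + r)]: if there are more than [m],
  then some [x_i] within [r] after [c] satisfies [x_(i+m) - x_i < r]; if there are
  fewer than [m], then for some [i] the arc from [x_i] to [x_(i+m+1)] contains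
  [c] and is at least [r] long.  Integrating out the position of [x_i] turns
  both into deviations of arc lengths, losing only a factor of the order of [N r]. *)

Require Import Defs.
From HB Require Import structures.
From mathcomp Require Import all_boot all_order all_algebra.
From mathcomp Require Import all_classical all_reals all_analysis.
From mathcomp Require Import measurable_realfun.
From mathcomp Require Import ring lra zify.
Import Order.TTheory GRing.Theory Num.Theory.
Import numFieldNormedType.Exports.
Local Open Scope classical_set_scope.
Local Open Scope ring_scope.

Set Implicit Arguments.
Unset Strict Implicit.
Unset Printing Implicit Defensive.

(** Prekopa-Leindler is used as f(X) g(Y) <= h((X + Y) / 2)^2, so g enters only through midpoint
    convexity with a quadratic gain: no derivative is taken, and the Hessian bound appears as a
    lower bound on H(U) + H(V) - 2 H((U + V) / 2). This form calls for opposite tilts: their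
    exponents combine to t times a linear function of U - V, which the gain can absorb. The obstacle
    is that the gain degenerates for long gaps, hence the restriction to K. It is harmless in the
    inequality, because K is convex, but it destroys the exact identity E F = k; the defect, the
    mean of F off K, is paid for by a second moment of F, which the exponential tails supply. With T
    = k^tau, tau = 5 eps / (8 (s + 2)), the variance proxy is of order k^(s + 5 eps / 8). Deviations
    of order k^(s / 2 + eps / 2) are tested with t of order k^(- s / 2 - eps / 8); both terms of the
    exponent are then of order k^(3 eps / 8), which is at least k^tau. In the counting part, a
    deficit of points weights the event by the arc length itself, so the second moment serves
    again. *)

Section PowerInequalities.
Context {R : realType}.
Implicit Types (p s x y a b r : R).

(** * Tangent and convexity inequalities for real powers *)

Lemma powR_bernoulli p x : 0 <= p <= 1 -> 0 < x -> x `^ p <= 1 + p * (x - 1).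
Proof.
move=> /andP[p0 p1] x0.
have h := le_ln1Dx (x := p * (x - 1)).
rewrite -[leRHS]lnK; last first.
  rewrite posrE; nra.
rewrite /powR gt_eqF// ler_expR.
have xpos : x \in Num.pos by rewrite posrE.
have [->|p0'] := eqVneq p 0; first by rewrite !mul0r addr0 ln1.
have := @concave_ln R (Itv01 p0 p1) x 1 x0 ltr01.
rewrite !convRE/= ln1 mulr0 addr0 mulr1.
by rewrite (_ : p * x + (1 - p) = 1 + p * (x - 1)) //; ring.
Qed.

Lemma powRB1 x y : 0 < y -> y `^ (x - 1) = y `^ x / y.
Proof. by move=> y0; rewrite powRB ?(gt_eqF y0) ?implybT// powRr1// ltW. Qed.

(** Concavity of x^p, obtained from the Bernoulli inequality by scaling with y. It replaces the mean
    value theorem wherever a sum of powers is compared with an integral. *)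
Lemma powR_tangent p x y : 0 <= p <= 1 -> 0 <= x -> 0 < y ->
  x `^ p <= y `^ p + p * y `^ (p - 1) * (x - y).
Proof.
move=> /[dup] p01 /andP[p0 p1]; rewrite le_eqVlt => /predU1P[<-|x0] y0.
  rewrite sub0r mulrN -mulrA (mulrC (y `^ _)).
  have [->|pn] := eqVneq p 0; first by rewrite !powRr0 mul0r subr0.
  rewrite mulr_powRB1 ?lt_neqAle ?p0 1?eq_sym ?pn//; last exact: ltW.
  by rewrite powR0// subr_ge0 ler_piMl// powR_ge0.
have -> : x = y * (x / y) by rewrite mulrCA divff ?mulr1// gt_eqF.
rewrite powRM ?(ltW y0) ?(ltW (divr_gt0 x0 y0))//.
have := @powR_bernoulli p (x / y) p01 (divr_gt0 x0 y0).
move/(ler_wpM2l (powR_ge0 y p)) => /le_trans; apply.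
rewrite mulrDr mulr1 lerD2l.
rewrite powRB1//.
by rewrite le_eqVlt; apply/orP; left; apply/eqP; field; rewrite gt_eqF.
Qed.

(** With t = x / y, Bernoulli bounds t^(-s) below by 1 / (1 + u), u = s (t - 1), and 1 / (1 + u) = 1
    - u + u^2 / (1 + u) exactly; this denominator is at most r / y. The result has s^2 in place of
    the Taylor constant s (s + 1) / 2. *)
Lemma powRN_tangent s x y r : 0 < s < 1 -> 0 < x <= r -> 0 < y <= r ->
  x `^ (- s) >= y `^ (- s) - s * y `^ (- s - 1) * (x - y)
     + s ^+ 2 * r `^ (- s - 2) * (x - y) ^+ 2.
Proof.
move=> /andP[s0 s1] /andP[x0 xr] /andP[y0 yr].
have r0 : 0 < r by exact: lt_le_trans xr.
have xyE : x = y * (x / y) by rewrite mulrCA divff ?mulr1// gt_eqF.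
have t0 : 0 < x / y by rewrite divr_gt0.
set t := x / y in xyE t0.
have B := @powR_bernoulli s t.
have {}B : t `^ s <= 1 + s * (t - 1) by apply: B => //; rewrite !ltW.
have C0 : 0 < 1 + s * (t - 1) by nra.
have tN : 1 / (1 + s * (t - 1)) <= t `^ (- s).
  by rewrite powRN div1r lef_pV2// posrE// powR_gt0.
have tN2 : 1 - s * (t - 1) + s ^+ 2 * (t - 1) ^+ 2 * (y / r) <= t `^ (- s).
  apply: le_trans tN.
  have -> : 1 / (1 + s * (t - 1)) = 1 - s * (t - 1) + s ^+ 2 * (t - 1) ^+ 2 * (1 / (1 + s * (t - 1))).
    by field; rewrite gt_eqF.
  rewrite lerD2l; apply: ler_wpM2l; first by rewrite mulr_ge0 ?sqr_ge0.
  rewrite ler_pdivlMr// mulrAC ler_pdivrMr// mul1r.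
  have -> : y * (1 + s * (t - 1)) = y * (1 - s) + s * (y * t) by ring.
  rewrite -xyE; nra.
have -> : x `^ (- s) = y `^ (- s) * t `^ (- s).
  by rewrite xyE powRM ?(ltW t0) ?(ltW y0)//.
apply: le_trans (ler_wpM2l (powR_ge0 y (- s)) tN2).
have yE : y `^ (- s - 1) = y `^ (- s) / y.
  exact: powRB1.
have xy2 : x - y = y * (t - 1) by rewrite mulrBr mulr1 -xyE.
rewrite yE xy2.
have -> : s * (y `^ (- s) / y) * (y * (t - 1)) = y `^ (- s) * (s * (t - 1)).
  by field; rewrite gt_eqF.
rewrite [leRHS](_ : _ = y `^ (- s) - y `^ (- s) * (s * (t - 1)) +
  y `^ (- s) * (s ^+ 2 * (t - 1) ^+ 2 * (y / r))); last by ring.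
rewrite lerD2l.
have -> : r `^ (- s - 2) = r `^ (- s - 1) / r.
  rewrite (_ : - s - 2 = (- s - 1) - 1); last by ring.
  exact: powRB1.
have -> : s ^+ 2 * (r `^ (- s - 1) / r) * (y * (t - 1)) ^+ 2 =
  (s ^+ 2 * (t - 1) ^+ 2 * (y ^+ 2 / r)) * r `^ (- s - 1) by ring.
have -> : y `^ (- s) * (s ^+ 2 * (t - 1) ^+ 2 * (y / r)) =
  (s ^+ 2 * (t - 1) ^+ 2 * (y ^+ 2 / r)) * (y `^ (- s) / y).
  by field; rewrite !gt_eqF.
apply: ler_wpM2l; first by apply: mulr_ge0;
  [apply: mulr_ge0; exact: sqr_ge0 | apply: divr_ge0; [exact: sqr_ge0 | exact: ltW]].
rewrite -yE (_ : - s - 1 = - (s + 1)); last by ring.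
rewrite !powRN lef_pV2 ?posrE ?powR_gt0//.
by rewrite ge0_ler_powR ?nnegrE ?(ltW y0) ?(ltW r0)// addr_ge0// ltW.
Qed.

(** Sum of the two tangent bounds at the midpoint: the linear terms cancel and each quadratic term
    carries ((a - b) / 2)^2. *)
Lemma powRN_midpoint_convex s a b r : 0 < s < 1 -> 0 < a <= r -> 0 < b <= r ->
  2 * ((a + b) / 2) `^ (- s) + s ^+ 2 / 2 * r `^ (- s - 2) * (a - b) ^+ 2
    <= a `^ (- s) + b `^ (- s).
Proof.
move=> s01 a0 b0; set m := (a + b) / 2.
have m0 : 0 < m <= r by rewrite /m; lra.
have h1 := powRN_tangent s01 a0 m0.
have h2 := powRN_tangent s01 b0 m0.
apply: le_trans (lerD h1 h2).
have e1 : a - m = (a - b) / 2 by rewrite /m; lra.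
have e2 : b - m = - ((a - b) / 2) by rewrite /m; lra.
by rewrite e1 e2 le_eqVlt; apply/orP; left; apply/eqP; field.
Qed.

(** The tangent of x^s at m bounds m^(s - 1) by (m^s - (m - 1)^s) / s, which telescopes. *)
Lemma sum_powR_le s n : 0 < s <= 1 ->
  \sum_(1 <= m < n.+1) m%:R `^ (s - 1) <= n%:R `^ s / s.
Proof.
move=> /andP[s0 s1]; elim: n => [|n IH].
  by rewrite big_geq// divr_ge0 ?powR_ge0 ?ltW.
rewrite big_nat_recr//=; apply: le_trans (lerD IH (lexx _)) _.
have := @powR_tangent s n%:R n.+1%:R.
move=> /(_ _ _ _)-/(_ _ _ _); rewrite (ltW s0) s1 ler0n ltr0n => /(_ isT isT isT).
rewrite -natr1 opprD addNKr mulrN1 => h.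
rewrite -ler_pdivrMr ?invr_gt0// invrK mulrDl mulfVK ?gt_eqF//.
by rewrite (mulrC _ s) -lerBrDr.
Qed.

End PowerInequalities.

(** * The kernel g *)

Section FundamentalSolution.
Context {R : realType}.
Implicit Types (s x y a b r : R).

Lemma cvgn_powRN s : 0 < s -> (fun n : nat => (n%:R : R) `^ (- s)) @ \oo --> (0 : R).
Proof.
move=> s0; apply/cvgrPdist_lt => e e0; near=> n.
rewrite sub0r normrN ger0_norm ?powR_ge0//.
have en : e `^ (- s^-1) < n%:R by near: n; exact: nbhs_infty_gtr.
have -> : e = (e `^ (- s^-1)) `^ (- s).
  by rewrite -powRrM mulrNN mulVf ?gt_eqF// powRr1// ltW.
have ep : 0 < e `^ (- s^-1) by exact: powR_gt0.
have n0 : 0 < (n%:R : R) by exact: lt_trans en.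
rewrite ![_ `^ (- s)]powRN ltf_pV2 ?posrE ?powR_gt0//.
by apply: gt0_ltr_powR; rewrite ?nnegrE ?(ltW ep) ?(ltW n0).
Unshelve. all: by end_near. Qed.

(** Regularised sums for zeta(s, y). Shifting the counterterm by y, instead of using n^(1 - s),
    makes the sequence monotone. *)
Definition hurwitz_partial s y n : R :=
  \sum_(0 <= k < n) (k%:R + y) `^ (- s) - (n%:R + y) `^ (1 - s) / (1 - s).

(** Concavity of x^(1 - s) compares each term with an increment of the counterterm from both sides:
    one side gives monotonicity, the other the upper bound y^(-s). *)
Lemma cvg_hurwitz_partial s y : 0 < s < 1 -> 0 < y -> cvgn (hurwitz_partial s y).
Proof.
move=> /andP[s0 s1] y0.
have p01 : 0 <= 1 - s <= 1 by lra.
have p0 : 0 < 1 - s by lra.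
have ny n : 0 < n%:R + y by rewrite ltr_wpDl.
have pE n : (n%:R + y) `^ (1 - s - 1) = (n%:R + y) `^ (- s) by congr powR; ring.
apply: nondecreasing_is_cvgn.
- apply/nondecreasing_seqP => n; rewrite /hurwitz_partial big_nat_recr//=.
  rewrite -addrA lerD2l lerBrDl -lerBrDr opprK -lerBlDr.
  rewrite -mulrBl ler_pdivrMr// lerBlDl.
  have := powR_tangent p01 (ltW (ny n.+1)) (ny n).
  rewrite pE (_ : n.+1%:R + y - (n%:R + y) = 1) ?mulr1; last by rewrite -natr1; ring.
  by rewrite (mulrC (_ `^ (- s))).
- exists (y `^ (- s)) => _ [n _ <-]; rewrite /hurwitz_partial lerBlDr.
  case: n => [|n]; first by rewrite big_geq// addr_ge0 ?powR_ge0// divr_ge0 ?powR_ge0// ltW.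
  apply: (@le_trans _ _ (y `^ (- s) + (n%:R + y) `^ (1 - s) / (1 - s))); last first.
    rewrite lerD2l ler_pM2r ?invr_gt0// ge0_ler_powR ?nnegrE ?(ltW p0)// ?(ltW (ny _))//.
    by rewrite lerD2r ler_nat.
  elim: n => [|n IH].
    by rewrite big_nat1 add0r lerDl divr_ge0 ?powR_ge0// ltW.
  rewrite big_nat_recr//=; apply: le_trans (lerD IH (lexx _)) _.
  rewrite -addrA lerD2l -lerBrDl -mulrBl ler_pdivlMr// lerBrDl.
  have := powR_tangent p01 (ltW (ny n)) (ny n.+1).
  rewrite pE (_ : n%:R + y - (n.+1%:R + y) = - 1) ?mulrN1; last by rewrite -natr1; ring.
  by rewrite lerBrDr (mulrC (_ `^ (- s))).
Qed.

(** The terms of negative index are reflected, |- (k + 1) + x| = k + (1 - x), which separates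
    zeta(s, x) from zeta(s, 1 - x). *)
Lemma hz_partialE s x n : 0 < x < 1 -> hz_partial s x n =
  \sum_(0 <= k < n.+1) (k%:R + x) `^ (- s)
  + \sum_(0 <= k < n) (k%:R + (1 - x)) `^ (- s)
  - 2 / (1 - s) * (n%:R `^ (1 - s)).
Proof.
move=> /andP[x0 x1]; rewrite /hz_partial; congr (_ - _).
rewrite (@big_cat_nat _ _ _ n)//=; last by lia.
rewrite addrC; congr (_ + _).
  rewrite -{1}(add0n n) big_addn (_ : (2 * n).+1 - n = n.+1)%N; last by lia.
  apply: eq_bigr => k _; rewrite natrD addrK ger0_norm//.
  by rewrite addr_ge0// ltW.
rewrite big_nat_rev/= add0n; apply: eq_big_nat => k /andP[_ kn].
rewrite natrB// -natr1.
have -> : n%:R - (k%:R + 1) - n%:R + x = - (k%:R + (1 - x)) by ring.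
by rewrite normrN ger0_norm// addr_ge0// subr_ge0 ltW.
Qed.

Lemma cvg_shifted_powR_diff s y : 0 < s < 1 -> 0 <= y ->
  (fun n : nat => ((n%:R + y) `^ (1 - s) - n%:R `^ (1 - s) : R)) @ \oo --> (0 : R).
Proof.
move=> /andP[s0 s1] y0.
have p01 : 0 <= 1 - s <= 1 by lra.
have c0 : (fun n : nat => (1 - s) * y * (n%:R : R) `^ (- s)) @ \oo --> (0 : R).
  rewrite -(mulr0 ((1 - s) * y)).
  by apply: cvgM; [exact: cvg_cst|exact: cvgn_powRN].
apply: (squeeze_cvgr _ (cvg_cst 0) c0); near=> n.
have n0 : (0 : R) < n%:R by rewrite ltr0n; near: n; exact: nbhs_infty_gt.
apply/andP; split.
  rewrite subr_ge0; apply: ge0_ler_powR; rewrite ?nnegrE ?lerDl ?(ltW n0)//.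
    by case/andP: p01.
  by rewrite addr_ge0 ?(ltW n0).
rewrite lerBlDl.
have := powR_tangent p01 (addr_ge0 (ltW n0) y0) n0.
rewrite (_ : 1 - s - 1 = - s); last by ring.
by rewrite addrAC subrr add0r mulrAC.
Unshelve. all: by end_near. Qed.

Lemma cvg_hz_partial s x : 0 < s < 1 -> 0 < x < 1 -> cvgn (hz_partial s x).
Proof.
move=> s01 x01; have /andP[x0 x1] := x01.
have p0 : 1 - s != 0 by lra.
(* The two halves have n + 1 and n terms, so their counterterms are powers of n + 1 + x and n + 1 -
   x; each differs from n^(1 - s) by a null sequence. *)
pose f n := hurwitz_partial s x n.+1 + hurwitz_partial s (1 - x) n
  + ((n%:R + (1 + x)) `^ (1 - s) - n%:R `^ (1 - s)) / (1 - s)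
  + ((n%:R + (1 - x)) `^ (1 - s) - n%:R `^ (1 - s)) / (1 - s).
have -> : hz_partial s x = f.
  apply/funext => n; rewrite hz_partialE// /f /hurwitz_partial.
  have -> : n.+1%:R + x = n%:R + (1 + x) by rewrite -natr1; ring.
  by field.
rewrite /f.
apply: is_cvgD; last first.
  apply: is_cvgM; last exact: is_cvg_cst.
  by apply/cvg_ex; exists 0; apply: cvg_shifted_powR_diff => //; lra.
apply: is_cvgD; last first.
  apply: is_cvgM; last exact: is_cvg_cst.
  by apply/cvg_ex; exists 0; apply: cvg_shifted_powR_diff => //; lra.
apply: is_cvgD; last by apply: cvg_hurwitz_partial => //; lra.
have /cvg_ex[l hl] := cvg_hurwitz_partial s01 x0.
by apply/cvg_ex; exists l; rewrite (cvg_shiftS (hurwitz_partial s x)).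
Qed.

(** The quadratic gain comes from the single term x^(-s) of the series; all others, including the
    reflected ones, contribute plain convexity. The gain does not depend on n, so it survives the
    limit. *)
Lemma gfun_midpoint_convex s a b r : 0 < s < 1 ->
  0 < a < 1 -> 0 < b < 1 -> a <= r -> b <= r ->
  2 * gfun s ((a + b) / 2) + s ^+ 2 / 2 * r `^ (- s - 2) * (a - b) ^+ 2
    <= gfun s a + gfun s b.
Proof.
move=> s01 a01 b01 ar br.
have m01 : 0 < (a + b) / 2 < 1 by lra.
set m := (a + b) / 2 in m01 *.
have ca := cvg_hz_partial s01 a01; have cb := cvg_hz_partial s01 b01.
have cm := cvg_hz_partial s01 m01.
have comb (u v w : nat -> R) (x y z : R) : u @ \oo --> x -> v @ \oo --> y -> w @ \oo --> z ->
    (fun n => u n + v n - 2 * w n) @ \oo --> x + y - 2 * z.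
  by move=> ux vy wz; apply: cvgB; [exact: cvgD|apply: cvgM => //; exact: cvg_cst].
have cD := comb _ _ _ _ _ _ ca cb cm.
rewrite -lerBrDl; apply: (cvgr_to_ge cD); apply: nearW => n.
rewrite !hz_partialE//.
set c := _ * n%:R `^ _; set d := _ * (a - b) ^+ 2.
have conv u v : 0 < u -> 0 < v -> 2 * ((u + v) / 2) `^ (- s) <= u `^ (- s) + v `^ (- s).
  move=> u0 v0; have := @powRN_midpoint_convex R s u v (Num.max u v) s01.
  rewrite u0 v0 !le_max !lexx orbT => /(_ isT isT); apply: le_trans.
  rewrite lerDl; apply: mulr_ge0; last exact: sqr_ge0.
  by apply: mulr_ge0; [apply: divr_ge0 => //; exact: sqr_ge0|exact: powR_ge0].
have h1 : d + 2 * \sum_(0 <= k < n.+1) (k%:R + m) `^ (- s) <=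
    \sum_(0 <= k < n.+1) (k%:R + a) `^ (- s) + \sum_(0 <= k < n.+1) (k%:R + b) `^ (- s).
  rewrite !big_nat_recl//= !add0r.
  have h0 : d + 2 * m `^ (- s) <= a `^ (- s) + b `^ (- s).
    by rewrite addrC; apply: powRN_midpoint_convex => //; lra.
  have hs : 2 * \sum_(0 <= k < n) (k.+1%:R + m) `^ (- s) <=
    \sum_(0 <= k < n) (k.+1%:R + a) `^ (- s) + \sum_(0 <= k < n) (k.+1%:R + b) `^ (- s).
    rewrite mulr_sumr -big_split/=; apply: ler_sum => k _.
    have := @conv (k.+1%:R + a) (k.+1%:R + b).
    have -> : (k.+1%:R + a + (k.+1%:R + b)) / 2 = k.+1%:R + m by rewrite /m; field.
    by apply; rewrite ltr_wpDl//; lra.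
  lra.
have h2 : 2 * \sum_(0 <= k < n) (k%:R + (1 - m)) `^ (- s) <=
    \sum_(0 <= k < n) (k%:R + (1 - a)) `^ (- s) + \sum_(0 <= k < n) (k%:R + (1 - b)) `^ (- s).
  rewrite mulr_sumr -big_split/=; apply: ler_sum => k _.
  have := @conv (k%:R + (1 - a)) (k%:R + (1 - b)).
  have -> : (k%:R + (1 - a) + (k%:R + (1 - b))) / 2 = k%:R + (1 - m) by rewrite /m; field.
  by apply; rewrite ltr_wpDl//; lra.
lra.
Qed.

Lemma gfun_midpoint_le s a b : 0 < s < 1 -> 0 < a < 1 -> 0 < b < 1 ->
  2 * gfun s ((a + b) / 2) <= gfun s a + gfun s b.
Proof.
move=> s01 a01 b01.
have a1 : a <= 1 by lra.
have b1 : b <= 1 by lra.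
have := gfun_midpoint_convex s01 a01 b01 a1 b1.
have : 0 <= s ^+ 2 / 2 * 1 `^ (- s - 2) * (a - b) ^+ 2.
  apply: mulr_ge0; last exact: sqr_ge0.
  by apply: mulr_ge0; [apply: divr_ge0 => //; exact: sqr_ge0|exact: powR_ge0].
by move=> x0; apply: le_trans; rewrite lerDl.
Qed.

Lemma measurable_hz_partial s n : measurable_fun setT (fun x : R => hz_partial s x n).
Proof.
apply: measurable_funB; last exact: measurable_cst.
apply: measurable_sum => j.
apply: (@measurableT_comp _ _ _ _ _ _ (@powR R ^~ (- s))); first exact: measurable_powR.
apply: measurableT_comp => //.
exact: measurable_funD.
Qed.

Lemma measurable_gfun s : 0 < s < 1 -> measurable_fun (`]0, 1[%classic : set R) (gfun s).
Proof.
move=> s01; apply: (@measurable_fun_cvg _ _ _ _ (fun n x => hz_partial s x n)) => //.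
- by move=> n; apply: measurable_funTS; exact: measurable_hz_partial.
- by move=> x /=; rewrite in_itv/= => x01; exact: cvg_hz_partial.
Qed.

Lemma trep_ge0 x : 0 <= trep x.
Proof. by rewrite /trep subr_ge0 floor_le. Qed.

Lemma trep_lt1 x : trep x < 1.
Proof. by rewrite /trep ltrBlDl -[X in _ + X]/(1%:~R) -intrD floorD1_gt. Qed.

Lemma trepDz x (m : int) : trep (x + m%:~R) = trep x.
Proof.
rewrite /trep (@floor_def _ (x + m%:~R) (Num.floor x + m)) ?intrD; first by ring.
by have := floor_itv x; rewrite !intrD; lra.
Qed.

Lemma trep_id x : 0 <= x < 1 -> trep x = x.
Proof.
by move=> x01; rewrite /trep (@floor_def _ x 0) ?subr0// add0r mulr0z.
Qed.

Lemma trep_eq x y (m : int) : 0 <= y < 1 -> x = y + m%:~R -> trep x = y.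
Proof. by move=> y01 ->; rewrite trepDz trep_id. Qed.

Lemma trepE x : x = trep x + (Num.floor x)%:~R.
Proof. by rewrite /trep subrK. Qed.

Lemma trep_trepD x y : trep (trep x + y) = trep (x + y).
Proof.
by rewrite -(trepDz (trep x + y) (Num.floor x)) addrAC -trepE.
Qed.

Lemma trep_Dtrep x y : trep (x + trep y) = trep (x + y).
Proof. by rewrite addrC trep_trepD addrC. Qed.

Lemma trep_Ntrep x : trep (- trep x) = trep (- x).
Proof.
rewrite -(trepDz (- trep x) (- Num.floor x)) mulrNz -opprD.
by rewrite -trepE.
Qed.

Lemma trep_Btrep x y : trep (trep x - trep y) = trep (x - y).
Proof. by rewrite trep_trepD -trep_Dtrep trep_Ntrep trep_Dtrep. Qed.

Lemma trepD x y : trep (x + y) =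
  if trep x + trep y < 1 then trep x + trep y else trep x + trep y - 1.
Proof.
have := trep_ge0 x; have := trep_ge0 y; have := trep_lt1 x; have := trep_lt1 y.
rewrite -trep_trepD -trep_Dtrep => ? ? ? ?; case: ifPn => h.
  by apply: trep_id; lra.
by apply: (@trep_eq _ _ 1%Z); [lra|rewrite /=; lra].
Qed.

Lemma trepB x y : trep (x - y) =
  if trep y <= trep x then trep x - trep y else trep x - trep y + 1.
Proof.
have := trep_ge0 x; have := trep_ge0 y; have := trep_lt1 x; have := trep_lt1 y.
rewrite -trep_Btrep => ? ? ? ?; case: ifPn => h.
  by apply: trep_id; lra.
by apply: (@trep_eq _ _ (-1)%Z); [lra|rewrite mulrN1z; lra].
Qed.

Lemma measurable_trep : measurable_fun setT (@trep R).
Proof.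
apply: measurable_funB => //.
apply: nondecreasing_measurable => // x y xy.
by rewrite ler_int le_floor.
Qed.

Lemma measurable_gT s : 0 < s < 1 -> measurable_fun setT (gT s : R -> R).
Proof.
move=> s01.
(* Convergence is known on the open interval only, so the value at integers is split off as a
   constant. *)
have -> : gT s = fun x : R => if trep x == 0 then gfun s 0 else
   ((gfun s : R -> R) \_ `]0, 1[%classic) (trep x).
  apply/funext => x; rewrite /gT; case: eqVneq => [->//|x0].
  by rewrite patchE mem_set//= in_itv/= lt_neqAle eq_sym x0 trep_ge0 trep_lt1.
apply: measurable_fun_ifT.
- by apply: measurable_fun_eqr => //; exact: measurable_trep.
- exact: measurable_cst.
- apply: measurableT_comp; last exact: measurable_trep.
  apply/(measurable_restrictT (gfun s)) => //; last exact: measurable_gfun.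
Qed.

End FundamentalSolution.

(** * Iterated integrals over the unit cube *)

Section UnitIntervalIntegral.
Context {R : realType}.
Local Open Scope ereal_scope.
Local Notation mu := (@lebesgue_measure R).

Definition I01 : set (measurableTypeR R) := [set y : R | (0 <= y < 1)%R].

Lemma I01E : I01 = `[0%R, 1%R[%classic.
Proof. by apply/seteqP; split => x /=; rewrite in_itv. Qed.

Lemma measurable_I01 : measurable I01.
Proof. by rewrite I01E; exact: measurable_itv. Qed.
Hint Resolve measurable_I01 : core.

Lemma measure_I01 : mu I01 = 1.
Proof. by rewrite I01E lebesgue_measure_itv/= lte_fin ltr01 oppr0 adde0. Qed.

Lemma integral_cst_I01 (c : \bar R) : \int[mu]_(x in I01) c = c.
Proof. by rewrite integral_cst// -[RHS]mule1; congr (_ * _); exact: measure_I01. Qed.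

Lemma measurable_affine (c a : R) :
  measurable_fun [set: measurableTypeR R]
    ((fun x => c * x + a)%R : measurableTypeR R -> measurableTypeR R).
Proof.
apply: measurable_funD; last exact: measurable_cst.
by apply: measurable_funM => //; exact: measurable_cst.
Qed.

(** By uniqueness of Lebesgue measure. It is applied with c = 1 for translations and with c = 1/2
    for the halved sets in the Brunn-Minkowski step. *)
Lemma lebesgue_measure_affine (c a : R) (A : set (measurableTypeR R)) :
  (0 < c)%R -> measurable A ->
  mu A = c%:E * mu ((fun x => c * x + a)%R @^-1` A).
Proof.
move=> c0 mA.
pose phi : measurableTypeR R -> measurableTypeR R := (fun x => c * x + a)%R.
have mphi : measurable_fun setT phi by exact: measurable_affine.
pose mphi_mixin := isMeasurableFun.Build _ _ _ _ _ mphi.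
pose mphi_pack : {mfun _ >-> _} := HB.pack phi mphi_mixin.
have cge : (0 <= c)%R by exact: ltW.
rewrite (lebesgue_measure_unique (mu :=
  mscale (NngNum cge) (pushforward mu mphi_pack)))// => _ [[x y] _ <-] /=.
rewrite /mscale/= /pushforward/=.
rewrite [X in _ = _ * mu X](_ : _ = `](x - a) / c, (y - a) / c]%classic)%R; last first.
  apply/seteqP; split => z /=; rewrite /phi !in_itv/= ltr_pdivrMr// ler_pdivlMr//;
  by rewrite ltrBlDr lerBrDr (mulrC z).
rewrite !lebesgue_measure_itv/= !lte_fin ltr_pM2r ?invr_gt0// ltrD2r.
case: ifPn => xy; last by rewrite mule0.
by rewrite -!EFinB -EFinM; congr EFin; field; rewrite gt_eqF.
Qed.

Lemma ge0_integral_shift (a : R) (D : set (measurableTypeR R)) (f : R -> \bar R) :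
  measurable D -> measurable_fun [set: measurableTypeR R] f -> (forall x, 0 <= f x) ->
  \int[mu]_(y in D) f y = \int[mu]_(x in (fun x => x + a)%R @^-1` D) f (x + a)%R.
Proof.
move=> mD mf f0.
pose phi : measurableTypeR R -> measurableTypeR R := (fun x => 1 * x + a)%R.
have mphi : measurable_fun setT phi by exact: measurable_affine.
pose mphi_mixin := isMeasurableFun.Build _ _ _ _ _ mphi.
pose mphi_pack : {mfun _ >-> _} := HB.pack phi mphi_mixin.
rewrite (@eq_measure_integral _ _ _ _ (pushforward mu mphi_pack)); last first.
  by move=> A mA _; have := lebesgue_measure_affine a ltr01 mA; rewrite mul1e.
rewrite (ge0_integral_pushforward mphi)//; last exact: measurable_funTS.
have -> : phi = (fun x => x + a)%R by apply/funext => x; rewrite /phi mul1r.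
by [].
Qed.

(** Rotation invariance on the circle: after a cut at [trep c], the rotation is a pair of
    translations that exchange the two pieces of the unit interval. *)
Lemma ge0_integral_trep (c : R) (f : R -> \bar R) :
  measurable_fun [set: measurableTypeR R] f -> (forall x, 0 <= f x) ->
  \int[mu]_(x in I01) f (trep (x - c)) = \int[mu]_(x in I01) f x.
Proof.
move=> mf f0; set r := trep c.
have r0 : (0 <= r)%R by exact: trep_ge0.
have r1 : (r < 1)%R by exact: trep_lt1.
have split_ (u : R) (g : R -> \bar R) : (0 <= u <= 1)%R ->
    measurable_fun [set: measurableTypeR R] g -> (forall x, 0 <= g x) ->
    \int[mu]_(x in I01) g x =
    \int[mu]_(x in `[0%R, u[%classic) g x + \int[mu]_(x in `[u, 1%R[%classic) g x.
  move=> /andP[u0 u1] mg g0.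
  have -> : I01 = `[0%R, u[%classic `|` `[u, 1%R[%classic.
    apply/seteqP; split => x /=; rewrite /I01/= !in_itv/=.
      by case: (ltrP x u) => xu /andP[-> ->]; [left|right].
    case=> /andP[h1 h2]; apply/andP; split => //; first exact: lt_le_trans u1.
    exact: le_trans h1.
  rewrite ge0_integral_setU//; first exact: measurable_funTS.
  apply/eqP; rewrite -subset0 => x [] /=; rewrite !in_itv/=.
  by move=> /andP[_ xu] /andP[ux _]; have := lt_le_trans xu ux; rewrite ltxx.
have mft : measurable_fun [set: measurableTypeR R] (fun x => f (trep (x - c))).
  apply: measurableT_comp => //; apply: (measurableT_comp measurable_trep).
  by apply: measurable_funB => //; exact: measurable_cst.
rewrite (split_ r)//; last by rewrite r0 ltW.
rewrite (split_ (1 - r)%R f)//; last by lra.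
rewrite addeC; congr (_ + _).
- rewrite (@ge0_integral_shift (- r)%R `[0%R, (1 - r)%R[%classic f)//.
  rewrite (_ : _ @^-1` `[0%R, (1 - r)%R[ = `[r, 1%R[%classic); last first.
    by apply/seteqP; split => x /=; rewrite !in_itv/= => h; lra.
  apply: eq_integral => x; rewrite inE/= in_itv/= => xr.
  by congr f; rewrite trepB (trep_id (x := x)) -/r; [case/andP: xr => ->|lra].
- rewrite (@ge0_integral_shift (1 - r)%R `[(1 - r)%R, 1%R[%classic f)//.
  rewrite (_ : _ @^-1` `[(1 - r)%R, 1%R[ = `[0%R, r[%classic); last first.
    by apply/seteqP; split => x /=; rewrite !in_itv/= => h; lra.
  apply: eq_integral => x; rewrite inE/= in_itv/= => xr.
  congr f; rewrite trepB (trep_id (x := x)) -/r; last by lra.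
  by rewrite leNgt; case/andP: xr => _ -> /=; ring.
Qed.

Lemma measurable_integral_I01 d (T : measurableType d) (f : T * measurableTypeR R -> \bar R) :
  measurable_fun setT f -> (forall z, 0 <= f z) ->
  measurable_fun setT (fun t => \int[mu]_(x in I01) f (t, x)).
Proof.
move=> mf f0.
pose g (z : T * measurableTypeR R) := if z.2 \in I01 then f z else 0.
have mg : measurable_fun setT g.
  apply: measurable_fun_ifT => //.
  have -> : (fun t : T * measurableTypeR R => t.2 \in I01) =
    (fun t => (0 <= t.2 < 1)%R).
    by apply/funext => t; apply/idP/idP; rewrite inE.
  apply: measurable_and.
    by apply: measurable_fun_ler => //; exact: measurable_cst.
  by apply: measurable_fun_ltr => //; exact: measurable_cst.
have g0 z : 0 <= g z by rewrite /g; case: ifP.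
have := measurable_fun_fubini_tonelli_F (m2 := mu) g mg g0.
apply: eq_measurable_fun => t _; rewrite /fubini_F.
by rewrite [RHS]integral_mkcond; apply: eq_integral => x _; rewrite patchE.
Qed.

Lemma tonelli_I01 (f : measurableTypeR R * measurableTypeR R -> \bar R) :
  measurable_fun setT f -> (forall z, 0 <= f z) ->
  \int[mu]_(x in I01) \int[mu]_(y in I01) f (x, y) =
  \int[mu]_(y in I01) \int[mu]_(x in I01) f (x, y).
Proof.
move=> mf f0.
have mI (T := (measurableTypeR R * measurableTypeR R)%type) (h : T -> measurableTypeR R) :
    measurable_fun setT h -> measurable_fun setT (fun t => h t \in I01).
  move=> mh; have -> : (fun t => h t \in I01) = (fun t => (0 <= h t < 1)%R).
    by apply/funext => t; apply/idP/idP; rewrite inE.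
  apply: measurable_and.
    by apply: measurable_fun_ler => //; exact: measurable_cst.
  by apply: measurable_fun_ltr => //; exact: measurable_cst.
pose g (z : measurableTypeR R * measurableTypeR R) :=
  if (z.1 \in I01) && (z.2 \in I01) then f z else 0.
have mg : measurable_fun setT g.
  by apply: measurable_fun_ifT => //; apply: measurable_and; exact: mI.
have g0 z : 0 <= g z by rewrite /g; case: ifP.
have := fubini_tonelli (m1 := mu) (m2 := mu) g mg g0.
have e1 : \int[mu]_x \int[mu]_y g (x, y) = \int[mu]_(x in I01) \int[mu]_(y in I01) f (x, y).
  rewrite [RHS]integral_mkcond; apply: eq_integral => x _; rewrite patchE.
  case: ifPn => xI; last first.
    by apply: integral0_eq => y _; rewrite /g/= (negbTE xI).
  rewrite [RHS]integral_mkcond; apply: eq_integral => y _; rewrite patchE.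
  by rewrite /g/= xI.
have e2 : \int[mu]_y \int[mu]_x g (x, y) = \int[mu]_(y in I01) \int[mu]_(x in I01) f (x, y).
  rewrite [RHS]integral_mkcond; apply: eq_integral => y _; rewrite patchE.
  case: ifPn => yI; last first.
    by apply: integral0_eq => x _; rewrite /g/= (negbTE yI) andbF.
  rewrite [RHS]integral_mkcond; apply: eq_integral => x _; rewrite patchE.
  by rewrite /g/= yI andbT.
by rewrite e1 e2.
Qed.

End UnitIntervalIntegral.
#[export] Hint Resolve measurable_I01 : core.

Section IteratedIntegral.
Context {R : realType}.
Local Open Scope ereal_scope.
Local Notation mu := (@lebesgue_measure R).
Local Notation RR := (measurableTypeR R).

(* Measurability in the first n coordinates, tested on all measurable families
   of coordinates; this avoids any sigma-algebra on sequences. *)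
Definition measurable_seq d' (U : measurableType d') (n : nat) (F : seq R -> U) :=
  forall d (T : measurableType d) (X : nat -> T -> RR),
    (forall i, measurable_fun setT (X i)) ->
    measurable_fun setT (fun w => F (mkseq (fun i => X i w) n)).

Lemma mkseq_cons (T : Type) (f : nat -> T) n : mkseq f n.+1 = f 0%N :: mkseq (fun i => f i.+1) n.
Proof. by rewrite /mkseq/= (iotaDl 1 0 n) -map_comp. Qed.

Lemma measurable_seq_cons d' (U : measurableType d') n (F : seq R -> U) x :
  measurable_seq n.+1 F -> measurable_seq n (fun t => F (x :: t)).
Proof.
move=> mF d T X mX.
pose Y i := if i is j.+1 then X j else cst (x : RR).
have mY i : measurable_fun setT (Y i) by case: i => [|i] //=; exact: measurable_cst.
have := mF d T Y mY; apply: eq_measurable_fun => w _.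
by rewrite mkseq_cons.
Qed.

Lemma iintS n (F : seq R -> \bar R) :
  iint n.+1 F = \int[mu]_(x in I01) iint n (fun t => F (x :: t)).
Proof. by []. Qed.

Lemma iint_ge0 n (F : seq R -> \bar R) : (forall X, 0 <= F X) -> 0 <= iint n F.
Proof. by elim: n F => [|n IH] F F0 //=; apply: integral_ge0 => x _; exact: IH. Qed.

(** The parameter t has an arbitrary type because the induction moves the first integration variable
    into it. *)
Lemma measurable_iint n d (T : measurableType d) (F : T -> seq R -> \bar R) :
  (forall t X, 0 <= F t X) ->
  (forall d' (T' : measurableType d') (a : T' -> T) (X : nat -> T' -> RR),
    measurable_fun setT a -> (forall i, measurable_fun setT (X i)) ->
    measurable_fun setT (fun w => F (a w) (mkseq (fun i => X i w) n))) ->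
  measurable_fun setT (fun t => iint n (F t)).
Proof.
elim: n d T F => [|n IH] d T F F0 mF /=.
  by have := mF d T idfun (fun _ => cst (0%R : RR)) (@measurable_id _ _ _) (fun _ => measurable_cst _).
pose G (z : T * RR) (s : seq R) := F z.1 (z.2 :: s).
apply: (@measurable_integral_I01 _ _ _ (fun z : T * RR => iint n (G z))); last first.
  by move=> z; apply: iint_ge0 => X; exact: F0.
apply: IH => [t X|d' T' a X ma mX]; first exact: F0.
pose Y i := if i is j.+1 then X j else (fun w => (a w).2 : RR).
have mY i : measurable_fun setT (Y i).
  by case: i => [|i] //=; exact: measurableT_comp.
have := mF d' T' (fun w => (a w).1) Y (measurableT_comp measurable_fst ma) mY.
by apply: eq_measurable_fun => w _; rewrite mkseq_cons.
Qed.

Lemma measurable_iint_cons n (F : seq R -> \bar R) :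
  measurable_seq n.+1 F -> (forall X, 0 <= F X) ->
  measurable_fun [set: RR] (fun x => iint n (fun t => F (x :: t))).
Proof.
move=> mF F0; apply: (@measurable_iint n _ RR (fun x t => F (x :: t))) => //.
move=> d' T' a X ma mX.
pose Y i := if i is j.+1 then X j else (a : T' -> RR).
have mY i : measurable_fun setT (Y i) by case: i.
by have := mF d' T' Y mY; apply: eq_measurable_fun => w _; rewrite mkseq_cons.
Qed.

Lemma eq_iint n (F G : seq R -> \bar R) :
  (forall X, size X = n -> all (fun x => (0 <= x < 1)%R) X -> F X = G X) ->
  iint n F = iint n G.
Proof.
elim: n F G => [|n IH] F G FG /=; first exact: FG.
apply: eq_integral => x; rewrite inE /= => x01; apply: IH => X sX aX.
by apply: FG => /=; rewrite ?sX// x01.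
Qed.

Lemma le_iint n (F G : seq R -> \bar R) :
  measurable_seq n F -> measurable_seq n G -> (forall X, 0 <= F X) ->
  (forall X, 0 <= G X) ->
  (forall X, size X = n -> all (fun x => (0 <= x < 1)%R) X -> F X <= G X) ->
  iint n F <= iint n G.
Proof.
elim: n F G => [|n IH] F G mF mG F0 G0 FG; [exact: FG|rewrite !iintS].
apply: ge0_le_integral => //.
- by move=> x _; exact: iint_ge0.
- by apply: measurable_funTS; exact: measurable_iint_cons.
- by apply: measurable_funTS; exact: measurable_iint_cons.
move=> x x01; apply: IH => //; try exact: measurable_seq_cons.
by move=> X sX aX; apply: FG => /=; rewrite ?sX// x01.
Qed.

Lemma iint_cst n (c : R) : (0 <= c)%R -> iint n (fun _ => c%:E) = c%:E.
Proof.
move=> c0; elim: n => [//|n IH]; rewrite iintS.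
under eq_integral do rewrite IH.
by rewrite integral_cst_I01.
Qed.

Lemma iintD n (F G : seq R -> \bar R) :
  measurable_seq n F -> measurable_seq n G -> (forall X, 0 <= F X) ->
  (forall X, 0 <= G X) ->
  iint n (fun X => F X + G X) = iint n F + iint n G.
Proof.
elim: n F G => [//|n IH] F G mF mG F0 G0; rewrite !iintS.
rewrite -ge0_integralD//.
- apply: eq_integral => x _; apply: IH => //; exact: measurable_seq_cons.
- by move=> x _; exact: iint_ge0.
- by apply: measurable_funTS; exact: measurable_iint_cons.
- by move=> x _; exact: iint_ge0.
- by apply: measurable_funTS; exact: measurable_iint_cons.
Qed.

Lemma iintZ n (c : R) (F : seq R -> \bar R) : (0 <= c)%R ->
  measurable_seq n F -> (forall X, 0 <= F X) ->
  iint n (fun X => c%:E * F X) = c%:E * iint n F.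
Proof.
move=> c0; elim: n F => [//|n IH] F mF F0; rewrite !iintS.
rewrite -ge0_integralZl//.
- apply: eq_integral => x _; apply: IH => //; exact: measurable_seq_cons.
- by apply: measurable_funTS; exact: measurable_iint_cons.
- by move=> x _; exact: iint_ge0.
Qed.

(** One exchange of the first two integrations moves x past y; the induction hypothesis on the
    remaining coordinates carries it to the end. *)
Lemma iint_rot n (F : seq R -> \bar R) :
  measurable_seq n.+1 F -> (forall X, 0 <= F X) ->
  iint n.+1 (fun X => F (rot 1 X)) = iint n.+1 F.
Proof.
elim: n F => [|n IH] F mF F0 //=.
transitivity (\int[mu]_(y in I01) \int[mu]_(x in I01)
    iint n (fun t => F (y :: rcons t x))).
  rewrite -(@tonelli_I01 _ (fun z => iint n (fun t => F (z.2 :: rcons t z.1)))).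
  - apply: eq_integral => x _; apply: eq_integral => y _.
    by apply: eq_iint => X _ _; rewrite rot1_cons.
  - apply: (@measurable_iint n _ (RR * RR)%type (fun z t => F (z.2 :: rcons t z.1))) => //.
    move=> d' T' a X ma mX.
    pose Y i := if i is j.+1 then (if (j < n)%N then X j else (fun w => (a w).1 : RR))
      else (fun w => (a w).2 : RR).
    have mY i : measurable_fun setT (Y i).
      by case: i => [|i] //=; [|case: ifP => _ //]; exact: measurableT_comp.
    have := mF d' T' Y mY; apply: eq_measurable_fun => w _; congr F.
    rewrite mkseq_cons /=; congr (_ :: _).
    rewrite /mkseq -addn1 iotaD/= map_cat/= cats1 add0n ltnn; congr rcons.
    by apply/eq_in_map => i; rewrite mem_iota add0n => /andP[_ ->].
  - by move=> z; exact: iint_ge0.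
apply: eq_integral => y _.
rewrite -[RHS](IH (fun t => F (y :: t)))//; last exact: measurable_seq_cons.
by rewrite /=; apply: eq_integral => x _; apply: eq_iint => t _ _; rewrite rot1_cons.
Qed.

Lemma iint_rcons n (F : seq R -> \bar R) :
  iint n.+1 F = iint n (fun t => \int[mu]_(x in I01) F (rcons t x)).
Proof.
elim: n F => [//|n IH] F.
transitivity (\int[mu]_(x in I01) iint n.+1 (fun t => F (x :: t))); first by [].
by rewrite [RHS]/=; apply: eq_integral => x _; rewrite IH.
Qed.

Lemma iint_trep n (c : R) (F : seq R -> \bar R) :
  measurable_seq n F -> (forall X, 0 <= F X) ->
  iint n (fun t => F (map (fun x => trep (x - c)) t)) = iint n F.
Proof.
elim: n F => [//|n IH] F mF F0 /=.
rewrite -[RHS](@ge0_integral_trep R c).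
- apply: eq_integral => x _.
  by rewrite -(IH (fun t => F (trep (x - c) :: t)))//; exact: measurable_seq_cons.
- exact: measurable_iint_cons.
- by move=> x; exact: iint_ge0.
Qed.

(** Supplies the positivity of the partition function. If the outer integral vanished, the inner one
    would vanish almost everywhere, against its positivity on a whole interval. *)
Lemma iint_gt0 n (a b : nat -> R) (F : seq R -> \bar R) :
  measurable_seq n F -> (forall X, 0 <= F X) ->
  (forall j, (j < n)%N -> (0 <= a j)%R /\ (a j < b j)%R /\ (b j <= 1)%R) ->
  (forall X, size X = n ->
     (forall j, (j < n)%N -> (a j <= nth 0 X j < b j)%R) -> 0 < F X) ->
  0 < iint n F.
Proof.
elim: n a b F => [|n IH] a b F mF F0 ab FP /=; first exact: FP.
have [a0 [a0b0 b1]] := ab 0%N isT.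
have pos x : (a 0%N <= x < b 0%N)%R -> 0 < iint n (fun t => F (x :: t)).
  move=> xab; apply: (IH (fun j => a j.+1) (fun j => b j.+1)) => //.
  - exact: measurable_seq_cons.
  - by move=> j jn; apply: (ab j.+1).
  - move=> X sX Xab; apply: FP => /=; first by rewrite sX.
    by case=> [|j] jn //=; apply: Xab.
have mG : measurable_fun [set: RR] (fun x => iint n (fun t => F (x :: t))).
  exact: measurable_iint_cons.
rewrite lt0e integral_ge0 ?andbT; last by move=> x _; exact: iint_ge0.
apply/eqP => I0.
have : \int[mu]_(x in I01) `|iint n (fun t => F (x :: t))| = 0.
  by rewrite -I0; apply: eq_integral => x _; rewrite gee0_abs// iint_ge0.
move/ae_eq_integral_abs => /(_ measurable_I01 (measurable_funTS mG)) [N [mN N0 subN]].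
have : mu `[a 0%N, b 0%N[%classic <= mu N.
  apply: le_measure; rewrite ?inE; [exact: measurable_itv|exact: mN|].
  move=> x /=; rewrite in_itv/= => xab; apply: subN => /= h.
  have x01 : I01 x by rewrite /I01/=; lra.
  by have := pos x xab; rewrite h// ltxx.
by rewrite N0 lebesgue_measure_itv/= lte_fin a0b0 -EFinB lee_fin leNgt subr_gt0 a0b0.
Qed.

End IteratedIntegral.

(** * The Prekopa-Leindler inequality *)

Section PrekopaLeindler.
Context {R : realType}.
Local Open Scope ereal_scope.
Local Notation mu := (@lebesgue_measure R).
Local Notation RR := (measurableTypeR R).

(* A translate of A by a near-minimal point of B and a translate of B by a
   near-maximal point of A overlap in essentially one point. *)
Lemma brunn_minkowski_I01 (A B C : set RR) :
  measurable A -> measurable B -> measurable C ->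
  A `<=` I01 -> B `<=` I01 -> A !=set0 -> B !=set0 ->
  (forall a b, A a -> B b -> C ((a + b) / 2)%R) ->
  mu A + mu B <= 2%:E * mu C.
Proof.
move=> mA mB mC AI BI [a0 Aa0] [b0 Bb0] AB.
have supA : has_sup A by split; [exists a0|exists 1%R => x /AI /=; rewrite /I01/=; lra].
have infB : has_inf B by split; [exists b0|exists 0%R => x /BI /=; rewrite /I01/=; lra].
apply/lee_addgt0Pr => e e0.
have e20 : (0 < e / 2)%R by rewrite divr_gt0.
have [a1 Aa1 a1s] := sup_adherent e20 supA.
have [b1 Bb1 b1s] := inf_adherent e20 infB.
pose m := ((a1 + b1) / 2)%R.
(* Averages of [A1] with [b1] lie to the left of [m], averages of [a1] with [B1] at or to the right
   of it, so the two halved copies sit in disjoint parts of [C]. Cutting [A] at [a1] and [B] at [b1]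
   costs at most [e / 2] each. *)
pose A1 := A `&` `]-oo, a1[%classic; pose B1 := B `&` `[b1, +oo[%classic.
pose C1 := C `&` `]-oo, m[%classic; pose C2 := C `&` `[m, +oo[%classic.
have mA1 : measurable A1 by apply: measurableI => //; exact: measurable_itv.
have mB1 : measurable B1 by apply: measurableI => //; exact: measurable_itv.
have mC1 : measurable C1 by apply: measurableI => //; exact: measurable_itv.
have mC2 : measurable C2 by apply: measurableI => //; exact: measurable_itv.
have CE : mu C = mu C1 + mu C2.
  rewrite -measureU//.
    congr (mu _); rewrite /C1 /C2 -setIUr; apply/seteqP; split => x /=; last by case.
    move=> Cx; split => //; rewrite !in_itv/= andbT.
    by case: (ltrP x m) => _; [left|right].
  rewrite -subset0 => x [[_ h1] [_ h2]].
  have h1' : (x : R) \in `]-oo, m[ by exact: h1.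
  have h2' : (x : R) \in `[m, +oo[ by exact: h2.
  by move: h1' h2'; rewrite !in_itv/= andbT => xm; rewrite leNgt xm.
have h2 : (0 < 2^-1 :> R)%R by rewrite invr_gt0.
have pre (c : R) (D : set RR) : measurable D ->
    measurable ((fun x => 2^-1 * x + c)%R @^-1` D).
  by move=> mD; rewrite -[X in measurable X]setTI; apply: measurable_affine.
have double (D : set RR) (c : R) : measurable D ->
    mu ((fun x => 2^-1 * x + c)%R @^-1` D) = 2%:E * mu D.
  move=> mD; rewrite [in RHS](lebesgue_measure_affine c h2 mD) muleA -EFinM.
  by rewrite divff// mul1e.
have A1C : mu A1 <= 2%:E * mu C1.
  rewrite -(double _ (2^-1 * b1)%R)//; apply: le_measure; rewrite ?inE; [exact: mA1|exact: pre|].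
  move=> x [Ax]; rewrite /= in_itv/= => xa; rewrite -mulrDr mulrC; split; first exact: AB.
  by rewrite /= in_itv/= /m; lra.
have B1C : mu B1 <= 2%:E * mu C2.
  rewrite -(double _ (2^-1 * a1)%R)//; apply: le_measure; rewrite ?inE; [exact: mB1|exact: pre|].
  move=> x [Bx]; rewrite /= in_itv/= andbT => xa; rewrite -mulrDr mulrC addrC; split; first exact: AB.
  by rewrite /= in_itv/= andbT /m; lra.
have mI (u v : R) : measurable (`[u, v]%classic : set RR) by exact: measurable_itv.
have len (u : R) : mu `[u, (u + e / 2)%R]%classic <= (e / 2)%:E.
  by rewrite lebesgue_measure_itv/= lte_fin ltrDl e20 -EFinB lee_fin; lra.
have AA1 : mu A <= mu A1 + (e / 2)%:E.
  apply: (@le_trans _ _ (mu (A1 `|` `[a1, (a1 + e / 2)%R]%classic))).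
    apply: le_measure; rewrite ?inE; [exact: mA|apply: measurableU => //; exact: measurable_itv|].
    move=> x Ax; case: (ltrP x a1) => xa; [left|right]; rewrite /A1/= ?in_itv//=.
    have := ub_le_sup supA.2 Ax; lra.
  apply: (le_trans (measureU2 _ _ _)) => //.
  by apply: leeD2l; exact: len.
have BB1 : mu B <= mu B1 + (e / 2)%:E.
  apply: (@le_trans _ _ (mu (B1 `|` `[(b1 - e / 2)%R, b1]%classic))).
    apply: le_measure; rewrite ?inE; [exact: mB|apply: measurableU => //; exact: measurable_itv|].
    move=> x Bx; case: (lerP b1 x) => xa; [left|right]; rewrite /B1/= ?in_itv/= ?andbT//.
    have := ge_inf infB.2 Bx; lra.
  apply: (le_trans (measureU2 _ _ _)) => //.
  by apply: leeD2l; have := len (b1 - e / 2)%R; rewrite subrK.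
apply: le_trans (leeD AA1 BB1) _.
rewrite addeACA -EFinD -splitr leeD2r// CE muleDr// ?leeD//.
by rewrite ge0_adde_def// inE.
Qed.

Lemma measurable_bool_EFin d (T : measurableType d) (p : T -> bool) :
  measurable_fun setT p -> measurable_fun setT (fun x => ((p x)%:R : R)%:E).
Proof.
move=> mp; have -> : (fun x => ((p x)%:R : R)%:E) = (fun x => if p x then 1 else 0).
  by apply/funext => x; case: (p x).
by apply: measurable_fun_ifT => //; exact: measurable_cst.
Qed.

Lemma integral_bool_I01 (p : RR -> bool) : measurable [set x | p x] ->
  \int[mu]_(x in I01) ((p x)%:R : R)%:E = mu ([set x | p x] `&` I01).
Proof.
move=> mp; rewrite -integral_indic//; apply: eq_integral => x _.
by congr (EFin (_%:R)); rewrite /= ; congr nat_of_bool; apply/idP/idP; rewrite inE.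
Qed.

(** Levels t range over the unit interval only, hence the minimum with 1, which is inactive for f /
    sup f. *)
Lemma layer_cake_I01 (f : RR -> R) : measurable_fun setT f -> (forall x, (0 <= f x)%R) ->
  \int[mu]_(t in I01) mu ([set x | (t < f x)%R] `&` I01) =
  \int[mu]_(x in I01) (Num.min (f x) 1)%:E.
Proof.
move=> mf f0.
have mlt d (T : measurableType d) (u v : T -> RR) :
    measurable_fun setT u -> measurable_fun setT v ->
    measurable [set x | (u x < v x)%R].
  move=> mu_ mv; have := @measurable_fun_ltr _ T R setT u v mu_ mv measurableT [set true] Logic.I.
  by rewrite setTI.
transitivity (\int[mu]_(t in I01) \int[mu]_(x in I01) ((t < f x)%R%:R : R)%:E).
  by apply: eq_integral => t _; rewrite integral_bool_I01//; apply: mlt.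
rewrite (@tonelli_I01 _ (fun z => ((z.1 < f z.2)%R%:R : R)%:E)).
- apply: eq_integral => x _; rewrite /= integral_bool_I01; last exact: mlt.
  rewrite (_ : _ `&` _ = `[0%R, Num.min (f x) 1%R[%classic); last first.
    apply/seteqP; split => t /=; rewrite /I01/= in_itv/= lt_min; first by move=> [-> /andP[-> ->]].
    by move=> /and3P[-> -> ->].
  rewrite lebesgue_measure_itv/= lte_fin; case: ifPn; first by rewrite oppr0 adde0.
  by rewrite -leNgt => h; congr EFin; apply/eqP; rewrite eq_le h le_min f0 ler01.
- apply: measurable_bool_EFin; apply: measurable_fun_ltr => //.
  by apply: measurableT_comp.
- by move=> z; rewrite lee_fin.
Qed.

(** The superlevel sets of f / sup f and g / sup g are nonempty at every level below 1, so
    Brunn-Minkowski applies level by level. The layer cake formula then gives F / a + G / b <= 2 H /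
    c, and the arithmetic-geometric mean inequality turns the sum into the product. *)
Lemma prekopa_leindler_I01 (f g h : RR -> R) (M : R) :
  measurable_fun setT f -> measurable_fun setT g -> measurable_fun setT h ->
  (forall x, 0 <= f x <= M)%R -> (forall x, 0 <= g x <= M)%R ->
  (forall x, 0 <= h x <= M)%R ->
  (forall x y, I01 x -> I01 y -> f x * g y <= h ((x + y) / 2) ^+ 2)%R ->
  (fine (\int[mu]_(x in I01) (f x)%:E) * fine (\int[mu]_(x in I01) (g x)%:E) <=
    (fine (\int[mu]_(x in I01) (h x)%:E)) ^+ 2)%R.
Proof.
move=> mf mg mh fM gM hM fgh.
have I0 : I01 (0%R : R) by rewrite /I01/= lexx ltr01.
have E_ge0 (k : RR -> R) : (forall x, 0 <= k x <= M)%R -> 0 <= \int[mu]_(x in I01) (k x)%:E.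
  by move=> kM; apply: integral_ge0 => x _; rewrite lee_fin; case/andP: (kM x).
have E_fin (k : RR -> R) : measurable_fun setT k -> (forall x, 0 <= k x <= M)%R ->
    \int[mu]_(x in I01) (k x)%:E \is a fin_num.
  move=> mk kM; rewrite ge0_fin_numE ?E_ge0//.
  apply: (@le_lt_trans _ _ (\int[mu]_(x in I01) M%:E)); last first.
    by rewrite integral_cst_I01 ltry.
  apply: ge0_le_integral => //.
  - by move=> x _; rewrite lee_fin; case/andP: (kM x).
  - by apply/measurable_EFinP; exact: measurable_funTS.
  - by move=> x _; rewrite lee_fin; case/andP: (kM x).
set F := fine (\int[mu]_(x in I01) (f x)%:E); set G := fine (\int[mu]_(x in I01) (g x)%:E).
set H := fine (\int[mu]_(x in I01) (h x)%:E).
have H0 : (0 <= H)%R by exact: fine_ge0 (E_ge0 _ hM).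
pose sp (k : RR -> R) := sup [set k x | x in I01].
have sp_has (k : RR -> R) : (forall x, 0 <= k x <= M)%R -> has_sup [set k x | x in I01].
  move=> kM; split; first by exists (k 0%R), 0%R.
  by exists M => _ [x _ <-]; case/andP: (kM x).
have sp_le (k : RR -> R) x : (forall x, 0 <= k x <= M)%R -> I01 x -> (k x <= sp k)%R.
  by move=> kM Ix; apply: ub_le_sup; [exact: (sp_has _ kM).2|exists x].
have sp0 (k : RR -> R) : (forall x, 0 <= k x <= M)%R -> (0 <= sp k)%R.
  by move=> kM; apply: le_trans (sp_le k 0%R kM I0); case/andP: (kM 0%R).
have zero (k : RR -> R) : (forall x, 0 <= k x <= M)%R -> sp k = 0%R ->
    fine (\int[mu]_(x in I01) (k x)%:E) = 0%R.
  move=> kM sk; rewrite integral0_eq// => x Ix; congr EFin; apply/eqP.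
  by rewrite eq_le -{1}sk sp_le//; case/andP: (kM x).
have [sf|sf] := eqVneq (sp f) 0%R.
  by rewrite /F zero// mul0r exprn_ge0.
have [sg|sg] := eqVneq (sp g) 0%R.
  by rewrite /G (zero g)// mulr0 exprn_ge0.
set a := sp f in sf; set b := sp g in sg.
have a0 : (0 < a)%R by rewrite lt_neqAle eq_sym sf sp0.
have b0 : (0 < b)%R by rewrite lt_neqAle eq_sym sg sp0.
(* The geometric mean is the right scale for h: f > t a and g > t b force h > t c at the
   midpoint. *)
pose c := Num.sqrt (a * b).
have c0 : (0 < c)%R by rewrite sqrtr_gt0 mulr_gt0.
have c2 : (c ^+ 2 = a * b)%R by rewrite sqr_sqrtr// mulr_ge0 ?(ltW a0) ?(ltW b0).
have mdiv (k : RR -> R) (u : R) : measurable_fun setT k -> measurable_fun setT (fun x => k x / u)%R.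
  by move=> mk; apply: measurable_funM => //; exact: measurable_cst.
have mlev (k : RR -> R) (t : R) : measurable_fun setT k -> measurable [set x : RR | (t < k x)%R].
  move=> mk; have := @measurable_fun_ltr _ RR R setT (cst t) k (measurable_cst _) mk measurableT [set true] Logic.I.
  by rewrite setTI.
have div0 (k : RR -> R) u : (forall x, 0 <= k x <= M)%R -> (0 < u)%R -> forall x, (0 <= k x / u)%R.
  by move=> kM u0 x; rewrite divr_ge0 ?(ltW u0)//; case/andP: (kM x).
have BM t : I01 t ->
    mu ([set x | (t < f x / a)%R] `&` I01) + mu ([set x | (t < g x / b)%R] `&` I01) <=
    2%:E * mu ([set x | (t < h x / c)%R] `&` I01).
  move=> /andP[t0 t1].
  have ne (k : RR -> R) : (forall x, 0 <= k x <= M)%R -> (0 < sp k)%R ->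
      [set x | (t < k x / sp k)%R] `&` I01 !=set0.
    move=> kM sk; have t1' : (0 < (1 - t) * sp k)%R by rewrite mulr_gt0// subr_gt0.
    have [_ [x Ix <-] hx] := sup_adherent t1' (sp_has _ kM).
    by exists x; split => //=; rewrite ltr_pdivlMr//; apply: le_lt_trans hx; rewrite -/(sp k); lra.
  apply: brunn_minkowski_I01 => //.
  - by apply: measurableI => //; apply: mlev; exact: mdiv.
  - by apply: measurableI => //; apply: mlev; exact: mdiv.
  - by apply: measurableI => //; apply: mlev; exact: mdiv.
  - exact: ne.
  - exact: ne.
  move=> x y [/= fx Ix] [/= gy Iy]; split; last by move: Ix Iy; rewrite /I01/=; lra.
  rewrite /= ltr_pdivlMr//; have := fgh x y Ix Iy.
  rewrite ltr_pdivlMr// in fx; rewrite ltr_pdivlMr// in gy.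
  rewrite ltNge => hh; apply/negP => hc.
  have tc : (h ((x + y) / 2) ^+ 2 <= (t * c) ^+ 2)%R.
    by rewrite ler_sqr ?nnegrE ?mulr_ge0 ?(ltW c0)//; case/andP: (hM ((x + y) / 2)%R).
  have ta0 : (0 <= t * a)%R by rewrite mulr_ge0 ?(ltW a0).
  have tb0 : (0 <= t * b)%R by rewrite mulr_ge0 ?(ltW b0).
  have := le_trans hh tc; rewrite exprMn c2 => hfin.
  have : ((t * a) * (t * b) < f x * g y)%R by exact: ltr_pM.
  by rewrite ltNge (le_trans hfin)//; rewrite le_eqVlt; apply/orP; left; apply/eqP; ring.
have mlayer (k : RR -> R) : measurable_fun setT k ->
    measurable_fun [set: RR] (fun t => mu ([set x | (t < k x)%R] `&` I01)).
  move=> mk.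
  have := @measurable_integral_I01 R _ RR (fun z => ((z.1 < k z.2)%R%:R : R)%:E).
  have -> : (fun t : RR => \int[mu]_(x in I01) ((t < k x)%R%:R : R)%:E) =
    (fun t => mu ([set x | (t < k x)%R] `&` I01)).
    by apply/funext => t; rewrite integral_bool_I01//; exact: mlev.
  apply; last by move=> z; rewrite lee_fin.
  apply: measurable_bool_EFin; apply: measurable_fun_ltr => //.
  by apply: measurableT_comp.
have key : \int[mu]_(x in I01) (Num.min (f x / a) 1)%:E +
    \int[mu]_(x in I01) (Num.min (g x / b) 1)%:E <=
    2%:E * \int[mu]_(x in I01) (Num.min (h x / c) 1)%:E.
  rewrite -!layer_cake_I01; try (by exact: mdiv); try (by exact: div0).
  rewrite -ge0_integralD//; [|by apply: measurable_funTS; apply: mlayer; exact: mdiv..].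
  rewrite -ge0_integralZl//; [|by apply: measurable_funTS; apply: mlayer; exact: mdiv].
  apply: ge0_le_integral => //.
  - by move=> t _; rewrite adde_ge0.
  - by apply: emeasurable_funD; apply: measurable_funTS; apply: mlayer; exact: mdiv.
  - by apply: measurable_funeM; apply: measurable_funTS; apply: mlayer; exact: mdiv.
have EZ (k : RR -> R) (u : R) : measurable_fun setT k -> (forall x, 0 <= k x <= M)%R ->
    (0 < u)%R -> \int[mu]_(x in I01) (k x / u)%:E =
      (fine (\int[mu]_(x in I01) (k x)%:E) / u)%:E.
  move=> mk kM u0; rewrite mulrC EFinM fineK ?E_fin// -ge0_integralZl//.
  - by apply: eq_integral => x _; rewrite -EFinM mulrC.
  - by apply/measurable_EFinP; exact: measurable_funTS.
  - by move=> x _; rewrite lee_fin; case/andP: (kM x).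
  - by rewrite lee_fin invr_ge0 ltW.
have min1 (k : RR -> R) : (forall x, 0 <= k x <= M)%R -> (0 < sp k)%R ->
   \int[mu]_(x in I01) (Num.min (k x / sp k) 1)%:E = \int[mu]_(x in I01) (k x / sp k)%:E.
  move=> kM sk; apply: eq_integral => x; rewrite inE => Ix; congr EFin.
  by apply/min_idPl; rewrite ler_pdivrMr// mul1r sp_le.
move: key; rewrite (min1 f)// (min1 g)// EZ// EZ//.
have minh : \int[mu]_(x in I01) (Num.min (h x / c) 1)%:E <= (H / c)%:E.
  rewrite -EZ//; apply: ge0_le_integral => //.
  - by move=> x _; rewrite lee_fin le_min ler01 div0.
  - apply/measurable_EFinP; apply: measurable_funTS; apply: measurable_minr; first exact: mdiv.
    exact: measurable_cst.
  - by apply/measurable_EFinP; apply: measurable_funTS; exact: mdiv.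
  - by move=> x _; rewrite lee_fin ge_min lexx.
move=> /le_trans-/(_ _ (lee_wpmul2l _ minh)); rewrite -EFinM -EFinD -/F -/G -/a -/b => key.
have {}key := key (ler0n _ 2); rewrite lee_fin in key.
have F0 : (0 <= F)%R by exact: fine_ge0 (E_ge0 _ fM).
have G0 : (0 <= G)%R by exact: fine_ge0 (E_ge0 _ gM).
have h1 : ((F / a + G / b) ^+ 2 <= (2 * (H / c)) ^+ 2)%R.
  have ? : (0 <= F / a)%R by rewrite divr_ge0 ?(ltW a0).
  have ? : (0 <= G / b)%R by rewrite divr_ge0 ?(ltW b0).
  have ? : (0 <= H / c)%R by rewrite divr_ge0 ?(ltW c0).
  by rewrite ler_sqr// nnegrE; lra.
have h3 : (4 * (F * G / (a * b)) <= 4 * (H ^+ 2 / (a * b)))%R.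
  have -> : (4 * (H ^+ 2 / (a * b)) = (2 * (H / c)) ^+ 2)%R.
    by rewrite exprMn expr_div_n c2; field; rewrite sf sg.
  apply: le_trans h1.
  have : (0 <= (F / a - G / b) ^+ 2)%R by exact: sqr_ge0.
  have -> : (F * G / (a * b) = (F / a) * (G / b))%R by field; rewrite sf sg.
  lra.
by move: h3; rewrite ler_pM2l// ler_pM2r// invr_gt0 mulr_gt0.
Qed.

End PrekopaLeindler.

(** * Integrals of bounded functions and Prekopa-Leindler in several variables *)

Section BoundedIntegral.
Context {R : realType}.
Local Notation mu := (@lebesgue_measure R).
Local Notation RR := (measurableTypeR R).
Implicit Types (n : nat) (F G : seq R -> R).

(** Boundedness makes all integrals over the cube finite, so the real-valued [Iint] is additive and
    monotone without finiteness side conditions. *)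
Definition admissible n F :=
  [/\ measurable_seq n (F : seq R -> RR), forall X, 0 <= F X & exists M, forall X, F X <= M].

Definition Iint n F : R := fine (iint n (fun X => (F X)%:E)).

Lemma measurable_seq_EFin n F : measurable_seq n (F : seq R -> RR) ->
  measurable_seq n (fun X => (F X)%:E).
Proof. by move=> mF d T X mX; apply/measurable_EFinP; exact: mF. Qed.

Lemma admissible_EFin n F : admissible n F -> measurable_seq n (fun X => (F X)%:E).
Proof. by case=> mF _ _; exact: measurable_seq_EFin. Qed.

Lemma admissible_EFin_ge0 n F : admissible n F -> forall X, (0 <= (F X)%:E)%E.
Proof. by case=> _ F0 _ X; rewrite lee_fin. Qed.

Lemma admissible_cst n (c : R) : 0 <= c -> admissible n (fun _ => c).
Proof. by move=> c0; split => //; exists c. Qed.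

Lemma admissibleD n F G : admissible n F -> admissible n G ->
  admissible n (fun X => F X + G X).
Proof.
move=> [mF F0 [M FM]] [mG G0 [N GN]]; split => [d T X mX|X|].
- by apply: measurable_funD; [exact: mF|exact: mG].
- exact: addr_ge0.
- by exists (M + N) => X; exact: lerD.
Qed.

Lemma admissibleM n F G : admissible n F -> admissible n G ->
  admissible n (fun X => F X * G X).
Proof.
move=> [mF F0 [M FM]] [mG G0 [N GN]]; split => [d T X mX|X|].
- by apply: measurable_funM; [exact: mF|exact: mG].
- exact: mulr_ge0.
- by exists (M * N) => X; exact: ler_pM.
Qed.

Lemma admissible_cons n F x : admissible n.+1 F -> admissible n (fun t => F (x :: t)).
Proof.
move=> [mF F0 [M FM]]; split => //; last by exists M.
exact: (@measurable_seq_cons R _ RR n F x mF).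
Qed.

Lemma iint_ub n F M : admissible n F -> (forall X, F X <= M) ->
  (iint n (fun X => (F X)%:E) <= M%:E)%E.
Proof.
move=> gF FM; have M0 : 0 <= M.
  by case: gF => _ F0 _; exact: le_trans (F0 [::]) (FM [::]).
rewrite -[leRHS](iint_cst n M0); apply: le_iint => //.
- exact: admissible_EFin.
- exact: admissible_EFin_ge0 gF.
- by move=> X _ _; rewrite lee_fin.
Qed.

Lemma IintE n F : admissible n F -> iint n (fun X => (F X)%:E) = (Iint n F)%:E.
Proof.
move=> gF; have [_ _ [M FM]] := gF.
rewrite /Iint fineK// ge0_fin_numE; first by rewrite (le_lt_trans (iint_ub gF FM))// ltry.
exact/iint_ge0/(admissible_EFin_ge0 gF).
Qed.

Lemma Iint_ge0 n F : admissible n F -> 0 <= Iint n F.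
Proof. by move=> gF; apply/fine_ge0/iint_ge0/(admissible_EFin_ge0 gF). Qed.

Lemma Iint_le n F G : admissible n F -> admissible n G ->
  (forall X, size X = n -> all (fun x => 0 <= x < 1) X -> F X <= G X) ->
  Iint n F <= Iint n G.
Proof.
move=> gF gG FG; rewrite -lee_fin -!IintE//; apply: le_iint.
- exact: admissible_EFin.
- exact: admissible_EFin.
- exact: admissible_EFin_ge0 gF.
- exact: admissible_EFin_ge0 gG.
- by move=> X sX aX; rewrite lee_fin FG.
Qed.

Lemma eq_Iint n F G :
  (forall X, size X = n -> all (fun x => 0 <= x < 1) X -> F X = G X) ->
  Iint n F = Iint n G.
Proof. by move=> FG; congr fine; apply: eq_iint => X sX aX; rewrite FG. Qed.

Lemma IintD n F G : admissible n F -> admissible n G ->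
  Iint n (fun X => F X + G X) = Iint n F + Iint n G.
Proof.
move=> gF gG; apply: EFin_inj; rewrite EFinD -!IintE//; last exact: admissibleD.
rewrite -iintD//; try exact: admissible_EFin; try exact: admissible_EFin_ge0 gF.
exact: admissible_EFin_ge0 gG.
Qed.

Lemma IintZ n (c : R) F : 0 <= c -> admissible n F ->
  Iint n (fun X => c * F X) = c * Iint n F.
Proof.
move=> c0 gF; apply: EFin_inj; rewrite EFinM -!IintE//; last first.
  by apply: admissibleM => //; exact: admissible_cst.
by rewrite -iintZ//; [exact: admissible_EFin|exact: admissible_EFin_ge0 gF].
Qed.

Lemma Iint_sum n (I : Type) (r : seq I) (F : I -> seq R -> R) :
  (forall i, admissible n (F i)) ->
  admissible n (fun X => \sum_(i <- r) F i X) /\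
  Iint n (fun X => \sum_(i <- r) F i X) = \sum_(i <- r) Iint n (F i).
Proof.
move=> gF; elim: r => [|i r [gr IH]].
  have z : (fun X : seq R => \sum_(i <- [::]) F i X) = (fun _ => 0).
    by apply/funext => X; rewrite big_nil.
  rewrite z big_nil; split; first exact: admissible_cst.
  by rewrite /Iint iint_cst.
have e : (fun X : seq R => \sum_(j <- i :: r) F j X) =
    (fun X => F i X + \sum_(j <- r) F j X).
  by apply/funext => X; rewrite big_cons.
by rewrite e big_cons; split; [exact: admissibleD|rewrite IintD// IH].
Qed.

Lemma Iint_rot n F : admissible n.+1 F -> Iint n.+1 (fun X => F (rot 1 X)) = Iint n.+1 F.
Proof.
move=> gF; congr fine; apply: (@iint_rot R n (fun X => (F X)%:E)).
- exact: admissible_EFin.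
- exact: admissible_EFin_ge0 gF.
Qed.

Lemma Iint_gt0 n (a b : nat -> R) F : admissible n F ->
  (forall j, (j < n)%N -> 0 <= a j /\ a j < b j /\ b j <= 1) ->
  (forall X, size X = n -> (forall j, (j < n)%N -> a j <= X`_j < b j) -> 0 < F X) ->
  0 < Iint n F.
Proof.
move=> gF ab FP; rewrite -lte_fin -IintE//.
apply: (@iint_gt0 R n a b) => //; first exact: admissible_EFin.
exact: admissible_EFin_ge0 gF.
Qed.

Definition midpoint (X Y : seq R) : seq R := [seq (p.1 + p.2) / 2 | p <- zip X Y].

Lemma nth_midpoint X Y i : size X = size Y -> (midpoint X Y)`_i = (X`_i + Y`_i) / 2.
Proof.
move=> sXY; case: (ltnP i (size X)) => iX.
  by rewrite (nth_map (0, 0)) ?size_zip -?sXY ?minnn// nth_zip.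
rewrite nth_default; last by rewrite size_map size_zip -sXY minnn.
by rewrite !nth_default -?sXY// addr0 mul0r.
Qed.

Lemma size_midpoint X Y : size X = size Y -> size (midpoint X Y) = size X.
Proof. by move=> sXY; rewrite size_map size_zip -sXY minnn. Qed.

Lemma measurable_Iint_cons n F : admissible n.+1 F ->
  measurable_fun [set: RR] (fun x => Iint n (fun t => F (x :: t)) : RR).
Proof.
move=> gF; apply/measurable_EFinP.
have := @measurable_iint_cons R n (fun X => (F X)%:E) (admissible_EFin gF) (admissible_EFin_ge0 gF).
by apply: eq_measurable_fun => x _; rewrite IintE//; exact: admissible_cons.
Qed.

Lemma IintS n F : admissible n.+1 F ->
  Iint n.+1 F = fine (\int[mu]_(x in I01) (Iint n (fun t => F (x :: t)))%:E).
Proof.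
move=> gF; rewrite {1}/Iint iintS; congr fine; apply: eq_integral => x _.
by rewrite IintE//; exact: admissible_cons.
Qed.

(** Induction on the dimension: for fixed first coordinates x and y, the conclusion for the slices
    is exactly the pointwise hypothesis of the one-dimensional inequality for the marginals. *)
Theorem prekopa_leindler n (f g h : seq R -> R) :
  admissible n f -> admissible n g -> admissible n h ->
  (forall X Y, size X = n -> size Y = n ->
     all (fun x => 0 <= x < 1) X -> all (fun x => 0 <= x < 1) Y ->
     f X * g Y <= h (midpoint X Y) ^+ 2) ->
  Iint n f * Iint n g <= Iint n h ^+ 2.
Proof.
elim: n f g h => [|n IH] f g h gf gg gh fgh.
  by have := fgh [::] [::] erefl erefl isT isT.
rewrite !IintS//.
have [_ _ [Mf fM]] := gf; have [_ _ [Mg gM]] := gg; have [_ _ [Mh hM]] := gh.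
pose M := Num.max Mf (Num.max Mg Mh).
have bnd F N : admissible n.+1 F -> (forall X, F X <= N) -> N <= M ->
    forall x, 0 <= Iint n (fun t => F (x :: t)) <= M.
  move=> gF FN NM x; have gx := admissible_cons x gF.
  rewrite Iint_ge0//=; apply: le_trans NM; rewrite -lee_fin -IintE//.
  exact: iint_ub.
apply: (@prekopa_leindler_I01 R _ _ _ M).
- exact: measurable_Iint_cons.
- exact: measurable_Iint_cons.
- exact: measurable_Iint_cons.
- by apply: (bnd _ Mf) => //; rewrite le_max lexx.
- by apply: (bnd _ Mg) => //; rewrite !le_max lexx orbT.
- by apply: (bnd _ Mh) => //; rewrite !le_max lexx !orbT.
move=> x y Ix Iy.
apply: (IH (fun t => f (x :: t)) (fun t => g (y :: t)) (fun t => h ((x + y) / 2 :: t)));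
  try exact: admissible_cons.
move=> X Y sX sY aX aY; apply: (fgh (x :: X) (y :: Y)); rewrite /= ?sX ?sY//.
  by rewrite aX andbT.
by rewrite aY andbT.
Qed.

End BoundedIntegral.

(** * The Gibbs weight *)

Local Opaque gfun.

(** * Measurability of functions of finitely many coordinates *)

Section MeasurableSequenceFunctions.
Context {R : realType}.
Local Notation RR := (measurableTypeR R).
Implicit Types (n : nat).

Lemma measurable_seq_cst d (U : measurableType d) n (c : U) :
  measurable_seq n (fun _ : seq R => c).
Proof. by move=> d' T X mX; exact: measurable_cst. Qed.

Lemma measurable_seq_comp d d' (U : measurableType d) (V : measurableType d') n
    (f : U -> V) (F : seq R -> U) :
  measurable_fun setT f -> measurable_seq n F -> measurable_seq n (fun X => f (F X)).
Proof. by move=> mf mF d'' T X mX; apply: (measurableT_comp mf); exact: mF. Qed.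

Lemma measurable_seq_nth n i : measurable_seq n (fun X : seq R => X`_i : RR).
Proof.
move=> d T X mX; case: (ltnP i n) => ni.
  by have := mX i; apply: eq_measurable_fun => w _; rewrite nth_mkseq.
have := @measurable_cst _ _ T RR setT (0 : R); apply: eq_measurable_fun => w _.
by rewrite nth_default// size_mkseq.
Qed.

Lemma measurable_seqB n (F G : seq R -> RR) : measurable_seq n F -> measurable_seq n G ->
  measurable_seq n (fun X => F X - G X : RR).
Proof. by move=> mF mG d T X mX; apply: measurable_funB; [exact: mF|exact: mG]. Qed.

Lemma measurable_seqM n (F G : seq R -> RR) : measurable_seq n F -> measurable_seq n G ->
  measurable_seq n (fun X => F X * G X : RR).
Proof. by move=> mF mG d T X mX; apply: measurable_funM; [exact: mF|exact: mG]. Qed.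

Lemma measurable_seq_sum n (I : Type) (r : seq I) (P : pred I) (F : I -> seq R -> RR) :
  (forall i, measurable_seq n (F i)) ->
  measurable_seq n (fun X => \sum_(i <- r | P i) F i X : RR).
Proof.
move=> mF d T X mX.
have -> : (fun w => \sum_(i <- r | P i) F i (mkseq (fun j => X j w) n)) =
  (fun w => \sum_(i <- r) (if P i then F i (mkseq (fun j => X j w) n) else 0)).
  by apply/funext => w; rewrite big_mkcond.
apply: measurable_sum => i; case: (P i); last exact: measurable_cst.
exact: mF.
Qed.

Lemma measurable_seq_ltr n (F G : seq R -> RR) : measurable_seq n F -> measurable_seq n G ->
  measurable_seq n (fun X => F X < G X).
Proof. by move=> mF mG d T X mX; apply: measurable_fun_ltr; [exact: mF|exact: mG]. Qed.

Lemma measurable_seq_ler n (F G : seq R -> RR) : measurable_seq n F -> measurable_seq n G ->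
  measurable_seq n (fun X => F X <= G X).
Proof. by move=> mF mG d T X mX; apply: measurable_fun_ler; [exact: mF|exact: mG]. Qed.

Lemma measurable_seq_and n (p q : seq R -> bool) : measurable_seq n p -> measurable_seq n q ->
  measurable_seq n (fun X => p X && q X).
Proof. by move=> mp mq d T X mX; apply: measurable_and; [exact: mp|exact: mq]. Qed.

Lemma measurable_seq_neg n (p : seq R -> bool) : measurable_seq n p ->
  measurable_seq n (fun X => ~~ p X).
Proof. by move=> mp d T X mX; apply: measurable_neg; exact: mp. Qed.

Lemma measurable_seq_all n (I : Type) (r : seq I) (p : I -> seq R -> bool) :
  (forall i, measurable_seq n (p i)) ->
  measurable_seq n (fun X => all (fun i => p i X) r).
Proof.
move=> mp; elim: r => [|i r IH] /=; first exact: measurable_seq_cst.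
exact: measurable_seq_and.
Qed.

Lemma measurable_seq_forall n (I : finType) (p : I -> seq R -> bool) :
  (forall i, measurable_seq n (p i)) ->
  measurable_seq n (fun X => [forall i, p i X]).
Proof.
move=> mp.
have -> : (fun X => [forall i, p i X]) = (fun X => all (fun i => p i X) (enum I)).
  apply/funext => X; apply/forallP/allP => [h i _|h i]; first exact: h.
  by apply: h; rewrite mem_enum.
exact: measurable_seq_all.
Qed.

Lemma measurable_seq_if d (U : measurableType d) n (p : seq R -> bool) (F G : seq R -> U) :
  measurable_seq n p -> measurable_seq n F -> measurable_seq n G ->
  measurable_seq n (fun X => if p X then F X else G X).
Proof.
by move=> mp mF mG d' T X mX; apply: measurable_fun_ifT; [exact: mp|exact: mF|exact: mG].
Qed.

Lemma measurable_seq_trep n (F : seq R -> RR) : measurable_seq n F ->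
  measurable_seq n (fun X => trep (F X) : RR).
Proof. by move=> mF; apply: measurable_seq_comp => //; exact: measurable_trep. Qed.

Lemma admissible_bool n (p : seq R -> bool) : measurable_seq n p ->
  admissible n (fun X => (p X)%:R : R).
Proof.
move=> mp; split => //; last by exists 1 => X; case: (p X).
have -> : (fun X => (p X)%:R : R) = (fun X => if p X then 1 else 0).
  by apply/funext => X; case: (p X).
by apply: measurable_seq_if => //; exact: measurable_seq_cst.
Qed.

Lemma nth_rot (X : seq R) i j : (i <= size X)%N -> (j < size X)%N ->
  (rot i X)`_j = X`_((i + j) %% size X).
Proof.
move=> iX jX; rewrite /rot nth_cat size_drop; case: ltnP => h.
  by rewrite nth_drop modn_small// -ltn_subRL.
have -> : ((i + j) %% size X = j - (size X - i))%N.
  move: (size X) iX jX h => n iX jX h.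
  have -> : (i + j = j - (n - i) + n)%N by lia.
  by rewrite modnDr modn_small//; lia.
by rewrite nth_take//; move: (size X) iX jX h => n iX jX h; lia.
Qed.

Lemma nth_rot1 (X : seq R) i : (i < size X)%N -> (rot 1 X)`_i = X`_(i.+1 %% size X).
Proof. by move=> iX; rewrite nth_rot// (leq_ltn_trans _ iX). Qed.

Lemma measurable_seq_rot d (U : measurableType d) N (G : seq R -> U) k :
  (k <= N)%N -> measurable_seq N G -> measurable_seq N (fun X => G (rot k X)).
Proof.
move=> kN mG d' T X mX.
have := mG d' T (fun i => X ((k + i) %% N)%N) (fun i => mX _).
apply: eq_measurable_fun => w _; congr G.
apply: (@eq_from_nth _ 0); first by rewrite size_rot !size_mkseq.
move=> i; rewrite size_mkseq => iN.
rewrite nth_mkseq// nth_rot size_mkseq// nth_mkseq// ltn_mod.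
exact: leq_ltn_trans iN.
Qed.

Lemma admissible_rot N (G : seq R -> R) k : (k <= N)%N -> admissible N G ->
  admissible N (fun X => G (rot k X)).
Proof.
move=> kN [mG G0 [M GM]]; split => //; last by exists M.
exact: measurable_seq_rot.
Qed.

End MeasurableSequenceFunctions.

(** * Boundedness and cyclic invariance of the weight *)

Section GibbsWeight.
Context {R : realType}.
Variables (s beta : R) (hs : 0 < s < 1) (hb : 0 < beta).
Local Notation RR := (measurableTypeR R).
Local Notation mu := (@lebesgue_measure R).
Implicit Types (N n i j k : nat) (X : seq R) (G : seq R -> R).

Definition chain N X : bool :=
  [forall j : 'I_N, (j.+1 < N)%N ==> (trep (X`_j - X`_0) < trep (X`_j.+1 - X`_0))].

(* Unlike [inDN], [chain] also excludes x_0 = x_1: this discards a null set on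
   which g takes a junk value. *)
Definition weight N X : R := if chain N X then expR (- beta * HN s N X) else 0.

Lemma trep0 : trep (0 : R) = 0.
Proof. by rewrite trep_id// lexx ltr01. Qed.

Lemma chain_lt N X i j : chain N X -> (i < j)%N -> (j < N)%N ->
  trep (X`_i - X`_0) < trep (X`_j - X`_0).
Proof.
move=> /forallP ch; elim: j => [//|j IH]; rewrite ltnS => ij jN.
have := ch (Ordinal (ltnW jN)); rewrite /= jN /= => h.
case: (ltngtP i j) ij => // [ij _|-> _]//.
by apply: lt_trans h; apply: IH => //; exact: ltnW.
Qed.

Lemma chain_le N X i j : chain N X -> (i <= j)%N -> (j < N)%N ->
  trep (X`_i - X`_0) <= trep (X`_j - X`_0).
Proof.
move=> ch; rewrite leq_eqVlt => /predU1P[->//|ij] jN.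
exact/ltW/(chain_lt ch).
Qed.

Lemma chainP N X : (forall j, (j.+1 < N)%N ->
  trep (X`_j - X`_0) < trep (X`_j.+1 - X`_0)) -> chain N X.
Proof. by move=> h; apply/forallP => j; apply/implyP; exact: h. Qed.

Lemma trepB_chain N X i j : chain N X -> (i <= j)%N -> (j < N)%N ->
  trep (X`_j - X`_i) = trep (X`_j - X`_0) - trep (X`_i - X`_0).
Proof.
move=> ch ij jN.
have -> : X`_j - X`_i = (X`_j - X`_0) - (X`_i - X`_0) by ring.
by rewrite trepB (chain_le ch).
Qed.

Lemma trepB_chain_lt N X i j : chain N X -> (i < j)%N -> (j < N)%N ->
  trep (X`_i - X`_j) = 1 - (trep (X`_j - X`_0) - trep (X`_i - X`_0)).
Proof.
move=> ch ij jN.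
have -> : X`_i - X`_j = (X`_i - X`_0) - (X`_j - X`_0) by ring.
by rewrite trepB leNgt (chain_lt ch ij jN) /=; ring.
Qed.

Lemma measurable_chain N : measurable_seq N (chain N).
Proof.
apply: measurable_seq_forall => j; case: (j.+1 < N)%N => /=; last exact: measurable_seq_cst.
by apply: measurable_seq_ltr; apply: measurable_seq_trep; apply: measurable_seqB;
  exact: measurable_seq_nth.
Qed.

Lemma measurable_inDN N : measurable_seq N (@inDN R N).
Proof.
apply: measurable_seq_forall => j; case: (_ && _)%N => /=; last exact: measurable_seq_cst.
by apply: measurable_seq_ltr; apply: measurable_seq_trep; apply: measurable_seqB;
  exact: measurable_seq_nth.
Qed.

Lemma measurable_HN N : measurable_seq N (HN s N : seq R -> RR).
Proof.
apply: measurable_seqM; first exact: measurable_seq_cst.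
apply: measurable_seq_sum => i; apply: measurable_seq_sum => j.
apply: (@measurable_seq_comp _ _ _ RR RR); first exact: measurable_gT.
by apply: measurable_seqB; exact: measurable_seq_nth.
Qed.

Lemma measurable_boltzmann N :
  measurable_seq N (fun X => expR (- beta * HN s N X) : RR).
Proof.
apply: (@measurable_seq_comp _ _ _ RR RR); first exact: measurable_expR.
by apply: measurable_seqM; [exact: measurable_seq_cst|exact: measurable_HN].
Qed.

Lemma measurable_weight N : measurable_seq N (weight N : seq R -> RR).
Proof.
apply: measurable_seq_if; [exact: measurable_chain|exact: measurable_boltzmann|].
exact: measurable_seq_cst.
Qed.

(** Pairing (i, j) with (j, i) lets midpoint convexity act: g(d) + g(1 - d) >= 2 g(1/2). The bound
    makes the weight bounded, hence admissible. *)
Lemma HN_ge N X : chain N X ->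
  N%:R `^ (- s) * \sum_(i < N) \sum_(j < N | i != j) gfun s (1 / 2) <= HN s N X.
Proof.
move=> ch; rewrite ler_wpM2l ?powR_ge0//.
have sym : \sum_(i < N) \sum_(j < N | i != j) gT s (X`_i - X`_j) =
    \sum_(i < N) \sum_(j < N | i != j) gT s (X`_j - X`_i).
  rewrite (exchange_big_dep predT)//=; apply: eq_bigr => i _.
  by apply: eq_bigl => j; rewrite eq_sym.
suff : 2 * \sum_(i < N) \sum_(j < N | i != j) gfun s (1 / 2) <=
    2 * \sum_(i < N) \sum_(j < N | i != j) gT s (X`_i - X`_j) by rewrite ler_pM2l.
rewrite [leRHS]mulr_natl [leRHS]mulr2n {2}sym mulr_sumr -big_split/=.
apply: ler_sum => i _; rewrite mulr_sumr -big_split/=; apply: ler_sum => j ij.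
wlog lij : i j ij / (i < j)%N => [hw|].
  have : (i : nat) != j by [].
  rewrite neq_ltn => /orP[h|h]; first exact: hw.
  by rewrite addrC; apply: hw => //; rewrite eq_sym.
rewrite /gT (trepB_chain_lt ch lij)// (trepB_chain ch (ltnW lij))//.
have u1 := chain_lt ch lij (ltn_ord j).
have u2 := trep_ge0 (X`_i - X`_0); have u3 := trep_lt1 (X`_j - X`_0).
set d := trep (X`_j - X`_0) - trep (X`_i - X`_0).
have d01 : 0 < d < 1 by rewrite /d; lra.
have d01' : 0 < 1 - d < 1 by lra.
have := gfun_midpoint_le hs d01' d01.
by rewrite subrK addrC.
Qed.

Lemma admissible_weight N : admissible N (weight N).
Proof.
split; first exact: measurable_weight.
  by move=> X; rewrite /weight; case: ifP => _ //; exact: expR_ge0.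
exists (expR (- beta * (N%:R `^ (- s) * \sum_(i < N) \sum_(j < N | i != j) gfun s (1 / 2)))) => X.
rewrite /weight; case: ifPn => [ch|_]; last exact: expR_ge0.
by rewrite ler_expR !mulNr lerN2 ler_pM2l// HN_ge.
Qed.

Lemma HN_rot1 N X : size X = N -> HN s N (rot 1 X) = HN s N X.
Proof.
move=> sX; congr (_ * _).
rewrite [RHS](reindex_inj (can_inj (@ordSK N))) /=.
apply: eq_bigr => i _; rewrite [RHS](reindex_inj (can_inj (@ordSK N))) /=.
apply: eq_big => [j|j _]; first by rewrite (inj_eq (can_inj (@ordSK N))).
by rewrite !nth_rot1 ?sX.
Qed.

Lemma chain_rot1 N X : size X = N -> chain N X -> chain N (rot 1 X).
Proof.
move=> sX ch; apply: chainP => j jN.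
have N1 : (1 < N)%N by apply: leq_trans jN.
rewrite !nth_rot1 ?sX ?(ltnW jN) ?(ltnW N1)// (modn_small jN) (modn_small N1).
have u1 := chain_lt ch (ltn0Sn 0) N1; rewrite subrr trep0 in u1.
rewrite (trepB_chain ch)//.
case: (ltnP j.+2 N) => j2.
  by rewrite modn_small// (@trepB_chain N X 1 j.+2)// ltrD2r (chain_lt ch).
(* Wrap-around: the last point of the rotated configuration is x_0, which lies beyond all others as
   seen from x_1. *)
have -> : j.+2 = N by apply/eqP; rewrite eqn_leq j2 jN.
rewrite modnn (@trepB_chain_lt N X 0 1)// subrr trep0.
by have := trep_lt1 (X`_j.+1 - X`_0); lra.
Qed.

Lemma chain_rot N X k : size X = N -> (k <= N)%N -> chain N X -> chain N (rot k X).
Proof.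
move=> sX kN ch; elim: k kN => [|k IH] kN; first by rewrite rot0.
by rewrite rotS ?sX// chain_rot1 ?size_rot// IH// ltnW.
Qed.

Lemma weight_rot1 N X : size X = N -> weight N (rot 1 X) = weight N X.
Proof.
move=> sX; rewrite /weight HN_rot1//; congr (if _ then _ else _).
apply/idP/idP => [|/chain_rot1->//].
case: N sX => [|N] sX; first by case: X sX.
(* With N + 1 points, N further rotations undo [rot 1], so the converse follows from the direct
   implication. *)
move=> /(chain_rot (k := N)); rewrite size_rot => /(_ sX (leqnSn N)).
by rewrite rot_rot -rotS ?sX// -sX rot_size.
Qed.

Definition gibbsE N G : R := Iint N (fun X => G X * weight N X).

Lemma admissible_weighted N G : admissible N G -> admissible N (fun X => G X * weight N X).
Proof. by move=> gG; apply: admissibleM => //; exact: admissible_weight. Qed.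

Lemma gibbsE_rot1 N G : admissible N G -> gibbsE N (fun X => G (rot 1 X)) = gibbsE N G.
Proof.
case: N => [|N] gG.
  by apply: eq_Iint => X /size0nil -> _.
rewrite /gibbsE -[RHS]Iint_rot; last exact: admissible_weighted.
by apply: eq_Iint => X sX _; rewrite weight_rot1.
Qed.

Lemma gibbsE_rot N G k : (k <= N)%N -> admissible N G ->
  gibbsE N (fun X => G (rot k X)) = gibbsE N G.
Proof.
elim: k G => [|k IH] G kN gG; first by apply: eq_Iint => X _ _; rewrite rot0.
rewrite -[RHS]gibbsE_rot1// -(IH (fun X => G (rot 1 X)))//.
- by apply: eq_Iint => X sX _; rewrite rotS ?sX.
- exact: ltnW.
- by apply: admissible_rot; first exact: leq_trans kN.
Qed.

End GibbsWeight.

(** * Removing a null set and the rotational degree of freedom *)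

Section GibbsWeightIntegral.
Context {R : realType}.
Variables (s beta : R) (hs : 0 < s < 1) (hb : 0 < beta).
Local Notation RR := (measurableTypeR R).
Local Notation mu := (@lebesgue_measure R).
Local Notation weight := (weight s beta).
Local Notation gibbsE := (gibbsE s beta).
Implicit Types (N n i j k : nat) (X : seq R) (G : seq R -> R).

Lemma inDN_chain N X : (1 < N)%N -> inDN N X && (0 < trep (X`_1 - X`_0)) = chain N X.
Proof.
move=> N1; apply/andP/idP => [[/forallP D h]|ch].
  apply: chainP => -[_|j jN]; first by rewrite subrr trep0.
  by have := D (Ordinal (ltnW jN)); rewrite /= jN.
split; last by have := chain_lt ch (ltn0Sn 0) N1; rewrite subrr trep0.
apply/forallP => j; apply/implyP => /andP[_ jN]; exact: (chain_lt ch).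
Qed.

(** The two weights can differ only where the second point equals the first, so removing one point
    from the second integration makes the integrands equal. For N <= 1 the two order conditions
    agree. *)
Lemma iint_gibbs_w N (A : seq R -> bool) : measurable_seq N A ->
  iint N (fun X => if A X then gibbs_w s beta N X else 0%E) =
  iint N (fun X => ((A X)%:R * weight N X)%:E).
Proof.
move=> mA.
have FE X : ((A X)%:R * weight N X)%:E = if A X then (weight N X)%:E else 0%E.
  by case: (A X); rewrite ?mul1r ?mul0r.
have gibbsE' X : inDN N X = chain N X -> gibbs_w s beta N X = (weight N X)%:E.
  by move=> e; rewrite /gibbs_w e.
case: (ltnP 1 N) => N1; last first.
  apply: eq_iint => X _ _; rewrite FE gibbsE'//.
  apply/forallP/forallP => _ j; apply/implyP; first by move=> jN; have := leq_trans jN N1.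
  by move=> /andP[_ jN]; have := leq_trans jN N1.
have mF : measurable_seq N (fun X => if A X then (weight N X)%:E else 0%E).
  apply: (@measurable_seq_if R _ _ N A (fun X => (weight N X)%:E) (fun _ => 0%E)) => //.
  by apply: measurable_seq_EFin; exact: measurable_weight.
have mG : measurable_seq N (fun X => if A X then gibbs_w s beta N X else 0%E).
  apply: (@measurable_seq_if R _ _ N A (gibbs_w s beta N) (fun _ => 0%E)) => //.
  apply: (@measurable_seq_EFin R N (fun X => if inDN N X then expR (- beta * HN s N X) else 0)).
  by apply: measurable_seq_if; [exact: measurable_inDN|exact: measurable_boltzmann|
    exact: measurable_seq_cst].
have F0 X : (0 <= if A X then (weight N X)%:E else 0)%E.
  by case: (A X) => //; rewrite lee_fin; case: (admissible_weight hs hb N).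
have G0 X : (0 <= if A X then gibbs_w s beta N X else 0)%E.
  by case: (A X) => //; rewrite lee_fin; case: ifP => // _; exact: expR_ge0.
rewrite (_ : (fun X => ((A X)%:R * weight N X)%:E) =
  (fun X => if A X then (weight N X)%:E else 0%E)); last by apply/funext.
case: N N1 mA mF mG F0 G0 {FE} gibbsE' => [//|[//|n]] _ mA mF mG F0 G0 gibbsE'.
rewrite [LHS]iintS [RHS]iintS; apply: eq_integral => x; rewrite inE => x01.
have mI1 : measurable (I01 `\ x) by apply: measurableD => //; exact: measurable_set1.
rewrite [LHS]iintS [RHS]iintS -(@integral_setD1 _ _ x) //; last first.
  apply: measurable_funTS.
  exact: (measurable_iint_cons (measurable_seq_cons x mG) (fun X => G0 (x :: X))).
rewrite -[RHS](@integral_setD1 _ _ x) //; last first.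
  apply: measurable_funTS.
  exact: (measurable_iint_cons (measurable_seq_cons x mF) (fun X => F0 (x :: X))).
apply: eq_integral => y; rewrite inE => -[y01 /eqP yx]; apply: eq_iint => t _ _.
rewrite gibbsE'// -inDN_chain// [X in _ = _ && X](_ : _ = true) ?andbT//=.
rewrite lt_neqAle trep_ge0 andbT eq_sym; apply/eqP.
have {}yx : y != x by [].
move: x01 y01; rewrite /I01/= => x01 y01; rewrite trepB !trep_id//.
by case: ifP => _; apply/eqP; [rewrite subr_eq0|lra].
Qed.

Lemma weight_shift n (x : R) (t : seq R) : size t = n ->
  weight n.+1 (x :: t) = weight n.+1 (0 :: [seq trep (y - x) | y <- t]).
Proof.
move=> st; set U := 0 :: _; set X := x :: t.
have nthE j : (j < n.+1)%N -> U`_j = trep (X`_j - X`_0).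
  case: j => [|j] jn; first by rewrite subrr trep0.
  by rewrite /U /X /= (nth_map 0) ?st.
clearbody U X.
have HE : HN s n.+1 X = HN s n.+1 U.
  congr (_ * _); apply: eq_bigr => i _; apply: eq_bigr => j _.
  rewrite (nthE i (ltn_ord i)) (nthE j (ltn_ord j)) /gT trep_Btrep.
  by congr (gfun s (trep _)); ring.
have tE i : (i < n.+1)%N -> trep (U`_i - U`_0) = trep (X`_i - X`_0).
  by move=> iN; rewrite (nthE i iN) (nthE 0%N isT) subrr trep0 subr0 trep_id// trep_ge0 trep_lt1.
rewrite /weight HE; congr (if _ then _ else _).
apply: eq_forallb => j; case: (ltnP j.+1 n.+1) => [jn|//] /=.
by rewrite (tE j.+1 jn) (tE j (ltn_ord j)).
Qed.

(** The weight depends on differences only, so after a rotation by x_0 the outer integral is that of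
    a constant. *)
Lemma gibbsE_differences n (F : seq R -> R) : admissible n F ->
  gibbsE n.+1 (fun X => F [seq trep (y - X`_0) | y <- behead X]) =
  Iint n (fun u => F u * weight n.+1 (0 :: u)).
Proof.
move=> gF.
have gw : admissible n (fun u => F u * weight n.+1 (0 :: u)).
  by apply: admissibleM => //; apply: admissible_cons; exact: admissible_weight.
have inner x : iint n (fun t => (F [seq trep (y - x) | y <- t] * weight n.+1 (x :: t))%:E) =
    (Iint n (fun u => F u * weight n.+1 (0 :: u)))%:E.
  have := @iint_trep R n x _ (admissible_EFin gw) (admissible_EFin_ge0 gw).
  move=> h; apply: etrans (etrans h (IintE gw)).
  by apply: eq_iint => t st _; rewrite weight_shift.
rewrite /gibbsE {1}/Iint iintS /=.
under eq_integral do rewrite inner.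
by rewrite integral_cst_I01.
Qed.

Lemma gibbsE1_gt0 N : 0 < gibbsE N (fun _ => 1).
Proof.
case: N => [|N].
  rewrite /gibbsE /Iint /= mul1r /weight; case: ifPn => [_|/negP[]]; first exact: expR_gt0.
  by apply: chainP.
have N0 : (0 : R) < N.+1%:R by rewrite ltr0n.
(* Separated half-cells: with n points, x_j in [j / n, (j + 1/2) / n) forces the cyclic order. *)
apply: (@Iint_gt0 R _ (fun j => j%:R / N.+1%:R) (fun j => (j%:R + 1 / 2) / N.+1%:R)).
- exact: (admissible_weighted hs hb (admissible_cst _ ler01)).
- move=> j jN; split; first by rewrite divr_ge0.
  split; first by rewrite ltr_pM2r ?invr_gt0//; lra.
  rewrite ler_pdivrMr// mul1r; have : (j%:R + 1 : R) <= N.+1%:R by rewrite natr1 ler_nat.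
  lra.
move=> X sX Xab; rewrite mul1r /weight ifT ?expR_gt0//.
have {}Xab j : (j < N.+1)%N -> j%:R <= X`_j * N.+1%:R < j%:R + 1 / 2.
  by move=> /Xab; rewrite ler_pdivrMr// ltr_pdivlMr.
have X01 j : (j < N.+1)%N -> 0 <= X`_j < 1.
  move=> jN; have := Xab j jN; have : (j%:R + 1 : R) <= N.+1%:R by rewrite natr1 ler_nat.
  have : (0 : R) <= j%:R by [].
  move=> h1 h2 /andP[h3 h4]; rewrite -(pmulr_lge0 _ N0) -(ltr_pM2r N0) mul1r; lra.
have tE j : (j < N.+1)%N -> trep (X`_j - X`_0) = X`_j - X`_0.
  move=> jN; rewrite trepB !(trep_id (X01 _ _))//.
  case: j jN => [|j] jN; first by rewrite lexx.
  have h0 := Xab 0%N isT; have hj := Xab _ jN.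
  rewrite ifT// -(ler_pM2r N0); have : (1 : R) <= j.+1%:R by rewrite ler1n.
  lra.
apply: chainP => j jN; rewrite !tE// ?(ltnW jN)// ltrD2r -(ltr_pM2r N0).
have := Xab _ jN; have := Xab _ (ltnW jN); rewrite -(natr1 j); lra.
Qed.

Lemma PNbetaE N (A : seq R -> bool) : measurable_seq N A ->
  PNbeta s beta N A = gibbsE N (fun X => (A X)%:R) / gibbsE N (fun _ => 1).
Proof.
move=> mA; rewrite /PNbeta iint_gibbs_w//.
have mT : measurable_seq N (fun _ : seq R => true).
  by move=> d T X mX; exact: measurable_cst.
have := @iint_gibbs_w N (fun _ => true) mT.
by rewrite /= => ->.
Qed.

End GibbsWeightIntegral.

(** * Uniform convexity of the energy *)

Section DiscreteSobolev.
Context {R : realType}.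
Implicit Types (s t kappa : R) (psi : nat -> R) (k m : nat).

Definition average psi m : R := (\sum_(0 <= a < m) psi a) / m%:R.

(** The running means interpolate between psi 0 and the mean over 0, ..., k, and their increments
    involve only differences psi m - psi a. *)
Lemma averageS psi m : (0 < m)%N -> average psi m.+1 - average psi m =
  \sum_(0 <= a < m) (psi m - psi a) / (m%:R * m.+1%:R).
Proof.
move=> m0; have m0' : m%:R != 0 :> R by rewrite pnatr_eq0 -lt0n.
have m1' : m%:R + 1 != 0 :> R by rewrite natr1 pnatr_eq0.
rewrite -mulr_suml big_split/= sumr_const_nat subn0 sumrN.
rewrite /average big_nat_recr//= -mulr_natr -natr1.
by field; rewrite m0' m1'.
Qed.

(** Discrete Gagliardo seminorm of order (s + 1) / 2. The order exceeds 1/2 by s / 2, which is why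
    it controls increments with the power k^(s / 2). The diagonal contributes 0 because the squares
    vanish there. *)
Definition seminorm s k psi : R := \sum_(0 <= m < k.+1) \sum_(0 <= a < k.+1)
  (psi m - psi a) ^+ 2 * (`|m%:R - a%:R| `^ (- s - 2)).

(** Young's inequality term by term, t x / q <= kappa x^2 / (2 c) + t^2 c / (2 kappa q^2), with c =
    |m - a|^(s + 2) <= m^(s + 2) and q >= m^2; the m error terms add up to at most t^2 m^(s - 1) /
    (2 kappa). *)
Lemma average_increment_le psi s kappa t m : 0 < s < 1 -> 0 < kappa -> (0 < m)%N ->
  t * (average psi m.+1 - average psi m) <=
  kappa / 2 * (\sum_(0 <= a < m) (psi m - psi a) ^+ 2 * (`|m%:R - a%:R| `^ (- s - 2)))
  + t ^+ 2 / (2 * kappa) * m%:R `^ (s - 1).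
Proof.
move=> s01 k0 m0; have [s0 s1] := andP s01.
have m0' : 0 < m%:R :> R by rewrite ltr0n.
set q := m%:R * m.+1%:R : R.
have q0 : 0 < q by rewrite mulr_gt0// ltr0n.
rewrite averageS// -/q.
apply: (@le_trans _ _ (\sum_(0 <= a < m) (kappa / 2 *
    ((psi m - psi a) ^+ 2 * (`|m%:R - a%:R| `^ (- s - 2))) +
    t ^+ 2 / (2 * kappa) * (m%:R `^ (s + 2) / q ^+ 2)))).
  rewrite mulr_sumr !big_nat; apply: ler_sum => a /andP[_ am].
  set x := psi m - psi a; set d := `|m%:R - a%:R|.
  have dE : d = m%:R - a%:R by rewrite /d ger0_norm// subr_ge0 ler_nat ltnW.
  have d0 : 0 < d by rewrite dE subr_gt0 ltr_nat.
  have dm : d <= m%:R by rewrite dE gerBl.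
  have -> : - s - 2 = - (s + 2) by ring.
  set c := d `^ (s + 2).
  have c0 : 0 < c by exact: powR_gt0.
  rewrite powRN -/c.
  have cm : c <= m%:R `^ (s + 2).
    by apply: ge0_ler_powR; rewrite ?nnegrE ?(ltW d0) ?(ltW m0')//; lra.
  apply: (@le_trans _ _ (kappa / 2 * (x ^+ 2 * c^-1) + t ^+ 2 / (2 * kappa) * (c / q ^+ 2))); last first.
    rewrite lerD2l; apply: ler_wpM2l; last by rewrite ler_pM2r// invr_gt0 exprn_gt0.
    by rewrite divr_ge0 ?sqr_ge0// mulr_ge0// ltW.
  rewrite -subr_ge0.
  have -> : kappa / 2 * (x ^+ 2 * c^-1) + t ^+ 2 / (2 * kappa) * (c / q ^+ 2) - t * (x / q) =
    (kappa * x / c - t / q) ^+ 2 * (c / (2 * kappa)).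
    by field; rewrite !gt_eqF.
  by apply: mulr_ge0; [exact: sqr_ge0|rewrite divr_ge0 ?mulr_ge0 ?ltW].
rewrite big_split/= -mulr_sumr lerD2l sumr_const_nat subn0 -mulrnAr.
apply: ler_wpM2l; first by rewrite divr_ge0 ?sqr_ge0// mulr_ge0// ltW.
rewrite -mulr_natr mulrAC ler_pdivrMr ?exprn_gt0//.
have -> : m%:R `^ (s + 2) = m%:R `^ (s - 1) * m%:R ^+ 3.
  rewrite -(@powR_mulrn _ m%:R 3)// -powRD; first by congr (_ `^ _); ring.
  by rewrite (gt_eqF m0') implybT.
rewrite -mulrA ler_pM2l ?powR_gt0// -exprSr /q exprMn.
rewrite (_ : m%:R ^+ 4 = m%:R ^+ 2 * m%:R ^+ 2); last by rewrite -exprD.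
by rewrite ler_pM2l ?exprn_gt0// ler_sqr ?nnegrE// ler_nat.
Qed.

(** Telescoping of the running means from psi 0: each pair a < m is used once, and the powers m^(s -
    1) sum to at most k^s / s. *)
Lemma average_sub_first_le psi s kappa t k : 0 < s < 1 -> 0 < kappa ->
  t * (average psi k.+1 - psi 0%N) <=
    kappa / 2 * seminorm s k psi + t ^+ 2 * k%:R `^ s / (2 * s * kappa).
Proof.
move=> s01 k0; have [s0 s1] := andP s01.
pose f m a := (psi m - psi a) ^+ 2 * (`|m%:R - a%:R| `^ (- s - 2)).
have f0 m a : 0 <= f m a by apply: mulr_ge0; [exact: sqr_ge0|exact: powR_ge0].
have step : t * (average psi k.+1 - psi 0%N) <=
   \sum_(1 <= m < k.+1) (kappa / 2 * (\sum_(0 <= a < m) f m a)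
      + t ^+ 2 / (2 * kappa) * m%:R `^ (s - 1)).
  elim: k => [|k IH].
    by rewrite /average big_nat1 divr1 subrr mulr0 big_geq.
  rewrite big_nat_recr//=; apply: le_trans (lerD IH (average_increment_le psi t s01 k0 (ltn0Sn k))).
  by rewrite -mulrDr addrCA addrAC subrr add0r addrC.
apply: le_trans step _; rewrite big_split/= -!mulr_sumr; apply: lerD.
  apply: ler_wpM2l; first by rewrite divr_ge0// ltW.
  rewrite /seminorm [leRHS]big_ltn//= -[leLHS]add0r; apply: lerD.
    by apply: sumr_ge0 => a _; exact: f0.
  rewrite !big_nat; apply: ler_sum => m /andP[_ mk].
  rewrite [leRHS](@big_cat_nat _ _ _ m)//=; last exact: ltnW.
  by rewrite lerDl; apply: sumr_ge0 => a _; exact: f0.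
have h := @sum_powR_le R s k; rewrite s0 (ltW s1) in h.
have -> : t ^+ 2 * k%:R `^ s / (2 * s * kappa) = t ^+ 2 / (2 * kappa) * (k%:R `^ s / s).
  by field; rewrite !gt_eqF.
by apply: ler_wpM2l; [rewrite divr_ge0 ?sqr_ge0// mulr_ge0// ltW|exact: h].
Qed.

(* Both end values are compared with the mean over {0, ..., k}. *)
Lemma increment_le_seminorm psi s kappa t k : 0 < s < 1 -> 0 < kappa ->
  t * (psi k - psi 0%N) <= kappa * seminorm s k psi + t ^+ 2 * k%:R `^ s / (s * kappa).
Proof.
move=> s01 k0; have [s0 s1] := andP s01.
(* Reflection of the index turns the last value into the first and keeps the mean and the
   seminorm. *)
pose psi' j := psi (k - j)%N.
have h1 := average_sub_first_le psi t k s01 k0.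
have h2 := average_sub_first_le psi' (- t) k s01 k0.
have avE : average psi' k.+1 = average psi k.+1.
  rewrite /average; congr (_ / _); rewrite big_nat_rev/= add0n.
  by apply: eq_big_nat => i /andP[_ ik]; rewrite /psi' subSS subKn.
have snE : seminorm s k psi' = seminorm s k psi.
  rewrite /seminorm big_nat_rev/= add0n; apply: eq_big_nat => i /andP[_ ik].
  rewrite big_nat_rev/= add0n; apply: eq_big_nat => j /andP[_ jk].
  rewrite /psi' !subSS !subKn// !natrB//; congr (_ * (_ `^ _)).
  by rewrite -normrN; congr `|_|; ring.
move: h2; rewrite avE snE /psi' subn0 sqrrN => h2.
have -> : t ^+ 2 * k%:R `^ s / (s * kappa) = 2 * (t ^+ 2 * k%:R `^ s / (2 * s * kappa)).
  by field; rewrite !gt_eqF.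
lra.
Qed.

Lemma sum_symmetric (f : nat -> nat -> R) k :
  (forall i j, f i j = f j i) -> (forall i, f i i = 0) ->
  \sum_(0 <= i < k) \sum_(0 <= j < k) f i j = 2 * \sum_(i < k) \sum_(j < k | (j < i)%N) f i j.
Proof.
move=> fs f0; rewrite big_mkord.
under eq_bigr do rewrite big_mkord.
have -> : \sum_(i < k) \sum_(j < k) f i j =
  \sum_(i < k) \sum_(j < k | (j < i)%N) f i j + \sum_(i < k) \sum_(j < k | (i < j)%N) f i j.
  rewrite -big_split/=; apply: eq_bigr => i _.
  rewrite [X in _ = X + _]big_mkcond [X in _ = _ + X]big_mkcond -big_split/=.
  apply: eq_bigr => j _; case: ltngtP => [_|_|e]; rewrite ?addr0 ?add0r//.
  by rewrite e f0.
rewrite [X in _ + X](exchange_big_dep predT)//= mulr2n mulrDl mul1r; congr (_ + _).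
by apply: eq_bigr => i _; apply: eq_bigr => j _; exact: fs.
Qed.

End DiscreteSobolev.

Section EnergyConvexity.
Context {R : realType}.
Variables (s : R) (hs : 0 < s < 1).
Implicit Types (N n i j k : nat) (X U V : seq R).

(** Differences are linear in the configuration, so each pair contributes midpoint convexity of g.
    For j < i <= k the gap bound puts U_i - U_j and V_i - V_j below r = (i - j) T / N, and the gain
    at this r carries the weight (i - j)^(- s - 2) of the seminorm. The seminorm counts each pair
    twice, hence s^2 / 4 in place of s^2 / 2. *)
Lemma energy_convexity N k (T : R) U V : (k < N)%N -> 0 < T ->
  size U = N -> size V = N -> U`_0 = 0 -> V`_0 = 0 ->
  all (fun x => 0 <= x < 1) U -> all (fun x => 0 <= x < 1) V ->
  chain N U -> chain N V ->
  (forall j, (j < k)%N -> N%:R * (U`_j.+1 - U`_j) <= T) ->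
  (forall j, (j < k)%N -> N%:R * (V`_j.+1 - V`_j) <= T) ->
  chain N (midpoint U V) /\
  2 * HN s N (midpoint U V) + s ^+ 2 / 4 * T `^ (- s - 2) *
    seminorm s k (fun i => N%:R * (U`_i - V`_i)) <= HN s N U + HN s N V.
Proof.
move=> kN T0 sU sV U0 V0 aU aV cU cV gU gV.
have [s0 s1] := andP hs.
have N0 : 0 < N%:R :> R by rewrite ltr0n (leq_ltn_trans _ kN).
set M := midpoint U V.
have ME i : M`_i = (U`_i + V`_i) / 2 by rewrite nth_midpoint// sU sV.
have in01 X i : size X = N -> all (fun x => 0 <= x < 1) X -> (i < N)%N -> 0 <= X`_i < 1.
  by move=> sX aX iN; apply: (allP aX); rewrite mem_nth// sX.
have tX X i : size X = N -> X`_0 = 0 -> all (fun x => 0 <= x < 1) X -> (i < N)%N ->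
    trep (X`_i - X`_0) = X`_i.
  by move=> sX X0 aX iN; rewrite X0 subr0 trep_id// in01.
have M0 : M`_0 = 0 by rewrite ME U0 V0 addr0 mul0r.
have sM : size M = N by rewrite size_midpoint// sU sV.
have M01 i : (i < N)%N -> 0 <= M`_i < 1.
  by move=> iN; rewrite ME; have := in01 U i sU aU iN; have := in01 V i sV aV iN; lra.
have aM : all (fun x => 0 <= x < 1) M.
  by apply/(all_nthP 0) => i; rewrite sM; exact: M01.
have ltU i j : (i < j)%N -> (j < N)%N -> U`_i < U`_j.
  move=> ij jN; have := chain_lt cU ij jN; rewrite !tX//; exact: ltn_trans jN.
have ltV i j : (i < j)%N -> (j < N)%N -> V`_i < V`_j.
  move=> ij jN; have := chain_lt cV ij jN; rewrite !tX//; exact: ltn_trans jN.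
have cM : chain N M.
  apply: chainP => j jN; rewrite !tX// ?(ltnW jN)// !ME.
  by have := ltU j j.+1 (ltnSn j) jN; have := ltV j j.+1 (ltnSn j) jN; lra.
split => //.
have gap X i j : (forall j, (j < k)%N -> N%:R * (X`_j.+1 - X`_j) <= T) ->
    (j < i)%N -> (i <= k)%N -> X`_i - X`_j <= (i%:R - j%:R) * T / N%:R.
  move=> gX; elim: i => [//|i IH]; rewrite ltnS leq_eqVlt => /predU1P[->|ji] ik.
    by rewrite -natr1 addrAC subrr add0r mul1r ler_pdivlMr// mulrC gX.
  have := IH ji (ltnW ik); have := gX i ik.
  rewrite mulrC -ler_pdivlMr// -(natr1 i) => h1 h2.
  have -> : (i%:R + 1 - j%:R) * T / N%:R = (i%:R - j%:R) * T / N%:R + T / N%:R by ring.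
  lra.
pose psi i := N%:R * (U`_i - V`_i).
pose f i j := (psi i - psi j) ^+ 2 * (`|i%:R - j%:R| `^ (- s - 2)).
have snE : seminorm s k psi = 2 * \sum_(i < k.+1) \sum_(j < k.+1 | (j < i)%N) f i j.
  apply: sum_symmetric => [i j|i]; last by rewrite /f subrr expr0n mul0r.
  by rewrite /f -[psi i - _]opprB sqrrN -[i%:R - _]opprB normrN.
have pair i j : (j < i)%N -> (i < N)%N ->
    [/\ gT s (U`_i - U`_j) = gfun s (U`_i - U`_j),
     gT s (V`_i - V`_j) = gfun s (V`_i - V`_j),
     gT s (M`_i - M`_j) = gfun s ((U`_i - U`_j + (V`_i - V`_j)) / 2) &
     [/\ gT s (U`_j - U`_i) = gfun s (1 - (U`_i - U`_j)),
     gT s (V`_j - V`_i) = gfun s (1 - (V`_i - V`_j)) &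
     gT s (M`_j - M`_i) = gfun s ((1 - (U`_i - U`_j) + (1 - (V`_i - V`_j))) / 2)]].
  move=> ji iN; have jN := ltn_trans ji iN.
  have dif X : size X = N -> X`_0 = 0 -> all (fun x => 0 <= x < 1) X -> chain N X ->
      trep (X`_i - X`_j) = X`_i - X`_j /\ trep (X`_j - X`_i) = 1 - (X`_i - X`_j).
    move=> sX X0 aX cX.
    rewrite (trepB_chain cX (ltnW ji) iN) (trepB_chain_lt cX ji iN).
    by rewrite (tX X i sX X0 aX iN) (tX X j sX X0 aX jN).
  have [u1 u2] := dif U sU U0 aU cU; have [v1 v2] := dif V sV V0 aV cV.
  have [m1 m2] := dif M sM M0 aM cM.
  rewrite /gT u1 u2 v1 v2 m1 m2 !ME.
  have -> : (U`_i + V`_i) / 2 - (U`_j + V`_j) / 2 = (U`_i - U`_j + (V`_i - V`_j)) / 2 by field.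
  have -> : 1 - (U`_i - U`_j + (V`_i - V`_j)) / 2 =
    (1 - (U`_i - U`_j) + (1 - (V`_i - V`_j))) / 2 by field.
  by split.
have d01 X i j (lt : forall i j, (i < j)%N -> (j < N)%N -> X`_i < X`_j) :
    size X = N -> all (fun x => 0 <= x < 1) X -> (j < i)%N -> (i < N)%N ->
    0 < X`_i - X`_j < 1.
  move=> sX aX ji iN; have := lt j i ji iN; have := in01 X i sX aX iN.
  by have := in01 X j sX aX (ltn_trans ji iN); lra.
(* The gain is credited once per pair, to the order j < i <= k; the opposite order and the other
   pairs enter through plain convexity. *)
pose b i j := if (j < i)%N && (i <= k)%N then s ^+ 2 / 2 * T `^ (- s - 2) * f i j else 0.
have convex_pair i j : (i < N)%N -> (j < N)%N -> i != j ->
    2 * gT s (M`_i - M`_j) + N%:R `^ s * b i j <= gT s (U`_i - U`_j) + gT s (V`_i - V`_j).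
  move=> iN jN; rewrite neq_ltn => /orP[ij|ji].
    have [_ _ _ [-> -> ->]] := pair j i ij jN.
    rewrite /b ltnNge (ltnW ij)/= mulr0 addr0.
    have dU := d01 U j i ltU sU aU ij jN; have dV := d01 V j i ltV sV aV ij jN.
    by apply: gfun_midpoint_le => //; lra.
  have [-> -> -> _] := pair i j ji iN.
  have dU := d01 U i j ltU sU aU ji iN; have dV := d01 V i j ltV sV aV ji iN.
  rewrite /b ji/=; case: ifPn => ik; last first.
    rewrite mulr0 addr0.
    exact: gfun_midpoint_le.
  set r := (i%:R - j%:R) * T / N%:R.
  have ij0 : 0 < i%:R - j%:R :> R by rewrite subr_gt0 ltr_nat.
  have := @gfun_midpoint_convex R s (U`_i - U`_j) (V`_i - V`_j) r hs dU dV
    (gap U i j gU ji ik) (gap V i j gV ji ik).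
  apply: le_trans; rewrite lerD2l le_eqVlt; apply/orP; left; apply/eqP.
  have -> : f i j = N%:R ^+ 2 * (U`_i - U`_j - (V`_i - V`_j)) ^+ 2 * (i%:R - j%:R) `^ (- s - 2).
    by rewrite /f /psi gtr0_norm//; congr (_ * _); ring.
  (* The power of r contributes N^(s + 2): N^2 turns differences into differences of psi, and N^s
     cancels the prefactor of the energy. *)
  have -> : r `^ (- s - 2) = (i%:R - j%:R) `^ (- s - 2) * T `^ (- s - 2) * (N%:R `^ s * N%:R ^+ 2).
    rewrite /r powRM ?invr_ge0 ?mulr_ge0 ?(ltW ij0) ?(ltW T0) ?(ltW N0)//.
    rewrite powRM ?(ltW ij0) ?(ltW T0)//; congr (_ * _).
    rewrite -(powR_inv1 (ltW N0)) -powRrM -(powR_mulrn 2 (ltW N0)) -powRD; last by rewrite (gt_eqF N0) implybT.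
    by congr (_ `^ _); ring.
  by ring.
rewrite snE /HN.
have sumb : N%:R `^ (- s) * \sum_(i < N) \sum_(j < N | i != j)
    (2 * gT s (M`_i - M`_j) + N%:R `^ s * b i j) <=
    N%:R `^ (- s) * \sum_(i < N) \sum_(j < N | i != j)
    (gT s (U`_i - U`_j) + gT s (V`_i - V`_j)).
  apply: ler_wpM2l; first exact: powR_ge0.
  by apply: ler_sum => i _; apply: ler_sum => j ij; exact: convex_pair.
have sp (x y : 'I_N -> 'I_N -> R) : \sum_(i < N) \sum_(j < N | i != j) (x i j + y i j) =
    \sum_(i < N) \sum_(j < N | i != j) x i j + \sum_(i < N) \sum_(j < N | i != j) y i j.
  by rewrite -big_split/=; apply: eq_bigr => i _; rewrite big_split.
apply: le_trans (le_trans _ sumb) _; last first.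
  by rewrite sp mulrDr.
rewrite sp mulrDr; apply: lerD.
  rewrite mulrCA; apply: ler_wpM2l; first exact: powR_ge0.
  by rewrite mulr_sumr; apply: ler_sum => i _; rewrite mulr_sumr.
have -> : \sum_(i < N) \sum_(j < N | i != j) N%:R `^ s * b i j =
    N%:R `^ s * \sum_(i < N) \sum_(j < N | i != j) b i j.
  by rewrite mulr_sumr; apply: eq_bigr => i _; rewrite mulr_sumr.
rewrite [leRHS]mulrA -powRD; last by rewrite (gt_eqF N0) implybT.
rewrite addNr powRr0 mul1r.
rewrite (big_ord_widen_cond _ predT (fun i => \sum_(j < k.+1 | (j < i)%N) f i j) kN)/=.
rewrite [X in X <= _](_ : _ = s ^+ 2 / 2 * T `^ (- s - 2) *
  \sum_(i < N | (i < k.+1)%N) \sum_(j < k.+1 | (j < i)%N) f i j); last by field.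
rewrite mulr_sumr big_mkcond/=; apply: ler_sum => i _.
case: ifPn => ik; last first.
  have ik' : (i <= k)%N = false by exact: negbTE.
  by apply: sumr_ge0 => j _; rewrite /b ik' andbF.
rewrite (big_ord_widen_cond _ (fun j => (j < i)%N) (fun j => f i j) kN)/=.
rewrite mulr_sumr big_mkcond [leRHS]big_mkcond/=; apply: ler_sum => j _.
have ik' : (i <= k)%N by [].
rewrite /b ik' andbT.
case: ltnP => ji /=; last by case: ifP => _ //; rewrite ?andbF.
have -> : (i != j) by rewrite neq_ltn ji orbT.
by rewrite (ltn_trans ji ik).
Qed.

End EnergyConvexity.

Local Opaque HN.

(** * Expectations under the Gibbs measure *)

Section GibbsExpectation.
Context {R : realType}.
Variables (s beta : R) (hs : 0 < s < 1) (hb : 0 < beta).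
Local Notation RR := (measurableTypeR R).
Local Notation wt := (weight s beta).
Local Notation gE := (gibbsE s beta).
Implicit Types (N k : nat) (X U V : seq R) (F G : seq R -> R).

Definition Ex N F : R := gE N F / gE N (fun _ => 1).

Let Z0 N : 0 < gE N (fun _ => 1).
Proof. exact: gibbsE1_gt0. Qed.

Lemma weight_chain N X : chain N X -> wt N X = expR (- beta * HN s N X).
Proof. by rewrite /weight => ->. Qed.

Lemma weight_nchain N X : ~~ chain N X -> wt N X = 0.
Proof. by rewrite /weight => /negbTE ->. Qed.

Local Opaque weight.

Lemma Ex_le N F G : admissible N F -> admissible N G ->
  (forall X, size X = N -> all (fun x => 0 <= x < 1) X -> chain N X -> F X <= G X) ->
  Ex N F <= Ex N G.
Proof.
move=> gF gG FG; rewrite ler_pM2r ?invr_gt0//.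
apply: Iint_le => [||X sX aX]; try exact: admissible_weighted.
have [ch|/weight_nchain ->] := boolP (chain N X); last by rewrite !mulr0.
by apply: ler_wpM2r; [case: (admissible_weight hs hb N)|exact: FG].
Qed.

Lemma eq_Ex N F G : admissible N F -> admissible N G ->
  (forall X, size X = N -> all (fun x => 0 <= x < 1) X -> chain N X -> F X = G X) ->
  Ex N F = Ex N G.
Proof.
move=> gF gG FG; apply/eqP; rewrite eq_le.
by rewrite !Ex_le// => X sX aX ch; rewrite FG.
Qed.

Lemma Ex_ge0 N F : admissible N F -> 0 <= Ex N F.
Proof.
move=> gF; rewrite divr_ge0// ?(ltW (Z0 N))//.
by apply: Iint_ge0; exact: admissible_weighted.
Qed.

Lemma Ex_cst N (c : R) : 0 <= c -> Ex N (fun _ => c) = c.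
Proof.
move=> c0; rewrite /Ex.
have -> : gE N (fun _ => c) = c * gE N (fun _ => 1).
  rewrite /gibbsE -IintZ//.
    by apply: eq_Iint => X _ _; rewrite mul1r.
  exact: (admissible_weighted hs hb (admissible_cst _ ler01)).
by rewrite mulfK// gt_eqF.
Qed.

Lemma ExD N F G : admissible N F -> admissible N G ->
  Ex N (fun X => F X + G X) = Ex N F + Ex N G.
Proof.
move=> gF gG; rewrite /Ex -mulrDl; congr (_ / _).
rewrite /gibbsE -IintD; try exact: admissible_weighted.
by apply: eq_Iint => X _ _; rewrite mulrDl.
Qed.

Lemma ExZ N (c : R) F : 0 <= c -> admissible N F ->
  Ex N (fun X => c * F X) = c * Ex N F.
Proof.
move=> c0 gF; rewrite /Ex mulrA; congr (_ / _).
rewrite /gibbsE -IintZ//; last exact: admissible_weighted.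
by apply: eq_Iint => X _ _; rewrite mulrA.
Qed.

Lemma Ex_sum N (I : Type) (r : seq I) (F : I -> seq R -> R) :
  (forall i, admissible N (F i)) ->
  admissible N (fun X => \sum_(i <- r) F i X) /\
  Ex N (fun X => \sum_(i <- r) F i X) = \sum_(i <- r) Ex N (F i).
Proof.
move=> gF; split; first by have [] := Iint_sum r gF.
have [_ h] := @Iint_sum R N I r (fun i X => F i X * wt N X)
  (fun i => admissible_weighted hs hb (gF i)).
rewrite /Ex -mulr_suml; congr (_ / _); rewrite -h.
by apply: eq_Iint => X _ _; rewrite mulr_suml.
Qed.

Lemma Ex_rot N F k : (k <= N)%N -> admissible N F ->
  Ex N (fun X => F (rot k X)) = Ex N F.
Proof. by move=> kN gF; rewrite /Ex gibbsE_rot. Qed.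

Definition differences X : seq R := [seq trep (y - X`_0) | y <- X].

Lemma gibbsE_invariant n F : admissible n.+1 F ->
  (forall X, size X = n.+1 -> F (differences X) = F X) ->
  gE n.+1 F = Iint n (fun u => F (0 :: u) * wt n.+1 (0 :: u)).
Proof.
move=> gF invF; rewrite -(gibbsE_differences hs hb (admissible_cons 0 gF)).
apply: eq_Iint => -[//|x t] sX _; rewrite -invF//= /differences/=.
by rewrite subrr trep0.
Qed.

Lemma tilted_product_le (f g h a b c : R) :
  f * g <= h ^+ 2 * expR (beta * (a + b - 2 * c)) ->
  (f * expR (- beta * a)) * (g * expR (- beta * b)) <= (h * expR (- beta * c)) ^+ 2.
Proof.
move=> fgh; rewrite mulrACA -expRD exprMn -expRM_natl.
have -> : 2%:R * (- beta * c) = beta * (a + b - 2 * c) + (- beta * a + - beta * b) by ring.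
by rewrite [X in _ <= _ * X]expRD mulrA; apply: ler_wpM2r => //; exact: expR_ge0.
Qed.

(* Exponential tilts of the translation-invariant observables are compared by
   Prekopa-Leindler in the variables x_j - x_0, where the weight is log-concave. *)
Lemma Ex_midpoint N F G H : (0 < N)%N ->
  admissible N F -> admissible N G -> admissible N H ->
  (forall X, size X = N -> F (differences X) = F X) ->
  (forall X, size X = N -> G (differences X) = G X) ->
  (forall X, size X = N -> H (differences X) = H X) ->
  (forall U V, size U = N -> size V = N -> U`_0 = 0 -> V`_0 = 0 ->
     all (fun x => 0 <= x < 1) U -> all (fun x => 0 <= x < 1) V ->
     chain N U -> chain N V ->
     F U * G V <= H (midpoint U V) ^+ 2 *
       expR (beta * (HN s N U + HN s N V - 2 * HN s N (midpoint U V)))) ->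
  Ex N F * Ex N G <= Ex N H ^+ 2.
Proof.
case: N => [//|n] _ gF gG gH iF iG iH FGH.
rewrite /Ex !gibbsE_invariant//; [|exact: admissible_cst].
set Z := Iint n (fun u => 1 * _).
have Zp : 0 < Z.
  have := Z0 n.+1; rewrite gibbsE_invariant//; exact: admissible_cst.
rewrite mulrACA -invfM -expr2 exprMn exprVn ler_pM2r ?invr_gt0 ?exprn_gt0//.
have gW F' : admissible n.+1 F' -> admissible n (fun u => F' (0 :: u) * wt n.+1 (0 :: u)).
  by move=> gF'; exact: (admissible_cons 0 (admissible_weighted hs hb gF')).
apply: prekopa_leindler; try exact: gW.
move=> u v su sv au av.
have w0 X : 0 <= wt n.+1 X by case: (admissible_weight hs hb n.+1).
have F0 X : 0 <= F X by case: gF.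
have G0 X : 0 <= G X by case: gG.
have H0 X : 0 <= H X by case: gH.
have [cu|/weight_nchain ->] := boolP (chain n.+1 (0 :: u)); last first.
  by rewrite mulr0 mul0r sqr_ge0.
have [cv|/weight_nchain ->] := boolP (chain n.+1 (0 :: v)); last first.
  by rewrite !mulr0 sqr_ge0.
have aU : all (fun x => 0 <= x < 1) (0 :: u) by rewrite /= lexx ltr01.
have aV : all (fun x => 0 <= x < 1) (0 :: v) by rewrite /= lexx ltr01.
have sU : size (0 :: u) = n.+1 by rewrite /= su.
have sV : size (0 :: v) = n.+1 by rewrite /= sv.
have mE : 0 :: midpoint u v = midpoint (0 :: u) (0 :: v).
  by rewrite /midpoint/= addr0 mul0r.
(* With k = 0 the gap conditions are vacuous; what is taken here is that the midpoint stays
   ordered. *)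
have [cm _] := @energy_convexity R s hs n.+1 0 1 _ _ (ltn0Sn n) ltr01 sU sV erefl erefl aU aV cu cv
  (fun j => ltac:(done)) (fun j => ltac:(done)).
have h := FGH _ _ sU sV erefl erefl aU aV cu cv.
rewrite mE (weight_chain cu) (weight_chain cv) (weight_chain cm).
exact: tilted_product_le h.
Qed.

End GibbsExpectation.

(** * Arc lengths *)

Section ArcTails.
Context {R : realType}.
Variables (s beta : R) (hs : 0 < s < 1) (hb : 0 < beta).
Local Notation RR := (measurableTypeR R).
Local Notation Ex := (Ex s beta).
Implicit Types (N k i j : nat) (X U V : seq R) (F G : seq R -> R) (a t T : R).

Definition arclen N k X : R := N%:R * trep (X`_k - X`_0).

Definition Pr N (A : seq R -> bool) : R := Ex N (fun X => (A X)%:R).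

Lemma measurable_arc N k : measurable_seq N (arclen N k : seq R -> RR).
Proof.
apply: measurable_seqM; first exact: measurable_seq_cst.
by apply: measurable_seq_trep; apply: measurable_seqB; exact: measurable_seq_nth.
Qed.

Lemma arc_ge0 N k X : 0 <= arclen N k X.
Proof. by rewrite mulr_ge0// trep_ge0. Qed.

Lemma arc_le N k X : arclen N k X <= N%:R.
Proof. by rewrite ler_piMr// ltW// trep_lt1. Qed.

Lemma admissible_arc N k : admissible N (arclen N k).
Proof.
split; [exact: measurable_arc|exact: arc_ge0|].
by exists N%:R; exact: arc_le.
Qed.

Lemma differences_trep N X i j : size X = N -> (i < N)%N -> (j < N)%N ->
  trep ((differences X)`_i - (differences X)`_j) = trep (X`_i - X`_j).
Proof.
move=> sX iN jN; rewrite !(nth_map 0) ?sX// trep_Btrep; congr trep; ring.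
Qed.

Lemma arc_differences N k X : (k < N)%N -> size X = N ->
  arclen N k (differences X) = arclen N k X.
Proof.
move=> kN sX; congr (_ * _); apply: (differences_trep sX) => //.
exact: leq_ltn_trans kN.
Qed.

Lemma arclen_rot N i k X : size X = N -> (i < N)%N -> (k < N)%N ->
  arclen N k (rot i X) = N%:R * trep (X`_((i + k) %% N) - X`_i).
Proof.
move=> sX iN kN; rewrite /arclen !nth_rot ?sX ?(ltnW iN)//; last exact: leq_ltn_trans kN.
by rewrite addn0 (modn_small iN).
Qed.

Lemma Ex_arc N k : (k < N)%N -> (1 < N)%N -> Ex N (arclen N k) = k%:R.
Proof.
move=> kN N1; have N0 : (0 < N)%N by exact: ltnW.
have rotE i : (i < N)%N -> Ex N (fun X => arclen N 1 (rot i X)) = Ex N (arclen N 1).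
  by move=> iN; apply: (Ex_rot hs hb (ltnW iN)); exact: admissible_arc.
have grot i : (i < N)%N -> admissible N (fun X => arclen N 1 (rot i X)).
  by move=> iN; apply: (admissible_rot (ltnW iN)); exact: admissible_arc.
have step j : (j.+1 < N)%N -> Ex N (arclen N j.+1) = Ex N (arclen N j) + Ex N (arclen N 1).
  move=> jN; rewrite -(rotE j (ltnW jN)) -ExD//; try exact: admissible_arc; last exact: grot (ltnW jN).
  apply: eq_Ex => //; [exact: admissible_arc|by apply: admissibleD; [exact: admissible_arc|exact: grot (ltnW jN)]|].
  move=> X sX aX ch; rewrite arclen_rot ?(ltnW jN)// addn1 modn_small// (trepB_chain ch (leqnSn j) jN).
  by rewrite /arclen; ring.
have E0 : Ex N (arclen N 0) = 0.
  rewrite -(@Ex_cst _ s beta hs hb N 0 (lexx 0)); apply: eq_Ex => //; [exact: admissible_arc|exact: admissible_cst|].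
  by move=> X sX aX ch; rewrite /arclen subrr trep0 mulr0.
have E j : (j < N)%N -> Ex N (arclen N j) = j%:R * Ex N (arclen N 1).
  elim: j => [|j IH] jN; first by rewrite E0 mul0r.
  by rewrite step// IH ?(ltnW jN)// -natr1 mulrDl mul1r.
(* Closing the circle: N - 1 gaps together with the gap from the last point back to x_0 have total
   scaled length N. *)
have lastE : Ex N (arclen N N.-1) + Ex N (arclen N 1) = N%:R.
  have pN : (N.-1 < N)%N by rewrite ltn_predL.
  rewrite -(rotE N.-1 pN) -ExD//; [|exact: admissible_arc|exact: grot].
  rewrite -(@Ex_cst _ s beta hs hb N N%:R (ler0n _ N)); apply: eq_Ex => //.
  - by apply: admissibleD; [exact: admissible_arc|exact: grot].
  - by apply: admissible_cst.
  move=> X sX aX ch; rewrite arclen_rot// addn1 prednK// modnn.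
  rewrite (@trepB_chain_lt _ N X 0 N.-1)//; last by rewrite -ltnS prednK.
  by rewrite /arclen subrr trep0; ring.
have E1 : Ex N (arclen N 1) = 1.
  move: lastE; rewrite E ?ltn_predL// -[X in _ + X = _]mul1r -mulrDl natr1 prednK//.
  by move/eqP; rewrite -subr_eq0 -[X in _ - X]mulr1 -mulrBr mulf_eq0 pnatr_eq0 gtn_eqF//= subr_eq0 => /eqP.
by rewrite E// E1 mulr1.
Qed.

Lemma energy_midpoint_ge0 N U V : (0 < N)%N ->
  size U = N -> size V = N -> U`_0 = 0 -> V`_0 = 0 ->
  all (fun x => 0 <= x < 1) U -> all (fun x => 0 <= x < 1) V ->
  chain N U -> chain N V ->
  0 <= HN s N U + HN s N V - 2 * HN s N (midpoint U V).
Proof.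
move=> N0 sU sV U0 V0 aU aV cU cV.
have none X j : (j < 0)%N -> N%:R * (X`_j.+1 - X`_j) <= 1 :> R by [].
have [_] := @energy_convexity R s hs N 0 1 U V N0 ltr01 sU sV U0 V0 aU aV cU cV
  (none U) (none V).
rewrite /seminorm !big_nat1 subrr expr0n mul0r mulr0 addr0 subr_ge0; exact.
Qed.

Lemma arc_centered N k U : size U = N -> U`_0 = 0 -> all (fun x => 0 <= x < 1) U ->
  (k < N)%N -> arclen N k U = N%:R * U`_k.
Proof.
move=> sU U0 aU kN; rewrite /arclen U0 subr0 trep_id//.
by apply: (allP aU); rewrite mem_nth// sU.
Qed.

Lemma midpoint_01 N U V : size U = N -> size V = N ->
  all (fun x => 0 <= x < 1) U -> all (fun x => 0 <= x < 1) V ->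
  all (fun x => 0 <= x < 1) (midpoint U V).
Proof.
move=> sU sV aU aV; apply/(all_nthP 0) => i; rewrite size_midpoint sU ?sV// => iN.
rewrite nth_midpoint ?sU ?sV//.
have := allP aU _ (mem_nth 0 (_ : i < size U)%N); rewrite sU => /(_ iN).
have := allP aV _ (mem_nth 0 (_ : i < size V)%N); rewrite sV => /(_ iN).
lra.
Qed.

Lemma arc_midpoint N k U V : size U = N -> size V = N -> U`_0 = 0 -> V`_0 = 0 ->
  all (fun x => 0 <= x < 1) U -> all (fun x => 0 <= x < 1) V -> (k < N)%N ->
  arclen N k (midpoint U V) = (arclen N k U + arclen N k V) / 2.
Proof.
move=> sU sV U0 V0 aU aV kN; rewrite (arc_centered sU)// (arc_centered sV)//.
rewrite (@arc_centered N)//; last exact: (midpoint_01 sU sV).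
- by rewrite nth_midpoint ?sU//; ring.
- by rewrite size_midpoint sU.
- by rewrite nth_midpoint ?sU// U0 V0 addr0 mul0r.
Qed.

Lemma Pr_ge0 N (A : seq R -> bool) : measurable_seq N A -> 0 <= Pr N A.
Proof. by move=> mA; apply: (Ex_ge0 hs hb); exact: admissible_bool. Qed.

Lemma Pr_le N (A B : seq R -> bool) : measurable_seq N A -> measurable_seq N B ->
  (forall X, size X = N -> all (fun x => 0 <= x < 1) X -> chain N X -> A X -> B X) ->
  Pr N A <= Pr N B.
Proof.
move=> mA mB AB; apply: (Ex_le hs hb); try exact: admissible_bool.
move=> X sX aX ch; have := AB X sX aX ch; rewrite ler_nat.
by case: (A X) (B X) => -[] // /(_ isT).
Qed.

Lemma Pr_le1 N (A : seq R -> bool) : measurable_seq N A -> Pr N A <= 1.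
Proof.
move=> mA; rewrite -(@Ex_cst _ s beta hs hb N 1 ler01); apply: (Ex_le hs hb).
- exact: admissible_bool.
- exact: admissible_cst.
- by move=> X _ _ _; case: (A X).
Qed.

Lemma Pr_or N (A B C : seq R -> bool) : measurable_seq N A -> measurable_seq N B -> measurable_seq N C ->
  (forall X, size X = N -> all (fun x => 0 <= x < 1) X -> chain N X -> A X -> B X || C X) ->
  Pr N A <= Pr N B + Pr N C.
Proof.
move=> mA mB mC ABC; rewrite /Pr -ExD//; try exact: admissible_bool.
apply: (Ex_le hs hb); [exact: admissible_bool|by apply: admissibleD; exact: admissible_bool|].
move=> X sX aX ch; have := ABC X sX aX ch; rewrite -natrD ler_nat.
by case: (A X) (B X) (C X) => -[] [] // /(_ isT).
Qed.

Lemma Pr_exists N (A : seq R -> bool) (r : seq nat) (B : nat -> seq R -> bool) :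
  measurable_seq N A -> (forall i, measurable_seq N (B i)) ->
  (forall X, size X = N -> all (fun x => 0 <= x < 1) X -> chain N X ->
     A X -> exists2 i, i \in r & B i X) ->
  Pr N A <= \sum_(i <- r) Pr N (B i).
Proof.
move=> mA mB AB.
have [gS <-] := @Ex_sum R s beta hs hb N nat r (fun i X => (B i X)%:R)
  (fun i => admissible_bool (mB i)).
apply: (Ex_le hs hb) => //; first exact: admissible_bool.
move=> X sX aX ch; case AX : (A X); last by apply: sumr_ge0.
have [i ir Bi] := AB X sX aX ch AX.
by rewrite (big_rem i)//= Bi lerDl; apply: sumr_ge0.
Qed.

Definition longer N k a X : bool := a < arclen N k X.

Lemma measurable_longer N k a : measurable_seq N (longer N k a).
Proof. by apply: measurable_seq_ltr; [exact: measurable_seq_cst|exact: measurable_arc]. Qed.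

(** The second function is the constant 1: the midpoint of a configuration with arc longer than a
    and an arbitrary one has arc longer than a / 2, since arcs are nonnegative. *)
Lemma longer_half N k a : (k < N)%N -> 0 <= a ->
  Pr N (longer N k a) <= Pr N (longer N k (a / 2)) ^+ 2.
Proof.
move=> kN a0; have N0 : (0 < N)%N by exact: leq_ltn_trans kN.
rewrite -[leLHS]mulr1 -{1}(@Ex_cst _ s beta hs hb N 1 ler01).
apply: (Ex_midpoint hs hb N0) => //; try (by apply: admissible_bool; exact: measurable_longer).
- exact: admissible_cst.
- by move=> X sX; rewrite /longer arc_differences.
- by move=> X sX; rewrite /longer arc_differences.
move=> U V sU sV U0 V0 aU aV cU cV.
have e1 : 1 <= expR (beta * (HN s N U + HN s N V - 2 * HN s N (midpoint U V))).
  apply: le_trans (expR_ge1Dx _); rewrite lerDl mulr_ge0 ?(ltW hb)//.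
  exact: energy_midpoint_ge0.
rewrite mulr1 /longer (arc_midpoint sU sV)//; case: ltP => aU'; last first.
  by rewrite mulr_ge0 ?sqr_ge0 ?expR_ge0.
have -> : a / 2 < (arclen N k U + arclen N k V) / 2 by have := arc_ge0 N k V; lra.
by rewrite expr1n mul1r.
Qed.

Lemma markov_arc N k a : (k < N)%N -> (1 < N)%N -> 0 < a ->
  Pr N (longer N k a) <= k%:R / a.
Proof.
move=> kN N1 a0; rewrite ler_pdivlMr// mulrC -(Ex_arc kN N1).
rewrite /Pr -ExZ ?(ltW a0)//; last by apply: admissible_bool; exact: measurable_longer.
have g := admissible_bool (measurable_longer N k a).
apply: (Ex_le hs hb) => //.
- by apply: admissibleM => //; apply: admissible_cst; exact: ltW.
- exact: admissible_arc.
move=> X _ _ _; rewrite /longer; case: ltP => h; first by rewrite mulr1 ltW.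
by rewrite mulr0 arc_ge0.
Qed.

(** Markov gives 1/4 at T = 4 k, and each doubling of T squares the bound, as it does exp (- T / (8
    k)). Below 4 k the prefactor 2 makes the claim trivial; the induction counts the halvings needed
    to bring T down to the range where Markov suffices. *)
Lemma longer_exp N k T : (0 < k)%N -> (k < N)%N -> 0 <= T ->
  Pr N (longer N k T) <= 2 * expR (- (T / (8 * k%:R))).
Proof.
move=> k0 kN T0; have N1 : (1 < N)%N by exact: leq_ltn_trans kN.
have kR : 0 < k%:R :> R by rewrite ltr0n.
have half : 2^-1 <= expR (- 2^-1 : R).
  by apply: le_trans (expR_ge1Dx _); lra.
have [T4|T4] := leP (4 * k%:R) T; last first.
  apply: le_trans (Pr_le1 (measurable_longer N k T)) _.
  rewrite -ler_pdivrMl// mulr1; apply: le_trans half _.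
  by rewrite ler_expR lerN2 ler_pdivrMr ?mulr_gt0//; lra.
apply: (@le_trans _ _ (expR (- (T / (8 * k%:R))))); last first.
  by rewrite ler_peMl ?expR_ge0// ler1n.
have [m Tm] : exists m : nat, T <= 4 * k%:R * 2 ^+ m.
  exists (Num.truncn T).+1; apply: (@le_trans _ _ (2 ^+ (Num.truncn T).+1)).
    apply: (@le_trans _ _ (Num.truncn T).+1%:R); first by rewrite ltW// truncnS_gt.
    by rewrite -natrX ler_nat ltnW// ltn_expl.
  by rewrite ler_peMl ?exprn_ge0//; have : (1 : R) <= k%:R by [rewrite ler1n]; lra.
elim: m T T0 T4 Tm => [|m IH] T T0 T4 Tm.
  rewrite expr0 mulr1 in Tm; have TE : T = 4 * k%:R by apply/eqP; rewrite eq_le Tm T4.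
  have T0' : 0 < T by rewrite TE mulr_gt0.
  apply: le_trans (markov_arc kN N1 T0') _.
  rewrite TE; have -> : k%:R / (4 * k%:R) = 4^-1 :> R by field; rewrite gt_eqF.
  have -> : 4 * k%:R / (8 * k%:R) = 2^-1 :> R by field; rewrite gt_eqF.
  by apply: le_trans half; lra.
have [T8|T8] := leP (8 * k%:R) T; last first.
  have T0' : 0 < T by apply: lt_le_trans T4; rewrite mulr_gt0.
  apply: le_trans (markov_arc kN N1 T0') _.
  apply: (@le_trans _ _ (expR (- 1))); last first.
    by rewrite ler_expR lerN2 ler_pdivrMr ?mulr_gt0// mul1r ltW.
  apply: (@le_trans _ _ (2^-1 ^+ 2)).
    by rewrite ler_pdivrMr//; lra.
  have -> : (- 1 : R) = 2%:R * (- 2^-1) by field.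
  by rewrite expRM_natl ler_sqr// nnegrE ?expR_ge0.
apply: le_trans (longer_half kN T0) _.
have T2 : 0 <= T / 2 by rewrite divr_ge0.
apply: (@le_trans _ _ (expR (- (T / 2 / (8 * k%:R))) ^+ 2)).
  rewrite ler_sqr ?nnegrE ?expR_ge0 ?Pr_ge0//; last exact: measurable_longer.
  by apply: IH => //; move: Tm; rewrite ?exprS; lra.
rewrite -expRM_natl ler_expR le_eqVlt; apply/orP; left; apply/eqP.
by field; rewrite gt_eqF.
Qed.

End ArcTails.

(** * Sub-Gaussian concentration of arc lengths *)

Section ArcConcentration.
Context {R : realType}.
Variables (s beta : R) (hs : 0 < s < 1) (hb : 0 < beta).
Local Notation RR := (measurableTypeR R).
Local Notation Ex := (Ex s beta).
Local Notation Pr := (Pr s beta).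
Implicit Types (N k i j : nat) (X U V : seq R) (a t T p w : R).

(** The partial sums have a closed form; the full series has the value 144 + 9 = 153. *)
Lemma sum_odd_geometric (M : nat) :
  \sum_(0 <= n < M) (2 * n%:R + 1) * (8 / 9) ^+ n <= 153 :> R.
Proof.
have -> : \sum_(0 <= n < M) (2 * n%:R + 1) * (8 / 9) ^+ n =
    153 - (18 * M%:R + 153) * (8 / 9) ^+ M :> R.
  elim: M => [|M IH]; first by rewrite big_geq// expr0; ring.
  by rewrite big_nat_recr//= IH exprS -natr1; field.
by rewrite gerBl mulr_ge0// ?exprn_ge0// addr_ge0// mulr_ge0.
Qed.

(** Sums of consecutive odd numbers are squares: y^2 is at most the square of its ceiling, written
    as a sum over levels so that tail bounds yield second moments. *)
Lemma sqr_le_sum_odd (M : nat) (y : R) : 0 <= y <= M%:R ->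
  y ^+ 2 <= \sum_(0 <= n < M) (2 * n%:R + 1) * (n%:R < y)%R%:R.
Proof.
elim: M => [|M IH] /andP[y0 yM].
  by rewrite big_geq// (_ : y = 0) ?expr0n//; apply/eqP; rewrite eq_le y0 yM.
rewrite big_nat_recr//=; have [yM'|My] := leP y M%:R.
  by rewrite mulr0 addr0 IH// y0.
rewrite mulr1.
have -> : \sum_(0 <= n < M) (2 * n%:R + 1) * (n%:R < y)%R%:R = M%:R ^+ 2 :> R.
  transitivity (\sum_(0 <= n < M) (2 * n%:R + 1) : R).
    rewrite !big_nat; apply: eq_bigr => n /andP[_ nM].
    by rewrite (lt_trans _ My) ?mulr1// ltr_nat.
  elim: (M) => [|m IHm]; first by rewrite big_geq// expr0n.
  by rewrite big_nat_recr//= IHm -natr1; ring.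
have -> : M%:R ^+ 2 + (2 * M%:R + 1) = M.+1%:R ^+ 2 :> R by rewrite -natr1; ring.
by rewrite ler_sqr ?nnegrE.
Qed.

(** Tails are taken at multiples of k: the n-th is at most 2 (8/9)^n because exp (1/8) >= 9/8, and
    306 is twice 153. *)
Lemma Ex_arc_sqr N k : (0 < k)%N -> (k < N)%N ->
  Ex N (fun X => arclen N k X ^+ 2) <= 306 * k%:R ^+ 2.
Proof.
move=> k0 kN; have kR : 0 < k%:R :> R by rewrite ltr0n.
have g1 n : admissible N (fun X => (longer N k (n%:R * k%:R) X)%:R : R).
  by apply: admissible_bool; exact: measurable_longer.
have g2 n : admissible N (fun X => (2 * n%:R + 1) * (longer N k (n%:R * k%:R) X)%:R : R).
  by apply: admissibleM => //; apply: admissible_cst; rewrite addr_ge0// mulr_ge0.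
have [gS ES] := Ex_sum hs hb (index_iota 0 N) g2.
apply: (@le_trans _ _ (Ex N (fun X => k%:R ^+ 2 *
    \sum_(0 <= n < N) (2 * n%:R + 1) * (longer N k (n%:R * k%:R) X)%:R))).
  apply: (Ex_le hs hb).
  - by apply: admissibleM; exact: admissible_arc.
  - by apply: admissibleM => //; apply: admissible_cst; rewrite exprn_ge0.
  move=> X _ _ _.
  have -> : arclen N k X ^+ 2 = k%:R ^+ 2 * (arclen N k X / k%:R) ^+ 2.
    by field; rewrite gt_eqF.
  apply: ler_wpM2l; first exact: sqr_ge0.
  apply: le_trans (sqr_le_sum_odd (M := N) _) _.
    rewrite divr_ge0 ?arc_ge0//= ler_pdivrMr//; apply: le_trans (arc_le N k X) _.
    by rewrite ler_peMr// ler1n.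
  by apply: ler_sum => n _; rewrite /longer -ltr_pdivlMr.
have k2 : 0 <= k%:R ^+ 2 :> R by exact: sqr_ge0.
rewrite (ExZ hs hb k2 gS).
rewrite mulrC ler_pM2r ?exprn_gt0// ES.
apply: (@le_trans _ _ (\sum_(0 <= n < N) 2 * ((2 * n%:R + 1) * (8 / 9) ^+ n))); last first.
  by rewrite -mulr_sumr; have := sum_odd_geometric N; lra.
apply: ler_sum => n _; have n1 : 0 <= 2 * n%:R + 1 :> R by rewrite addr_ge0// mulr_ge0.
rewrite (ExZ hs hb n1 (g1 n)) [leRHS]mulrCA; apply: ler_wpM2l => //.
apply: le_trans (longer_exp hs hb k0 kN _) _; first by rewrite mulr_ge0.
apply: ler_wpM2l => //.
have -> : - (n%:R * k%:R / (8 * k%:R)) = n%:R * (- 8^-1) :> R.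
  by field; rewrite gt_eqF.
rewrite expRM_natl; apply: lerXn2r; rewrite ?nnegrE ?expR_ge0//.
rewrite expRN -div1r ler_pdivrMr ?expR_gt0//.
by have := @expR_ge1Dx R 8^-1; lra.
Qed.

(** Cauchy-Schwarz in the form x <= p x^2 / (2 k) + k / (2 p) on the event; the two terms contribute
    153 k p and k p / 2. *)
Lemma Ex_arc_event N k p (A : seq R -> bool) : (0 < k)%N -> (k < N)%N -> 0 < p ->
  measurable_seq N A -> Pr N A <= p ^+ 2 ->
  Ex N (fun X => arclen N k X * (A X)%:R) <= 154 * k%:R * p.
Proof.
move=> k0 kN p0 mA PA; have kR : 0 < k%:R :> R by rewrite ltr0n.
have gA := admissible_bool mA; have ga := admissible_arc (R := R) N k.
have gaa := admissibleM ga ga.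
have c1 : 0 <= p / (2 * k%:R) by rewrite divr_ge0 ?mulr_ge0 ?(ltW p0).
have c2 : 0 <= k%:R / (2 * p) by rewrite divr_ge0 ?mulr_ge0 ?(ltW p0).
have g1 := admissibleM (admissible_cst N c1) gaa.
have g2 := admissibleM (admissible_cst N c2) gA.
apply: (@le_trans _ _ (Ex N (fun X => p / (2 * k%:R) * (arclen N k X * arclen N k X) +
    k%:R / (2 * p) * (A X)%:R))).
  apply: (Ex_le hs hb); [exact: admissibleM|exact: admissibleD|].
  move=> X _ _ _; set x := arclen N k X; case: (A X); last first.
    by rewrite !mulr0 addr0 mulr_ge0// -expr2 sqr_ge0.
  rewrite !mulr1 -subr_ge0.
  have -> : p / (2 * k%:R) * (x * x) + k%:R / (2 * p) - x =
    (p * x - k%:R) ^+ 2 / (2 * k%:R * p) by field; rewrite !gt_eqF.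
  by rewrite divr_ge0 ?sqr_ge0// !mulr_ge0// ltW.
rewrite ExD// !ExZ//.
have h1 : Ex N (fun X => arclen N k X * arclen N k X) <= 306 * k%:R ^+ 2.
  exact: Ex_arc_sqr.
have := ler_wpM2l c1 h1; have := ler_wpM2l c2 PA.
have -> : k%:R / (2 * p) * p ^+ 2 = k%:R * p / 2 by field; rewrite gt_eqF.
have -> : p / (2 * k%:R) * (306 * k%:R ^+ 2) = 153 * (k%:R * p) by field; rewrite gt_eqF.
have : 0 <= k%:R * p by rewrite mulr_ge0// ltW.
rewrite /Pr; lra.
Qed.

(** The event K. It is cut out by upper bounds on gaps, which are linear in the ordered coordinates,
    so it is stable under midpoints. *)
Definition short N k T X : bool :=
  all (fun j => N%:R * trep (X`_j.+1 - X`_j) <= T) (iota 0 k).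

Lemma measurable_short N k T : measurable_seq N (short N k T).
Proof.
apply: measurable_seq_all => j; apply: measurable_seq_ler; last exact: measurable_seq_cst.
apply: measurable_seqM; first exact: measurable_seq_cst.
by apply: measurable_seq_trep; apply: measurable_seqB; exact: measurable_seq_nth.
Qed.

Lemma Pr_not_short N k T : (k < N)%N -> 0 <= T ->
  Pr N (fun X => ~~ short N k T X) <= 2 * k%:R * expR (- (T / 8)).
Proof.
move=> kN T0; case: k kN => [|k'] kN.
  rewrite mulr0 mul0r -(@Ex_cst _ s beta hs hb N 0 (lexx 0)); apply: (Ex_le hs hb).
  - by apply: admissible_bool; apply: measurable_seq_neg; exact: measurable_short.
  - exact: admissible_cst.
  - by move=> X _ _ _.
set k := k'.+1 in kN *.
have N1 : (1 < N)%N by apply: leq_ltn_trans kN.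
(* [minn j N] makes the rotation legitimate for every j; on the range summed over it equals j. *)
pose B j X := longer N 1 T (rot (minn j N) X).
have gB j : admissible N (fun X => (B j X)%:R : R).
  apply: (@admissible_rot R N (fun X => (longer N 1 T X)%:R)); first exact: geq_minr.
  by apply: admissible_bool; exact: measurable_longer.
have [gS ES] := Ex_sum hs hb (iota 0 k) gB.
apply: (@le_trans _ _ (Ex N (fun X => \sum_(j <- iota 0 k) (B j X)%:R))).
  apply: (Ex_le hs hb) => //.
    by apply: admissible_bool; apply: measurable_seq_neg; exact: measurable_short.
  move=> X sX _ _; case: (boolP (short N k T X)) => [_|]; first by apply: sumr_ge0.
  rewrite -has_predC => /hasP[j jk /= hj].
  have jk' : (j < k)%N by move: jk; rewrite mem_iota add0n => /andP[].
  have jN : (j.+1 < N)%N by apply: leq_ltn_trans kN.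
  rewrite (big_rem j)//= (_ : B j X) ?lerDl ?sumr_ge0//.
  rewrite /B (minn_idPl _) ?(ltnW (ltnW jN))// /longer arclen_rot ?(ltnW jN)//.
  by rewrite addn1 modn_small// ltNge.
rewrite ES; apply: (@le_trans _ _ (\sum_(j <- iota 0 k) 2 * expR (- (T / 8)))).
  apply: ler_sum => j _.
  rewrite (@Ex_rot R s beta hs hb N (fun X => (longer N 1 T X)%:R)) ?geq_minr//; last first.
    by apply: admissible_bool; exact: measurable_longer.
  by have := longer_exp hs hb (ltn0Sn 0) N1 T0; rewrite mulr1.
rewrite big_const_seq count_predT size_iota iter_addr_0 -mulr_natr.
by rewrite le_eqVlt; apply/orP; left; apply/eqP; ring.
Qed.

Lemma admissible_exp_arc N k t (c : R) :
  admissible N (fun X => expR (t * (arclen N k X - c))).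
Proof.
split => [|X|]; first last.
- exists (expR (`|t| * (N%:R + `|c|))) => X; rewrite ler_expR.
  apply: le_trans (ler_norm _) _; rewrite normrM; apply: ler_wpM2l => //.
  apply: le_trans (ler_normB _ _) _; rewrite lerD2r ger0_norm ?arc_ge0//.
  exact: arc_le.
- exact: expR_ge0.
apply: (@measurable_seq_comp _ _ _ RR RR); first exact: measurable_expR.
apply: measurable_seqM; first exact: measurable_seq_cst.
by apply: measurable_seqB; [exact: measurable_arc|exact: measurable_seq_cst].
Qed.

Definition tilt N k T t X : R := (short N k T X)%:R * expR (t * (arclen N k X - k%:R)).

Lemma admissible_tilt N k T t : admissible N (tilt N k T t).
Proof.
by apply: admissibleM; [apply: admissible_bool; exact: measurable_short|exact: admissible_exp_arc].
Qed.

(** Variance proxy: the term t^2 k^s / (s beta kappa) that [increment_le_seminorm] gives when kappa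
    = s^2 T^(- s - 2) / 4 is the convexity constant of the energy. *)
Definition proxy k T : R := 4 * k%:R `^ s * T `^ (s + 2) / (beta * s ^+ 3).

Lemma short_differences N k T X : (k < N)%N -> size X = N ->
  short N k T (differences X) = short N k T X.
Proof.
move=> kN sX; apply: eq_in_all => j; rewrite mem_iota add0n => /andP[_ jk].
have jN : (j.+1 < N)%N by apply: leq_ltn_trans kN.
by rewrite (differences_trep sX jN (ltnW jN)).
Qed.

(** With opposite tilts the centring at k cancels and t (psi k - psi 0), psi = N (U - V), is left in
    the exponent. Its seminorm part is absorbed by the energy gain; the constant that remains is put
    into the middle function as c. *)
Lemma tilt_product_le N k T t : (0 < k)%N -> (k < N)%N -> 0 < T ->
  Ex N (tilt N k T t) * Ex N (tilt N k T (- t)) <= expR (proxy k T * t ^+ 2).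
Proof.
move=> k0 kN T0; have N0 : (0 < N)%N by exact: leq_ltn_trans kN.
have [s0 s1] := andP hs.
set c := expR (proxy k T * t ^+ 2 / 2).
have c2 : c ^+ 2 = expR (proxy k T * t ^+ 2).
  by rewrite -expRM_natl; congr expR; field.
have gH : admissible N (fun X => c * (short N k T X)%:R).
  apply: admissibleM; first by apply: admissible_cst; exact: expR_ge0.
  by apply: admissible_bool; exact: measurable_short.
apply: (@le_trans _ _ (Ex N (fun X => c * (short N k T X)%:R) ^+ 2)); last first.
  rewrite -c2 ler_sqr ?nnegrE ?expR_ge0 ?(Ex_ge0 hs hb)//.
  rewrite ExZ ?expR_ge0//; last by apply: admissible_bool; exact: measurable_short.
  by apply: ler_piMr; [exact: expR_ge0|apply: (Pr_le1 hs hb); exact: measurable_short].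
apply: (Ex_midpoint hs hb N0) => //; try exact: admissible_tilt.
- by move=> X sX; rewrite /tilt arc_differences// short_differences.
- by move=> X sX; rewrite /tilt arc_differences// short_differences.
- by move=> X sX; rewrite short_differences.
move=> U V sU sV U0 V0 aU aV cU cV; rewrite /tilt.
case: (boolP (short N k T U)) => KU; last by rewrite mul0r mul0r mulr_ge0 ?sqr_ge0 ?expR_ge0.
case: (boolP (short N k T V)) => KV; last by rewrite mul0r mulr0 mulr_ge0 ?sqr_ge0 ?expR_ge0.
have gap W : size W = N -> W`_0 = 0 -> all (fun x => 0 <= x < 1) W -> chain N W ->
    short N k T W -> forall j, (j < k)%N -> N%:R * (W`_j.+1 - W`_j) <= T.
  move=> sW W0 aW cW KW j jk; have jN : (j.+1 < N)%N by apply: leq_ltn_trans kN.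
  have := allP KW j; rewrite mem_iota add0n jk => /(_ isT).
  rewrite (trepB_chain cW (leqnSn j) jN) W0 !subr0 !trep_id//.
    by apply: (allP aW); rewrite mem_nth// sW ltnW.
  by apply: (allP aW); rewrite mem_nth// sW.
have gU := gap U sU U0 aU cU KU; have gV := gap V sV V0 aV cV KV.
have [cM EC] := energy_convexity hs kN T0 sU sV U0 V0 aU aV cU cV gU gV.
have KM : short N k T (midpoint U V).
  apply/allP => j; rewrite mem_iota add0n => /andP[_ jk].
  have jN : (j.+1 < N)%N by apply: leq_ltn_trans kN.
  have sM : size (midpoint U V) = N by rewrite size_midpoint sU.
  have aM := midpoint_01 sU sV aU aV.
  have M0 : (midpoint U V)`_0 = 0 by rewrite nth_midpoint ?sU// U0 V0 addr0 mul0r.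
  rewrite (trepB_chain cM (leqnSn j) jN) M0 !subr0 !trep_id//; last 2 first.
  - by apply: (allP aM); rewrite mem_nth// sM ltnW.
  - by apply: (allP aM); rewrite mem_nth// sM.
  rewrite !nth_midpoint ?sU//; have := gU j jk; have := gV j jk.
  move=> h1 h2.
  have -> : N%:R * ((U`_j.+1 + V`_j.+1) / 2 - (U`_j + V`_j) / 2) =
    (N%:R * (U`_j.+1 - U`_j) + N%:R * (V`_j.+1 - V`_j)) / 2 by field.
  by rewrite ler_pdivrMr// mulr_natr mulr2n; exact: lerD.
rewrite KM !mul1r mulr1 c2 -!expRD ler_expR.
set psi := fun i => N%:R * (U`_i - V`_i) in EC *.
set kappa := s ^+ 2 / 4 * T `^ (- s - 2) in EC.
have T2 : 0 < T `^ (s + 2) by exact: powR_gt0.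
have kE : kappa = s ^+ 2 / (4 * T `^ (s + 2)).
  rewrite /kappa (_ : - s - 2 = - (s + 2)); last by ring.
  by rewrite powRN; field; rewrite gt_eqF.
have kp : 0 < beta * kappa.
  by rewrite mulr_gt0// kE divr_gt0 ?exprn_gt0 ?mulr_gt0.
have := increment_le_seminorm psi t k hs kp.
have -> : t ^+ 2 * k%:R `^ s / (s * (beta * kappa)) = proxy k T * t ^+ 2.
  by rewrite kE /proxy; field; rewrite !gt_eqF.
rewrite (arc_centered sU)// (arc_centered sV)// /psi U0 V0 subrr mulr0 subr0 => h.
have -> : t * (N%:R * U`_k - k%:R) + - t * (N%:R * V`_k - k%:R) =
  t * (N%:R * (U`_k - V`_k)) by ring.
apply: le_trans h _; rewrite addrC lerD2l -mulrA; apply: ler_wpM2l; first exact: ltW.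
by rewrite lerBrDl.
Qed.

(** On K, exp y >= 1 + y. Restricting to K lowers the probability by at most p^2 and shifts the
    centred mean by at most 154 k p, so 312 k p <= 1 keeps the total loss below 1/2. *)
Lemma Ex_tilt_ge N k T p t : (0 < k)%N -> (k < N)%N -> 0 < T -> 0 < p -> p <= 1 ->
  2 * k%:R * expR (- (T / 8)) <= p ^+ 2 -> 312 * k%:R * p <= 1 -> - 1 <= t <= 1 ->
  2^-1 <= Ex N (tilt N k T t).
Proof.
move=> k0 kN T0 p0 p1 Tp kp /andP[t0 t1].
have kR : 1 <= k%:R :> R by rewrite ler1n.
have N1 : (1 < N)%N by exact: leq_ltn_trans kN.
have mK : measurable_seq N (short N k T) by exact: measurable_short.
have mKc : measurable_seq N (fun X => ~~ short N k T X) by exact: measurable_seq_neg.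
have gK := admissible_bool mK; have gKc := admissible_bool mKc.
have ga := admissible_arc (R := R) N k.
have PKc : Pr N (fun X => ~~ short N k T X) <= p ^+ 2.
  by apply: le_trans Tp; apply: Pr_not_short => //; exact: ltW.
have PK : Pr N (short N k T) + Pr N (fun X => ~~ short N k T X) = 1.
  rewrite /Pr -ExD//; transitivity (Ex N (fun _ => 1)); last exact: (Ex_cst hs hb).
  apply: (eq_Ex hs hb); [exact: admissibleD|exact: admissible_cst|].
  by move=> X _ _ _; case: (short N k T X); rewrite /= ?addr0 ?add0r.
have Ea := Ex_arc hs hb kN N1.
have Eac := Ex_arc_event k0 kN p0 mKc PKc.
have EaK : Ex N (fun X => arclen N k X * (short N k T X)%:R) +
    Ex N (fun X => arclen N k X * (~~ short N k T X)%:R) = k%:R.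
  rewrite -Ea -ExD//; try exact: admissibleM.
  apply: (eq_Ex hs hb); [by apply: admissibleD; exact: admissibleM|exact: ga|].
  by move=> X _ _ _; case: (short N k T X); rewrite /= ?mulr1 ?mulr0 ?addr0 ?add0r.
have Eac0 : 0 <= Ex N (fun X => arclen N k X * (~~ short N k T X)%:R).
  by apply: (Ex_ge0 hs hb); exact: admissibleM.
have PKc0 := Pr_ge0 hs hb mKc.
set A := Ex N (fun X => arclen N k X * (short N k T X)%:R) in EaK.
set B := Ex N (fun X => arclen N k X * (~~ short N k T X)%:R) in EaK Eac Eac0.
set q := Pr N (fun X => ~~ short N k T X) in PKc PK PKc0.
set r := Pr N (short N k T) in PK.
have pp : p ^+ 2 <= p by rewrite expr2 ler_piMl// ltW.
have kpp : k%:R * p ^+ 2 <= k%:R * p by apply: ler_wpM2l.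
have pkp : p <= k%:R * p by rewrite ler_peMl// ltW.
have kq : k%:R * q <= k%:R * p ^+ 2 by apply: ler_wpM2l.
have kq0 : 0 <= k%:R * q by rewrite mulr_ge0.
have gt := admissible_tilt N k T t.
have [t00|t00] := leP 0 t.
(* Written with nonnegative terms on both sides, since expectations are linear on admissible
   functions; for t < 0 the terms change sides. *)
- have h : r + t * A <= Ex N (tilt N k T t) + (t * k%:R) * r.
    rewrite /r /A /Pr -!ExZ ?mulr_ge0//; try exact: admissibleM.
    rewrite -!ExD//; try (by apply: admissibleM => //; apply: admissible_cst; rewrite ?mulr_ge0);
      try (by apply: admissibleM; [apply: admissible_cst|exact: admissibleM]).
    apply: (Ex_le hs hb).
    - by apply: admissibleD => //; apply: admissibleM; [exact: admissible_cst|exact: admissibleM].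
    - by apply: admissibleD => //; apply: admissibleM => //; apply: admissible_cst; rewrite mulr_ge0.
    move=> X _ _ _; rewrite /tilt; case: (short N k T X); last by rewrite !mulr0 mul0r addr0.
    rewrite !mulr1 mul1r; have := @expR_ge1Dx R (t * (arclen N k X - k%:R)).
    by rewrite mulrBr -[true%:R]/(1 : R); lra.
  have tB : t * B <= B by rewrite ler_piMl.
  have e1 : t * A = t * k%:R - t * B by rewrite -EaK; ring.
  have e2 : t * k%:R * r = t * k%:R - t * (k%:R * q).
    by rewrite -[X in _ = X - _]mulr1 -PK; ring.
  have tq : 0 <= t * (k%:R * q) by rewrite mulr_ge0.
  lra.
- have nt : 0 <= - t by lra.
  have h : r + (- t * k%:R) * r <= Ex N (tilt N k T t) + (- t) * A.
    rewrite /r /A /Pr -!ExZ ?mulr_ge0//; try exact: admissibleM.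
    rewrite -!ExD//; try (by apply: admissibleM => //; apply: admissible_cst; rewrite ?mulr_ge0);
      try (by apply: admissibleM; [apply: admissible_cst|exact: admissibleM]).
    apply: (Ex_le hs hb).
    - by apply: admissibleD => //; apply: admissibleM => //; apply: admissible_cst; rewrite mulr_ge0.
    - by apply: admissibleD => //; apply: admissibleM; [exact: admissible_cst|exact: admissibleM].
    move=> X _ _ _; rewrite /tilt; case: (short N k T X); last by rewrite !mulr0 mul0r !addr0.
    rewrite !mulr1 mul1r; have := @expR_ge1Dx R (t * (arclen N k X - k%:R)).
    by rewrite mulrBr -[true%:R]/(1 : R); lra.
  have e1 : - t * A = - t * k%:R + t * B by rewrite -EaK; ring.
  have e2 : - t * k%:R * r = - t * k%:R - (- t) * (k%:R * q).
    by rewrite -[X in _ = X - _]mulr1 -PK; ring.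
  have tB : t * B <= 0 by rewrite mulr_le0_ge0// ltW.
  have tq : - t * (k%:R * q) <= k%:R * q by rewrite ler_piMl//; lra.
  lra.
Qed.

(** Each tilted expectation is at most 2 exp (proxy t^2), because the product is bounded and the
    other factor is at least 1/2; the exponential Markov inequality on both sides gives the factor
    4. *)
Lemma arc_concentration N k T p t w : (0 < k)%N -> (k < N)%N -> 0 < T -> 0 < p -> p <= 1 ->
  2 * k%:R * expR (- (T / 8)) <= p ^+ 2 -> 312 * k%:R * p <= 1 -> 0 <= t <= 1 ->
  Pr N (fun X => w < `|arclen N k X - k%:R|) <= p ^+ 2 + 4 * expR (proxy k T * t ^+ 2 - t * w).
Proof.
move=> k0 kN T0 p0 p1 Tp kp /andP[t0 t1].
have mK : measurable_seq N (short N k T) by exact: measurable_short.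
have mKc : measurable_seq N (fun X => ~~ short N k T X) by exact: measurable_seq_neg.
have PKc : Pr N (fun X => ~~ short N k T X) <= p ^+ 2.
  by apply: le_trans Tp; apply: Pr_not_short => //; exact: ltW.
have t11 : - 1 <= t <= 1 by lra.
have t11' : - 1 <= - t <= 1 by lra.
have a2 := Ex_tilt_ge k0 kN T0 p0 p1 Tp kp t11.
have b2 := Ex_tilt_ge k0 kN T0 p0 p1 Tp kp t11'.
have ab := tilt_product_le t k0 kN T0.
set a := Ex N (tilt N k T t) in a2 ab; set b := Ex N (tilt N k T (- t)) in b2 ab.
set E := expR (proxy k T * t ^+ 2) in ab.
have E0 : 0 <= E by exact: expR_ge0.
have aE : a <= 2 * E by nra.
have bE : b <= 2 * E by nra.
have mw : measurable_seq N (fun X => w < `|arclen N k X - k%:R|).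
  apply: measurable_seq_ltr; first exact: measurable_seq_cst.
  apply: (@measurable_seq_comp _ _ _ RR RR); first exact: normr_measurable.
  by apply: measurable_seqB; [exact: measurable_arc|exact: measurable_seq_cst].
have gt u : admissible N (tilt N k T u) by exact: admissible_tilt.
have ew : 0 <= expR (- (t * w)) by exact: expR_ge0.
have gtw u : admissible N (fun X => expR (- (t * w)) * tilt N k T u X).
  by apply: admissibleM => //; exact: admissible_cst.
apply: (@le_trans _ _ (Ex N (fun X => (~~ short N k T X)%:R +
   (expR (- (t * w)) * tilt N k T t X + expR (- (t * w)) * tilt N k T (- t) X)))).
  apply: (Ex_le hs hb).
  - exact: admissible_bool.
  - by apply: admissibleD; [exact: admissible_bool|exact: admissibleD].
  move=> X _ _ _; set x := arclen N k X - k%:R.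
  have tilt0 u : 0 <= expR (- (t * w)) * tilt N k T u X by case: (gtw u).
  case: (boolP (w < `|x|)) => hx; last by rewrite !addr_ge0.
  case: (boolP (short N k T X)) => hK; last by rewrite lerDl addr_ge0.
  rewrite add0r /tilt hK !mul1r -/x -!expRD.
  have [x0|x0] := leP 0 x.
    rewrite ger0_norm// in hx.
    apply: (@le_trans _ _ (expR (- (t * w) + t * x))); last by rewrite lerDl expR_ge0.
    apply: le_trans (expR_ge1Dx _); rewrite lerDl.
    by rewrite addrC -mulrBr mulr_ge0// subr_ge0 ltW.
  rewrite ltr0_norm// in hx.
  apply: (@le_trans _ _ (expR (- (t * w) + - t * x))); last by rewrite lerDr expR_ge0.
  apply: le_trans (expR_ge1Dx _); rewrite lerDl.
  by rewrite mulNr -opprD oppr_ge0 -mulrDr mulr_ge0_le0//; lra.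
rewrite ExD//; [|exact: admissible_bool|exact: admissibleD].
rewrite ExD// !ExZ//; apply: lerD => //.
rewrite expRD -/E -/a -/b.
have := ler_wpM2l ew aE; have := ler_wpM2l ew bE; lra.
Qed.

End ArcConcentration.

(** * Choice of the gap bound and of the tilt *)

Section Rigidity.
Context {R : realType}.
Variables (s eps : R) (hs : 0 < s < 1) (heps : 0 < eps < 1).
Local Notation RR := (measurableTypeR R).
Implicit Types (beta x y : R) (N k n : nat).

(** The tilt must stay at most 1, while its natural size is proportional to beta; the minimum
    respects both and stays bounded and bounded away from 0 on compact sets of beta. *)
Definition inv_temp beta : R := Num.min beta 1.

Lemma inv_temp_gt0 beta : 0 < beta -> 0 < inv_temp beta.
Proof. by move=> b0; rewrite lt_min b0 ltr01. Qed.

Lemma inv_temp_le1 beta : inv_temp beta <= 1.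
Proof. by rewrite ge_min lexx orbT. Qed.

Lemma inv_temp_le beta : inv_temp beta <= beta.
Proof. by rewrite ge_min lexx. Qed.

Lemma loc_unif_mul_inv_temp (c : R) : 0 < c -> loc_unif (fun beta => c * inv_temp beta).
Proof.
move=> c0 a b a0 ab; exists c, (c * inv_temp a); split.
  by rewrite mulr_gt0// inv_temp_gt0.
move=> beta /andP[ab1 _]; rewrite ler_pM2l// ler_piMr ?inv_temp_le1 ?(ltW c0)// andbT.
by rewrite le_min !ge_min ab1 lexx orbT.
Qed.

Lemma loc_unif_mul_inv_temp_exp (c : R) n : 0 < c ->
  loc_unif (fun beta => c * (inv_temp beta)^-1 ^+ n).
Proof.
move=> c0 a b a0 ab; exists (c * (inv_temp a)^-1 ^+ n), c; split=> // beta /andP[ab1 _].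
have b0 : 0 < beta by exact: lt_le_trans ab1.
have ia := inv_temp_gt0 a0; have ib := inv_temp_gt0 b0.
apply/andP; split.
  rewrite ler_peMr ?(ltW c0)//; apply: exprn_ege1.
  by rewrite invf_ge1// inv_temp_le1.
rewrite ler_pM2l//; apply: lerXn2r; rewrite ?nnegrE ?invr_ge0 ?(ltW ia) ?(ltW ib)//.
rewrite lef_pV2 ?posrE//.
by rewrite le_min !ge_min ab1 lexx orbT.
Qed.

Lemma powR_ge1 x y : 1 <= x -> 0 <= y -> 1 <= x `^ y.
Proof. by move=> x1 y0; rewrite -[X in X <= _](powRr0 x); apply: ler_powR. Qed.

Lemma exp_ge_pow n x : 0 <= x -> x ^+ n / n`!%:R <= expR x.
Proof.
move=> x0; case: n => [|n].
  by rewrite expr0 divr1; apply: le_trans (expR_ge1Dx _); rewrite lerDl.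
by apply: le_trans (expR_ge1Dxn n x0); rewrite lerDr.
Qed.

(** Lets polynomial factors in x be absorbed by an exponential of x^tau; any n >= 1 / tau would
    do. *)
Lemma le_pow_of_powR (tau : R) : 0 < tau ->
  exists n : nat, (0 < n)%N /\ forall x, 1 <= x -> x <= (x `^ tau) ^+ n.
Proof.
move=> t0; exists (Num.truncn tau^-1).+1; split => // x x1.
have x0 : 0 <= x by apply: le_trans x1.
rewrite -powR_mulrn ?powR_ge0// -powRrM; apply: le1r_powR => //.
by rewrite -ler_pdivrMl// mulr1 ltW// truncnS_gt.
Qed.

(* Among the first k points every gap is below k^gap_exp outside an event of
   stretched-exponentially small probability, and s + (s + 2) gap_exp stays below
   2 fluct_exp, which leaves room in the sub-Gaussian bound. *)
Definition gap_exp : R := 5 * eps / (8 * (s + 2)).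

(** Taking half of eps keeps this exponent below 1, which s / 2 + eps may exceed; counting relies on
    L^fluct_exp <= L. *)
Definition fluct_exp : R := s / 2 + eps / 2.

Lemma gap_exp_gt0 : 0 < gap_exp.
Proof.
have [s0 _] := andP hs; have [e0 _] := andP heps.
by apply: divr_gt0; lra.
Qed.

Lemma gap_expM : gap_exp * (s + 2) = 5 * eps / 8.
Proof.
have s2 : s + 2 != 0 by have [s0 _] := andP hs; lra.
by rewrite /gap_exp; field.
Qed.

Lemma gap_exp_le : gap_exp <= 3 * eps / 8.
Proof.
have [s0 _] := andP hs; have [e0 _] := andP heps.
rewrite /gap_exp ler_pdivrMr; last by lra.
have -> : 3 * eps / 8 * (8 * (s + 2)) = 3 * eps * (s + 2) by field.
nra.
Qed.

Lemma arc_rigidity : exists C : R, 0 < C /\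
  forall beta N k, 0 < beta -> (0 < k)%N -> (k < N)%N ->
  Pr s beta N (fun X => k%:R `^ fluct_exp / 8 < `|arclen N k X - k%:R|) <=
  C * expR (- (s ^+ 3 / 64 / 16 * inv_temp beta * k%:R `^ gap_exp)).
Proof.
have [s0 s1] := andP hs; have [e0 e1] := andP heps.
have [n [n0 hn]] := le_pow_of_powR gap_exp_gt0.
pose c1 := s ^+ 3 / 64; set c0 := _ / 16.
have s3 : 0 < s ^+ 3 by exact: exprn_gt0.
have s31 : s ^+ 3 <= 1 by rewrite exprn_ile1// ltW.
have c10 : 0 < c1 by rewrite /c1; lra.
have c00 : 0 < c0 by rewrite /c0; lra.
(* M bounds x = k^gap_exp when exp (x / 32) < 312 k: the term of order n + 1 of the exponential
   series outgrows k <= x^n. For such k the constant exp (c0 M) makes the bound trivial. *)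
pose M : R := 312 * 32 ^+ n.+1 * n.+1`!%:R.
exists (5 + expR (c0 * M)); split; first by rewrite addr_gt0// expR_gt0.
move=> beta N k b0 k0 kN.
set b := inv_temp beta; have ib : 0 < b by exact: inv_temp_gt0.
have b1 : b <= 1 by exact: inv_temp_le1.
have kR : 1 <= k%:R :> R by rewrite ler1n.
have kR0 : 0 < k%:R :> R by rewrite ltr0n.
set x := k%:R `^ gap_exp.
have x1 : 1 <= x by apply: powR_ge1 => //; exact/ltW/gap_exp_gt0.
have x0 : 0 < x by exact: lt_le_trans x1.
have mw : measurable_seq N (fun X => k%:R `^ fluct_exp / 8 < `|arclen N k X - k%:R|).
  apply: measurable_seq_ltr; first exact: measurable_seq_cst.
  apply: (@measurable_seq_comp _ _ _ RR RR); first exact: normr_measurable.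
  by apply: measurable_seqB; [exact: measurable_arc|exact: measurable_seq_cst].
have [big|small] := leP (312 * k%:R) (expR (x / 32)); last first.
  apply: le_trans (Pr_le1 hs b0 mw) _.
  have xM : x <= M.
    have := exp_ge_pow n.+1 (_ : 0 <= x / 32); rewrite divr_ge0 ?(ltW x0)// => /(_ isT) h1.
    have h2 := le_lt_trans h1 small.
    have h3 : 312 * k%:R <= 312 * x ^+ n by apply: ler_wpM2l; [lra|exact: hn].
    have := lt_le_trans h2 h3; rewrite ltr_pdivrMr ?ltr0n ?fact_gt0// expr_div_n.
    rewrite ltr_pdivrMr ?exprn_gt0// exprS => h4.
    have : x * x ^+ n < M * x ^+ n by apply: lt_le_trans h4 _; rewrite /M; lra.
    by rewrite ltr_pM2r ?exprn_gt0// => /ltW.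
  apply: (@le_trans _ _ (expR (c0 * M) * expR (- (c0 * b * x)))).
    rewrite -expRD -[leLHS]expR0 ler_expR subr_ge0 -mulrA ler_pM2l//.
    by apply: le_trans xM; rewrite ler_piMl// ltW.
  by apply: ler_wpM2r; [exact: expR_ge0|rewrite lerDr].
(* The gap tail is 2 k exp (- x / 8) = 2 k p^4, so 312 k p <= 1 gives both smallness conditions of
   the concentration bound. *)
set p := expR (- (x / 32)).
have p0 : 0 < p by exact: expR_gt0.
have p1 : p <= 1 by rewrite expR_le1 oppr_le0 divr_ge0// ltW.
have p2 : p ^+ 2 = expR (- (x / 16)) by rewrite -expRM_natl; congr expR; field.
have kp : 312 * k%:R * p <= 1.
  by rewrite /p expRN ler_pdivrMr ?expR_gt0// mul1r.
have Tp : 2 * k%:R * expR (- (x / 8)) <= p ^+ 2.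
  have -> : expR (- (x / 8)) = p ^+ 2 * p ^+ 2.
    by rewrite p2 -expRD; congr expR; field.
  rewrite mulrA ler_piMl ?exprn_ge0 ?(ltW p0)//.
  rewrite expr2 mulrA; nra.
(* The exponent solves s + 5 eps / 8 + e = fluct_exp, and c1 = s^3 / 64 makes proxy times t at most
   half of the deviation w = k^fluct_exp / 8. Half of t w remains, which is of order k^(3 eps / 8)
   >= x. *)
pose e := - s / 2 - eps / 8.
pose t := c1 * b * k%:R `^ e.
have ke : k%:R `^ e <= 1.
  by rewrite -[leRHS](powRr0 (k%:R : R)); apply: ler_powR => //; rewrite /e; lra.
have t0 : 0 < t by rewrite !mulr_gt0// powR_gt0.
have t1 : t <= 1.
  rewrite /t; apply: (@le_trans _ _ (c1 * b)); first by rewrite ler_piMr// ltW// mulr_gt0.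
  by rewrite /c1; nra.
have t01 : 0 <= t <= 1 by rewrite (ltW t0) t1.
have := arc_concentration hs b0 (k%:R `^ fluct_exp / 8) k0 kN x0 p0 p1 Tp kp t01.
move=> /le_trans; apply.
have xs : x `^ (s + 2) = k%:R `^ (5 * eps / 8) by rewrite /x -powRrM gap_expM.
have pt : proxy s beta k x * t <= k%:R `^ fluct_exp / 16.
  have kk : k%:R `^ s * k%:R `^ (5 * eps / 8) * k%:R `^ e = k%:R `^ fluct_exp.
    rewrite -!powRD ?(gt_eqF kR0) ?implybT//; congr (_ `^ _).
    by rewrite /e /fluct_exp; field.
  have -> : proxy s beta k x * t = (b / beta) * (k%:R `^ s * k%:R `^ (5 * eps / 8) * k%:R `^ e) / 16.
    by rewrite /proxy xs /t /c1; field; rewrite !gt_eqF.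
  rewrite kk ler_pM2r ?invr_gt0// ler_piMl ?powR_ge0//.
  by rewrite ler_pdivrMr// mul1r inv_temp_le.
have tk : t * k%:R `^ fluct_exp = c1 * b * k%:R `^ (3 * eps / 8).
  rewrite /t -mulrA -powRD ?(gt_eqF kR0) ?implybT//; congr (_ * _ `^ _).
  by rewrite /e /fluct_exp; field.
have xk : x <= k%:R `^ (3 * eps / 8) by apply: ler_powR => //; exact: gap_exp_le.
have expo : proxy s beta k x * t ^+ 2 - t * (k%:R `^ fluct_exp / 8) <= - (c0 * b * x).
  have -> : proxy s beta k x * t ^+ 2 = t * (proxy s beta k x * t) by ring.
  have h := ler_wpM2l (ltW t0) pt.
  have h2 : c1 * b * x <= c1 * b * k%:R `^ (3 * eps / 8).
    by apply: ler_wpM2l => //; rewrite ltW// mulr_gt0.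
  have h3 : c0 * b * x = c1 * b * x / 16 by rewrite /c0 /c1; field.
  by rewrite h3; lra.
have px : p ^+ 2 <= expR (- (c0 * b * x)).
  rewrite p2 ler_expR lerN2 mulrC ler_pM2l//.
  have : c0 * b <= c0 by rewrite ler_piMr// ltW.
  by rewrite /c0; lra.
have E0 := expR_ge0 (- (c0 * b * x)).
have h4 : 4 * expR (proxy s beta k x * t ^+ 2 - t * (k%:R `^ fluct_exp / 8)) <=
    4 * expR (- (c0 * b * x)) by rewrite ler_pM2l// ler_expR.
have h5 : 0 <= expR (c0 * M) * expR (- (c0 * b * x)) by rewrite mulr_ge0// expR_ge0.
rewrite mulrDl; lra.
Qed.

End Rigidity.

(** * Counting points in an arc *)

Local Opaque weight.

Section SwapHead.
Context {R : realType}.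
Local Notation RR := (measurableTypeR R).
Local Notation mu := (@lebesgue_measure R).

Lemma measurable_seq_rotr1 d (V : measurableType d) n (F : seq R -> V) :
  measurable_seq n F -> measurable_seq n (fun X => F (rotr 1 X)).
Proof.
case: n => [|n] mF d' T X mX.
  by have := mF d' T X mX; apply: eq_measurable_fun.
pose Y i := if i is j.+1 then X j else X n.
have mY i : measurable_fun setT (Y i) by case: i => [|i]; exact: mX.
have := mF d' T Y mY; apply: eq_measurable_fun => w _; congr F.
by rewrite mkseq_cons (mkseqS (X^~ w)) rotr1_rcons.
Qed.

Lemma measurable_seq_behead d (V : measurableType d) n (F : seq R -> V) (x : R) :
  measurable_seq n.+1 F -> measurable_seq n.+1 (fun X => F (x :: behead X)).
Proof.
move=> mF d' T X mX.
pose Y i := if i is j.+1 then X j.+1 else fun=> x.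
have mY i : measurable_fun setT (Y i) by case: i => [|i]; [exact: measurable_cst|exact: mX].
have := mF d' T Y mY; apply: eq_measurable_fun => w _; congr F.
by rewrite (mkseq_cons (Y^~ w)) (mkseq_cons (X^~ w)).
Qed.

(** A cyclic rotation brings the first variable to the end, where it is integrated innermost. *)
Lemma iint_swap_head n (F : seq R -> \bar R) :
  measurable_seq n.+1 F -> (forall X, (0 <= F X)%E) ->
  iint n.+1 F = iint n (fun u => (\int[mu]_(x in I01) F (x :: u))%E).
Proof.
move=> mF F0; have mG := measurable_seq_rotr1 mF.
transitivity (iint n.+1 (fun X => F (rotr 1 (rot 1 X)))).
  by apply: eq_iint => X _ _; rewrite rotK.
rewrite (iint_rot mG)// iint_rcons; apply: eq_iint => u _ _.
by apply: eq_integral => x _; rewrite rotr1_rcons.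
Qed.

(** For fixed x_0 the other variables are replaced by their differences with x_0; then x_0 is
    integrated innermost, with the differences held fixed. *)
Lemma iint_root_le n (F G H : seq R -> R) :
  admissible n.+1 F -> admissible n.+1 G -> admissible n H ->
  (forall x t, size t = n -> F (x :: t) = G (x :: [seq trep (y - x) | y <- t])) ->
  (forall u, size u = n -> all (fun x => 0 <= x < 1) u ->
     (\int[mu]_(x in I01) (G (x :: u))%:E <= (H u)%:E)%E) ->
  Iint n.+1 F <= Iint n H.
Proof.
move=> gF gG gH FG GH; have [mG G0 _] := gG.
rewrite -lee_fin -!IintE//.
have -> : iint n.+1 (fun X => (F X)%:E) = iint n.+1 (fun X => (G X)%:E).
  rewrite !iintS; apply: eq_integral => x _.
  have gGx := admissible_cons x gG.
  rewrite -(@iint_trep R n x _ (admissible_EFin gGx) (admissible_EFin_ge0 gGx)).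
  by apply: eq_iint => t st _; rewrite FG.
rewrite iint_swap_head; [|exact: admissible_EFin|exact: admissible_EFin_ge0 gG].
apply: le_iint => //.
- move=> d T X mX.
  pose Y (i : nat) (z : T * RR) : RR := if i is j.+1 then X j z.1 else z.2.
  have mY i : measurable_fun setT (Y i).
    by case: i => [|i]; [exact: measurable_snd|apply: measurableT_comp => //; exact: measurable_fst].
  have mGY := mG _ (T * RR)%type Y mY.
  apply: (@measurable_integral_I01 R _ T (fun z => (G (z.2 :: mkseq (fun i => X i z.1) n))%:E)).
    apply/measurable_EFinP; move: mGY; apply: eq_measurable_fun => z _.
    by rewrite mkseq_cons.
  by move=> z; rewrite lee_fin.
- exact: admissible_EFin.
- by move=> u; apply: integral_ge0 => x _; rewrite lee_fin.
- exact: admissible_EFin_ge0 gH.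
Qed.

End SwapHead.

(** * Integrating out the position of the root *)

Section RootIntegral.
Context {R : realType}.
Variables (s beta : R) (hs : 0 < s < 1) (hb : 0 < beta).
Local Notation RR := (measurableTypeR R).
Local Notation mu := (@lebesgue_measure R).
Local Notation Ex := (Ex s beta).
Local Notation Pr := (Pr s beta).
Local Notation wt := (weight s beta).
Implicit Types (N n k : nat) (X U : seq R).

(** Under the Gibbs measure x_0 is uniform and independent of the differences, because the weight
    depends on the latter alone. A function of both can thus be averaged over the root for frozen
    differences. *)
Lemma Ex_root_le N (Phi : R -> seq R -> R) (Psi : seq R -> R) : (0 < N)%N ->
  admissible N (fun X => Phi X`_0 (differences X)) ->
  admissible N (fun X => Phi X`_0 (0 :: behead X)) ->
  admissible N Psi -> (forall X, size X = N -> Psi (differences X) = Psi X) ->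
  (forall U, size U = N -> U`_0 = 0 -> all (fun x => 0 <= x < 1) U ->
     (\int[mu]_(x in I01) (Phi x U)%:E <= (Psi U)%:E)%E) ->
  Ex N (fun X => Phi X`_0 (differences X)) <= Ex N Psi.
Proof.
case: N => [//|n] _ gP gQ gPsi iPsi PhiPsi.
rewrite /Ex ler_pM2r ?invr_gt0 ?gibbsE1_gt0//.
rewrite (gibbsE_invariant hs hb gPsi iPsi).
have gw := admissible_weight hs hb n.+1.
have gw0 : admissible n.+1 (fun X => wt n.+1 (0 :: behead X)).
  have [_ wp [M wM]] := gw.
  split; first 1 last.
  - by move=> X; exact: wp (0 :: behead X).
  - by exists M => X; exact: wM (0 :: behead X).
  by have [mw _ _] := gw; exact: (measurable_seq_behead 0 mw).
have gF := admissibleM gQ gw0.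
have gW := admissible_cons 0 (admissible_weighted hs hb gPsi).
have gP' := admissible_weighted hs hb gP.
apply: (@iint_root_le R n _ _ _ gP' gF gW) => [x t st|u su au].
  by rewrite (weight_shift s beta x st) /differences/= subrr trep0.
have w0 : 0 <= wt n.+1 (0 :: u) by case: gw => _ wp _; exact: wp.
have aU : all (fun x => 0 <= x < 1) (0 :: u) by rewrite /= lexx ltr01.
have sU : size (0 :: u) = n.+1 by rewrite /= su.
have h := PhiPsi _ sU erefl aU.
move: (wt n.+1 (0 :: u)) w0 h => w w0 h /=.
have mPhi : measurable_fun I01 (fun x : RR => (Phi x (0 :: u))%:E).
  apply: measurable_funTS; apply/measurable_EFinP.
  have [mQ _ _] := gQ.
  pose Y (i : nat) (x : RR) : RR := if i is j.+1 then u`_j else x.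
  have mY i : measurable_fun setT (Y i) by case: i => [|i]; [exact: measurable_id|exact: measurable_cst].
  have := mQ _ RR Y mY; apply: eq_measurable_fun => x _.
  rewrite mkseq_cons/=; congr (Phi x (0 :: _)).
  by rewrite -su; exact: mkseq_nth.
have Q0 x : 0 <= Phi x (0 :: u) by case: gQ => _ hQ _; exact: (hQ (x :: u)).
under eq_integral do rewrite mulrC EFinM.
rewrite ge0_integralZl//; last 2 first.
- exact: measurable_I01.
- by move=> x _; rewrite lee_fin.
by rewrite mulrC EFinM; apply: lee_wpmul2l.
Qed.

Lemma integral_trep_lt (c r : R) : 0 <= r <= 1 ->
  (\int[mu]_(x in I01) ((trep (x - c) < r)%R%:R)%:E = r%:E)%E.
Proof.
move=> r01; have m (p : RR -> bool) : measurable_fun setT p -> measurable [set x | p x].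
  by move=> mp; have := mp measurableT [set true] Logic.I; rewrite setTI.
have mr : measurable_fun setT (fun y : RR => y < r).
  by apply: measurable_fun_ltr => //; exact: measurable_cst.
rewrite (@ge0_integral_trep R c (fun y => ((y < r)%R%:R)%:E)).
- rewrite integral_bool_I01; last exact: m.
  rewrite (_ : _ `&` _ = `[0, r[%classic); last first.
    apply/seteqP; split => t /=; rewrite /I01/= in_itv/=; first by move=> [-> /andP[-> _]].
    by move=> /andP[t0 tr]; split => //; rewrite t0 (lt_le_trans tr)//; case/andP: r01.
  rewrite lebesgue_measure_itv/= lte_fin; case: ifPn; first by rewrite oppr0 adde0.
  by rewrite -leNgt => r0; congr EFin; apply/eqP; rewrite eq_le r0; case/andP: r01 => ->.
- exact: measurable_bool_EFin.
- by move=> x; rewrite lee_fin.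
Qed.

Lemma integral_trep_opp_le (c r : R) : 0 <= r < 1 ->
  (\int[mu]_(x in I01) ((trep (c - x) <= r)%R%:R)%:E <= r%:E)%E.
Proof.
move=> /andP[r0 r1].
have m (p : RR -> bool) : measurable_fun setT p -> measurable [set x | p x].
  by move=> mp; have := mp measurableT [set true] Logic.I; rewrite setTI.
have mr : measurable_fun setT (fun y : RR => trep (- y) <= r).
  apply: measurable_fun_ler; last exact: measurable_cst.
  by apply: (measurableT_comp measurable_trep); exact: oppr_measurable.
have -> : (\int[mu]_(x in I01) ((trep (c - x) <= r)%R%:R)%:E =
  \int[mu]_(x in I01) ((trep (- trep (x - c)) <= r)%R%:R : R)%:E)%E.
  by apply: eq_integral => x _; rewrite trep_Ntrep opprB.
rewrite (@ge0_integral_trep R c (fun y => ((trep (- y) <= r)%R%:R)%:E)); last 2 first.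
- exact: measurable_bool_EFin.
- by move=> x; rewrite lee_fin.
rewrite integral_bool_I01; last exact: m.
(* Since [trep 0] is 0, the reflected arc is {0} together with [1 - r, 1); the singleton is null. *)
pose A : set RR := [set 0]; pose B : set RR := `[1 - r, 1[%classic.
have mA : measurable A by exact: measurable_set1.
have mB : measurable B by exact: measurable_itv.
apply: (@le_trans _ _ (mu (A `|` B))).
  apply: le_measure; rewrite ?inE; [by apply: measurableI => //; exact: m|exact: measurableU|].
  move=> y [/= hy /andP[y0 y1]].
  have [->|yn] := eqVneq y 0; [by left|right].
  have y0' : 0 < y by rewrite lt_neqAle eq_sym yn.
  rewrite /B /= in_itv/= y1 andbT; move: hy.
  rewrite (@trep_eq R _ (1 - y) (-1)%Z); [lra|lra|].
  by rewrite mulrN1z; ring.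
have mU : (mu (A `|` B) <= mu A + mu B)%E by exact: measureU2.
have A0 : mu A = 0%E by exact: lebesgue_measure_set1.
have Br : (mu B <= r%:E)%E.
  rewrite /B lebesgue_measure_itv/= lte_fin.
  case: ifP => _; last by rewrite lee_fin.
  by rewrite (_ : (_ + _)%E = r%:E)//; congr EFin; ring.
by apply: (le_trans mU); rewrite A0 add0e.
Qed.

End RootIntegral.

Section CountingPoints.
Context {R : realType}.
Implicit Types (N m p : nat) (X Y : seq R) (a l c : R).

Lemma indic_tarc a l x : 0 < l < 1 / 4 ->
  \1_(tarc a l) x = (0 < trep (x - (a - l)) < 2 * l)%R%:R :> R.
Proof.
move=> l0; rewrite indicE; congr (nat_of_bool _)%:R; apply/idP/idP.
  rewrite inE => -[m hm].
  rewrite (@trep_eq R _ (x + m%:~R - (a - l)) (- m)); [lra|lra|].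
  by rewrite mulrNz; ring.
move=> h; rewrite inE; exists (- Num.floor (x - (a - l))).
have := trepE (x - (a - l)); rewrite mulrNz; lra.
Qed.

Definition count_arc c r X : R := \sum_(x <- X) (0 < trep (x - c) < r)%R%:R.

Lemma count_arc_rot c r p X : count_arc c r (rot p X) = count_arc c r X.
Proof. by apply: perm_big; rewrite perm_rot. Qed.

(** Offsets from c, measured through x_0, increase along the configuration, so a single index q
    separates the points before a full turn from those after it. *)
Lemma chain_cut N X c : chain N X -> exists q, [/\ (q <= N)%N,
  forall j, (j < q)%N -> trep (X`_j - X`_0) + trep (X`_0 - c) < 1 &
  forall j, (q <= j)%N -> (j < N)%N -> 1 <= trep (X`_j - X`_0) + trep (X`_0 - c)].
Proof.
move=> ch; have : (N <= N)%N by []; move: {1 3 4}N => m.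
elim: m => [|m IH] mN; first by exists 0%N.
have [q [qm h1 h2]] := IH (ltnW mN).
case: (ltnP q m) => qm'.
  exists q; split => //; first exact: ltnW.
  move=> j qj; rewrite ltnS leq_eqVlt => /predU1P[->|]; last exact: h2.
  by apply: le_trans (h2 q (leqnn q) qm') _; rewrite lerD2r (chain_le ch).
have qE : q = m by apply/eqP; rewrite eqn_leq qm qm'.
rewrite {}qE in h1 h2 *.
have [mt|mt] := ltP (trep (X`_m - X`_0) + trep (X`_0 - c)) 1.
  exists m.+1; split => // [j|j mj jm]; last by move: mj; rewrite leqNgt jm.
  by rewrite ltnS leq_eqVlt => /predU1P[->//|]; exact: h1.
exists m; split => // j mj; rewrite ltnS => jm.
by have -> : j = m by apply/eqP; rewrite eqn_leq jm mj.
Qed.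

(** The labels are rotated so that the first point met counterclockwise from c comes first;
    positions relative to c then increase without wrapping. *)
Lemma chain_from N X c : (0 < N)%N -> size X = N -> chain N X ->
  exists2 p, (p < N)%N & forall j, (j.+1 < N)%N ->
    trep ((rot p X)`_j - c) < trep ((rot p X)`_j.+1 - c).
Proof.
move=> N0 sX ch; have [q [qN h1 h2]] := chain_cut c ch.
have yE j : trep (X`_j - c) = if trep (X`_j - X`_0) + trep (X`_0 - c) < 1
    then trep (X`_j - X`_0) + trep (X`_0 - c) else trep (X`_j - X`_0) + trep (X`_0 - c) - 1.
  by rewrite -trepD; congr trep; ring.
have yl j : (j < q)%N -> trep (X`_j - c) = trep (X`_j - X`_0) + trep (X`_0 - c).
  by move=> jq; rewrite yE h1.
have yr j : (q <= j)%N -> (j < N)%N -> trep (X`_j - c) = trep (X`_j - X`_0) + trep (X`_0 - c) - 1.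
  by move=> qj jN; rewrite yE ltNge h2.
have q0 : (0 < q)%N.
  rewrite lt0n; apply/eqP => qE; have := h2 0%N; rewrite qE => /(_ isT N0).
  by rewrite subrr trep0 add0r leNgt trep_lt1.
case: (ltnP q N) => qN'; last first.
  have qE : q = N by apply/eqP; rewrite eqn_leq qN qN'.
  exists 0%N; first exact: N0.
  move=> j jN; have jN' := ltnW jN.
  have jq : (j < q)%N by rewrite qE.
  have jq' : (j.+1 < q)%N by rewrite qE.
  by rewrite rot0 (yl _ jq) (yl _ jq') ltrD2r; exact: (chain_lt ch).
exists q; first exact: qN'.
move=> j jN; rewrite !nth_rot ?sX ?(ltnW jN)// ?(ltnW qN')//.
have shift0 (x y z : R) : x < y -> x + z < y + z by move=> xy; rewrite ltrD2r.
have shift1 (x y z : R) : x < y -> x + z - 1 < y + z - 1 by move=> xy; rewrite !ltrD2r.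
have modE i : (N <= i)%N -> (i < N + N)%N -> (i %% N = i - N)%N.
  by move=> Ni iN; rewrite -{1}(subnK Ni) modnDr modn_small// ltn_subLR.
have jq : (j < q + j)%N by rewrite -[X in (X < _)%N]add0n ltn_add2r.
case: (ltngtP (q + j.+1) N) => h.
- have h' : (q + j < N)%N by apply: leq_ltn_trans h; rewrite leq_add2l.
  rewrite (modn_small h) (modn_small h') (yr _ (leq_addr _ _) h) (yr _ (leq_addr _ _) h').
  by apply: shift1; apply: (chain_lt ch) => //; rewrite ltn_add2l.
- have Nq : (N <= q + j)%N by rewrite -ltnS -addnS.
  have b2 : (q + j.+1 < N + N)%N by apply: (leq_trans (n := q + N)); rewrite ?ltn_add2l ?leq_add2r.
  have b1 : (q + j < N + N)%N by apply: leq_ltn_trans b2; rewrite leq_add2l.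
  have c2 : (q + j.+1 - N < q)%N by rewrite ltn_subLR ?(ltnW h)// addnC ltn_add2r.
  have c1 : (q + j - N < q + j.+1 - N)%N by rewrite ltn_sub2r ?addnS// -addnS.
  rewrite (modE _ Nq b1) (modE _ (ltnW h) b2) (yl _ (ltn_trans c1 c2)) (yl _ c2).
  by apply: shift0; apply: (chain_lt ch) => //; exact: leq_trans qN.
- have h' : (q + j < N)%N by rewrite -h ltn_add2l.
  rewrite h modnn (modn_small h') (yl 0%N q0) (yr _ (leq_addr _ _) h') subrr trep0 add0r.
  have : trep (X`_(q + j) - X`_0) < 1 by exact: trep_lt1.
  by rewrite -addrA addrC -addrA -subr_lt0; move: (trep _) (trep _) => x y; lra.
Qed.

Section Increasing.
Variables (N : nat) (Y : seq R) (c r : R) (sY : size Y = N).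
Hypothesis inc : forall j, (j.+1 < N)%N -> trep (Y`_j - c) < trep (Y`_j.+1 - c).

Lemma inc_lt i j : (i < j)%N -> (j < N)%N -> trep (Y`_i - c) < trep (Y`_j - c).
Proof.
elim: j => [//|j IH]; rewrite ltnS leq_eqVlt => /predU1P[->|ij] jN; first exact: inc.
by apply: lt_trans (inc jN); apply: IH => //; exact: ltnW.
Qed.

Lemma count_arcE : count_arc c r Y = \sum_(0 <= j < N) (0 < trep (Y`_j - c) < r)%R%:R.
Proof. by rewrite /count_arc (big_nth 0) sY. Qed.

Lemma count_arc_gt m : m%:R < count_arc c r Y -> (m < N)%N -> trep (Y`_m - c) < r.
Proof.
move=> mc mN; rewrite ltNge; apply/negP => hm; move: mc; rewrite count_arcE ltNge => /negP[].
rewrite (@big_cat_nat _ _ _ m)//=; last exact: ltnW.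
rewrite [X in _ + X]big1_seq ?addr0; last first.
  move=> j /andP[_]; rewrite mem_index_iota => /andP[mj jN].
  have h : trep (Y`_m - c) <= trep (Y`_j - c).
    by move: mj; rewrite leq_eqVlt => /predU1P[->//|mj]; exact/ltW/inc_lt.
  by rewrite (ltNge _ r) (le_trans hm h) andbF.
apply: (@le_trans _ _ (\sum_(0 <= j < m) 1 : R)).
  by apply: ler_sum => j _; case: (_ && _).
by rewrite sumr_const_nat subn0.
Qed.

Lemma count_arc_lt m : count_arc c r Y < m%:R -> (m < N)%N -> r <= trep (Y`_m - c).
Proof.
move=> mc mN; rewrite leNgt; apply/negP => hm; move: mc; rewrite count_arcE ltNge => /negP[].
have N0 : (0 < N)%N by exact: leq_ltn_trans mN.
rewrite (@big_cat_nat _ _ _ m.+1)//=.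
apply: (@le_trans _ _ (\sum_(0 <= j < m.+1) (0 < trep (Y`_j - c) < r)%R%:R)); last first.
  by rewrite lerDl; apply: sumr_ge0.
(* The point of index 0 may sit exactly at c, where the strict inequality fails; the m points of
   indices 1 to m are counted in any case. *)
rewrite big_nat_recl//= addrC.
apply: (@le_trans _ _ (\sum_(0 <= j < m) 1 : R)); first by rewrite sumr_const_nat subn0.
apply: (@le_trans _ _ (\sum_(0 <= j < m) (0 < trep (Y`_j.+1 - c) < r)%R%:R)); last by rewrite lerDl.
rewrite !big_nat; apply: ler_sum => j /andP[_ jm].
have -> : 0 < trep (Y`_j.+1 - c).
  by apply: le_lt_trans (trep_ge0 (Y`_0 - c)) _; apply: inc_lt => //; exact: leq_ltn_trans mN.
suff -> : trep (Y`_j.+1 - c) < r by [].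
apply: le_lt_trans hm; move: jm; rewrite leq_eqVlt => /predU1P[->//|jm].
exact/ltW/inc_lt.
Qed.

End Increasing.

Lemma count_arc_gt_event N X c r m : (0 < N)%N -> size X = N -> chain N X -> (m < N)%N ->
  m%:R < count_arc c r X ->
  exists2 i, (i <= N)%N & (trep ((rot i X)`_0 - c) < r) &&
    (trep ((rot i X)`_m - (rot i X)`_0) < r).
Proof.
move=> N0 sX ch mN mc; have [p pN inc] := chain_from c N0 sX ch.
exists p; first exact: ltnW.
set Y := rot p X in inc *.
have sY : size Y = N by rewrite size_rot.
have hm : trep (Y`_m - c) < r.
  by apply: (count_arc_gt sY inc) => //; rewrite count_arc_rot.
have h0 : trep (Y`_0 - c) <= trep (Y`_m - c).
  case: m mN {mc hm} => [//|m] mN; exact/ltW/(inc_lt inc).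
have -> : Y`_m - Y`_0 = (Y`_m - c) - (Y`_0 - c) by ring.
rewrite (trepB (Y`_m - c)) h0 (le_lt_trans h0 hm)/=.
by have := trep_ge0 (Y`_0 - c); lra.
Qed.

Lemma count_arc_lt_event N X c r m : 0 < r -> (m.+1 < N)%N -> size X = N -> chain N X ->
  count_arc c r X < m%:R ->
  exists2 i, (i <= N)%N & (trep (c - (rot i X)`_0) <= trep ((rot i X)`_m.+1 - (rot i X)`_0)) &&
    (r <= trep ((rot i X)`_m.+1 - (rot i X)`_0)).
Proof.
move=> r0 mN sX ch mc; have N0 : (0 < N)%N by exact: leq_ltn_trans mN.
have [p pN inc] := chain_from c N0 sX ch.
set Y := rot p X in inc *.
have sY : size Y = N by rewrite size_rot.
have hm : r <= trep (Y`_m - c).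
  by apply: (count_arc_lt sY inc); rewrite ?count_arc_rot ?(ltnW mN).
have lN : (N.-1 < N)%N by rewrite ltn_predL.
have h1 : trep (Y`_m - c) < trep (Y`_N.-1 - c).
  by apply: (inc_lt inc) => //; rewrite -ltnS prednK.
(* The root is the last point before c, at index N - 1; m + 1 steps from it wrap around to index
   m. *)
have [i iN Ei] : exists2 i, (i <= N)%N & rot i X = rot N.-1 Y.
  rewrite /Y rot_add_mod ?sX ?leq_pred ?(ltnW pN)//.
  by case: leqP => h; eexists; try reflexivity; lia.
exists i => //; rewrite Ei.
have E0 : (rot N.-1 Y)`_0 = Y`_N.-1.
  by rewrite nth_rot ?sY ?leq_pred// addn0 modn_small.
have Em : (rot N.-1 Y)`_m.+1 = Y`_m.
  rewrite nth_rot ?sY ?leq_pred//; congr (nth 0 Y _).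
  have -> : (N.-1 + m.+1 = m + N)%N by lia.
  by rewrite modnDr modn_small// ltnW.
rewrite E0 Em.
have -> : Y`_m - Y`_N.-1 = (Y`_m - c) - (Y`_N.-1 - c) by ring.
have -> : c - Y`_N.-1 = 0 - (Y`_N.-1 - c) by ring.
rewrite (trepB 0) (trepB (Y`_m - c)) trep0 (leNgt (trep (Y`_N.-1 - c)) (trep (Y`_m - c))) h1/=.
have := trep_lt1 (Y`_N.-1 - c); have := trep_ge0 (Y`_m - c).
by case: ifPn => h; lra.
Qed.

End CountingPoints.

Local Opaque trep.

Section CountTails.
Context {R : realType}.
Variables (s beta : R) (hs : 0 < s < 1) (hb : 0 < beta).
Local Notation RR := (measurableTypeR R).
Local Notation mu := (@lebesgue_measure R).
Local Notation Ex := (Ex s beta).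
Local Notation Pr := (Pr s beta).
Implicit Types (N i k m : nat) (X U : seq R) (c r : R).

Lemma measurable_count_arc N c r : measurable_seq N (count_arc c r : seq R -> RR).
Proof.
move=> d T X mX.
have mF i : measurable_fun setT (fun w => (0 < trep (X i w - c) < r)%R%:R : RR).
  have mt : measurable_fun setT (fun w => trep (X i w - c) : RR).
    apply: (measurableT_comp measurable_trep).
    by apply: measurable_funB; [exact: mX|exact: measurable_cst].
  have mb : measurable_fun setT (fun w => 0 < trep (X i w - c) < r).
    by apply: measurable_and; apply: measurable_fun_ltr => //; exact: measurable_cst.
  have := measurable_fun_ifT mb (measurable_cst (1 : RR)) (measurable_cst (0 : RR)).
  by apply: eq_measurable_fun => w _; case: (_ && _).
have := @measurable_sum _ _ R setT nat (iota 0 N) (fun i w => (0 < trep (X i w - c) < r)%R%:R) mF.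
by apply: eq_measurable_fun => w _; rewrite /count_arc /mkseq big_map.
Qed.

Lemma PNbeta_ge N (A B : seq R -> bool) (q : R) :
  measurable_seq N A -> measurable_seq N B ->
  (forall X, size X = N -> all (fun x => 0 <= x < 1) X -> chain N X -> ~~ A X -> B X) ->
  Pr N B <= q -> 1 - q <= PNbeta s beta N A.
Proof.
move=> mA mB AB Bq; have -> : PNbeta s beta N A = Pr N A by exact: (PNbetaE hs hb mA).
suff : 1 <= Pr N A + Pr N B by lra.
rewrite -(@Ex_cst _ s beta hs hb N 1 ler01) /Pr -(ExD hs hb); try exact: admissible_bool.
apply: (Ex_le hs hb); first exact: admissible_cst.
  by apply: admissibleD; exact: admissible_bool.
move=> X sX aX ch; have := AB X sX aX ch.
by case: (A X) => [_|/(_ isT) ->]; rewrite ?lerDl ?lerDr.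
Qed.

(** Union bound over rotations, under which the law is invariant; i = N, a full turn, is allowed,
    whence N + 1 terms. *)
Lemma Pr_exists_rot N (A B : seq R -> bool) : measurable_seq N A -> measurable_seq N B ->
  (forall X, size X = N -> all (fun x => 0 <= x < 1) X -> chain N X -> A X ->
     exists2 i, (i <= N)%N & B (rot i X)) ->
  Pr N A <= N.+1%:R * Pr N B.
Proof.
move=> mA mB AB.
have mBi i : measurable_seq N (fun X => B (rot (minn i N) X)).
  by apply: measurable_seq_rot => //; exact: geq_minr.
apply: (le_trans (Pr_exists hs hb (r := index_iota 0 N.+1) mA mBi _)).
  move=> X sX aX ch AX; have [i iN Bi] := AB X sX aX ch AX.
  by exists i; [rewrite mem_index_iota ltnS|rewrite (minn_idPl iN)].
have E i : Pr N (fun X => B (rot (minn i N) X)) = Pr N B.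
  exact: (Ex_rot hs hb (geq_minr i N) (admissible_bool mB)).
by rewrite (eq_bigr _ (fun i _ => E i)) sumr_const_nat subn0 mulr_natl.
Qed.

Lemma eq_measurable_seq d (V : measurableType d) n (F G : seq R -> V) :
  (forall X, size X = n -> F X = G X) -> measurable_seq n F -> measurable_seq n G.
Proof.
move=> FG mF d' T X mX; have := mF _ T X mX.
by apply: eq_measurable_fun => w _; rewrite FG// size_mkseq.
Qed.

Lemma measurable_seq_arc n i j : measurable_seq n (fun X => trep (X`_i - X`_j) : RR).
Proof. by apply: measurable_seq_trep; apply: measurable_seqB; exact: measurable_seq_nth. Qed.

(** The root integral for an event that involves x_0 and one arc: h t bounds the measure of the
    roots compatible with an arc of length t. *)
Lemma Pr_root_le N k (e : R -> R -> bool) (h : R -> R) : (k < N)%N ->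
  (forall F G : seq R -> RR, measurable_seq N F -> measurable_seq N G ->
     measurable_seq N (fun X => e (F X) (G X))) ->
  admissible N (fun X => h (trep (X`_k - X`_0))) ->
  (forall t, 0 <= t < 1 -> (\int[mu]_(x in I01) ((e x t)%:R : R)%:E <= (h t)%:E)%E) ->
  Pr N (fun X => e X`_0 (trep (X`_k - X`_0))) <= Ex N (fun X => h (trep (X`_k - X`_0))).
Proof.
move=> kN me gh eh; have N0 : (0 < N)%N by exact: leq_ltn_trans kN.
pose Phi x U : R := (e x (trep (U`_k - U`_0)))%:R.
have mX0 : measurable_seq N (fun X => X`_0 : RR) by exact: measurable_seq_nth.
have dE X : size X = N -> Phi X`_0 (differences X) = (e X`_0 (trep (X`_k - X`_0)))%:R.
  by move=> sX; rewrite /Phi (differences_trep sX kN N0).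
have gE : admissible N (fun X => (e X`_0 (trep (X`_k - X`_0)))%:R : R).
  by apply: admissible_bool; apply: me => //; exact: measurable_seq_arc.
have gP : admissible N (fun X => Phi X`_0 (differences X)).
  apply: admissible_bool; apply: (me (fun X => X`_0) (fun X => trep (_ - _))) => //.
  apply: (@eq_measurable_seq _ RR N (fun X => trep (X`_k - X`_0))).
    by move=> X sX; rewrite (differences_trep sX kN N0).
  exact: measurable_seq_arc.
have gQ : admissible N (fun X => Phi X`_0 (0 :: behead X)).
  apply: admissible_bool; apply: (me (fun X => X`_0) (fun X => trep (_ - _))) => //.
  case: N N0 {kN me gh mX0 dE gE gP} => [//|n] _.
  exact: (measurable_seq_behead 0 (measurable_seq_arc n.+1 k 0)).
have -> : Pr N (fun X => e X`_0 (trep (X`_k - X`_0))) = Ex N (fun X => Phi X`_0 (differences X)).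
  by apply: (eq_Ex hs hb) => // X sX _ _; rewrite dE.
apply: (Ex_root_le hs hb N0 gP gQ gh) => [X sX|U sU U0 aU].
  by rewrite (differences_trep sX kN N0).
by apply: eh; rewrite trep_ge0 trep_lt1.
Qed.

(** Given the differences, the root falls within r after c with probability r; the union over roots
    costs N + 1. *)
Lemma Pr_count_arc_gt N c r m : (m < N)%N -> 0 <= r <= 1 ->
  Pr N (fun X => m%:R < count_arc c r X) <=
  N.+1%:R * (r * Pr N (fun X => arclen N m X < N%:R * r)).
Proof.
move=> mN r01; have N0 : (0 < N)%N by exact: leq_ltn_trans mN.
have [r0 _] := andP r01.
have mc : measurable_seq N (fun X => m%:R < count_arc c r X).
  by apply: measurable_seq_ltr; [exact: measurable_seq_cst|exact: measurable_count_arc].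
pose e (x t : R) := (trep (x - c) < r) && (t < r).
pose h (t : R) : R := r * (t < r)%R%:R.
have me (F G : seq R -> RR) : measurable_seq N F -> measurable_seq N G ->
    measurable_seq N (fun X => e (F X) (G X)).
  move=> mF mG; have mr := @measurable_seq_cst R _ RR N r.
  have mt : measurable_seq N (fun X => trep (F X - c) : RR).
    by apply: measurable_seq_trep; apply: measurable_seqB => //; exact: measurable_seq_cst.
  by apply: measurable_seq_and; exact: measurable_seq_ltr.
have mA : measurable_seq N (fun X => arclen N m X < N%:R * r).
  by apply: measurable_seq_ltr; [exact: measurable_arc|exact: measurable_seq_cst].
have hE X : h (trep (X`_m - X`_0)) = r * (arclen N m X < N%:R * r)%R%:R.
  by rewrite /h /arclen ltr_pM2l// ltr0n.
have gA : admissible N (fun X => (arclen N m X < N%:R * r)%R%:R : R) by exact: admissible_bool.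
have gh : admissible N (fun X => h (trep (X`_m - X`_0))).
  rewrite (_ : (fun X => _) = fun X => r * (arclen N m X < N%:R * r)%R%:R); last exact/funext.
  by apply: admissibleM => //; exact: admissible_cst.
have eh t : 0 <= t < 1 -> (\int[mu]_(x in I01) ((e x t)%:R : R)%:E <= (h t)%:E)%E.
  move=> _; rewrite /e /h; case: (t < r); last first.
    rewrite mulr0; under eq_integral do rewrite andbF.
    by rewrite integral0.
  under eq_integral do rewrite andbT.
  by rewrite mulr1 (integral_trep_lt c r01).
have := Pr_exists_rot mc (me _ _ (measurable_seq_nth N 0) (measurable_seq_arc N m 0))
  (fun X sX _ ch => count_arc_gt_event N0 sX ch mN).
move=> /le_trans; apply; apply: ler_wpM2l => //.
apply: (le_trans (Pr_root_le mN me gh eh)).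
by rewrite (funext hE) (ExZ hs hb r0 gA).
Qed.

(** The roots from which an arc of length t reaches c have measure at most t. The root integral thus
    weights the event by the arc length, which leaves a restricted expectation in place of a
    probability. *)
Lemma Pr_count_arc_lt N c r m : (m.+1 < N)%N -> 0 < r ->
  Pr N (fun X => count_arc c r X < m%:R) <=
  N.+1%:R / N%:R *
    Ex N (fun X => arclen N m.+1 X * (N%:R * r <= arclen N m.+1 X)%R%:R).
Proof.
move=> mN r0; have N0 : (0 < N)%N by exact: leq_ltn_trans mN.
have NR : 0 < N%:R :> R by rewrite ltr0n.
have mc : measurable_seq N (fun X => count_arc c r X < m%:R).
  by apply: measurable_seq_ltr; [exact: measurable_count_arc|exact: measurable_seq_cst].
pose e (x t : R) := (trep (c - x) <= t) && (r <= t).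
pose h (t : R) : R := t * (r <= t)%R%:R.
have me (F G : seq R -> RR) : measurable_seq N F -> measurable_seq N G ->
    measurable_seq N (fun X => e (F X) (G X)).
  move=> mF mG; have mr := @measurable_seq_cst R _ RR N r.
  have mt : measurable_seq N (fun X => trep (c - F X) : RR).
    by apply: measurable_seq_trep; apply: measurable_seqB => //; exact: measurable_seq_cst.
  by apply: measurable_seq_and; exact: measurable_seq_ler.
have mA : measurable_seq N (fun X => N%:R * r <= arclen N m.+1 X).
  by apply: measurable_seq_ler; [exact: measurable_seq_cst|exact: measurable_arc].
have hE X : h (trep (X`_m.+1 - X`_0)) =
    N%:R^-1 * (arclen N m.+1 X * (N%:R * r <= arclen N m.+1 X)%R%:R).
  by rewrite /h /arclen ler_pM2l// !mulrA mulVf ?mul1r// gt_eqF.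
have gA : admissible N (fun X => arclen N m.+1 X * (N%:R * r <= arclen N m.+1 X)%R%:R).
  by apply: admissibleM; [exact: admissible_arc|exact: admissible_bool].
have N0' : 0 <= N%:R^-1 :> R by rewrite invr_ge0 ler0n.
have gh : admissible N (fun X => h (trep (X`_m.+1 - X`_0))).
  rewrite (funext hE).
  by apply: admissibleM => //; exact: admissible_cst.
have eh t : 0 <= t < 1 -> (\int[mu]_(x in I01) ((e x t)%:R : R)%:E <= (h t)%:E)%E.
  move=> t01; rewrite /e /h; case: (r <= t); last first.
    rewrite mulr0; under eq_integral do rewrite andbF.
    by rewrite integral0.
  under eq_integral do rewrite andbT.
  by rewrite mulr1; exact: integral_trep_opp_le.
have := Pr_exists_rot mc (me _ _ (measurable_seq_nth N 0) (measurable_seq_arc N m.+1 0))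
  (fun X sX _ ch => count_arc_lt_event r0 mN sX ch).
move=> /le_trans; apply; rewrite -mulrA; apply: ler_wpM2l => //.
apply: (le_trans (Pr_root_le mN me gh eh)).
by rewrite (funext hE) (ExZ hs hb N0' gA).
Qed.

End CountTails.

(** * From the tails to the two fluctuation bounds *)

Section Fluctuations.
Context {R : realType}.
Variables (s eps : R) (hs : 0 < s < 1) (heps : 0 < eps < 1).
Local Notation RR := (measurableTypeR R).
Local Notation Ex := (Ex s).
Local Notation Pr := (Pr s).
Local Notation γ := (fluct_exp s eps).
Local Notation τ := (gap_exp s eps).
Implicit Types (beta C c x y L v : R) (N i k m n : nat) (X : seq R).

Lemma gap_exp_ge : eps / (2 * (s + 2)) <= τ /\ eps / (4 * (s + 2)) <= τ.
Proof.
have [s0 _] := andP hs; have [e0 _] := andP heps.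
have s2 : s + 2 != 0 by lra.
have i0 : 0 < (s + 2)^-1 by rewrite invr_gt0; lra.
have -> : eps / (2 * (s + 2)) = eps / 2 * (s + 2)^-1 by field.
have -> : eps / (4 * (s + 2)) = eps / 4 * (s + 2)^-1 by field.
have -> : τ = 5 * eps / 8 * (s + 2)^-1 by rewrite /gap_exp; field.
by rewrite !ler_pM2r//; split; lra.
Qed.

Lemma fluct_exp_bounds : 0 < γ /\ γ < 1 /\ γ <= s / 2 + eps.
Proof.
have [s0 s1] := andP hs; have [e0 e1] := andP heps.
by rewrite /fluct_exp; split; [lra|split; lra].
Qed.

Lemma ge1_of_powR L : 0 <= L -> 4 <= L `^ γ -> 1 <= L.
Proof.
have [g0 _] := fluct_exp_bounds.
move=> L0 v4; rewrite leNgt; apply/negP => L1.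
have : L `^ γ <= 1 `^ γ by apply: ge0_ler_powR; rewrite ?nnegrE//; exact: ltW.
by rewrite powR1; lra.
Qed.

Definition off N k X : bool := k%:R `^ γ / 8 < `|arclen N k X - k%:R|.

Lemma measurable_off N k : measurable_seq N (off N k).
Proof.
apply: measurable_seq_ltr; first exact: measurable_seq_cst.
apply: (@measurable_seq_comp _ _ _ RR RR); first exact: normr_measurable.
by apply: measurable_seqB; [exact: measurable_arc|exact: measurable_seq_cst].
Qed.

Lemma arc_fluctuations (delta := eps / (4 * (s + 2))) :
  exists C c : R -> R,
    (forall beta, 0 < beta -> 0 < C beta /\ 0 < c beta) /\
    loc_unif C /\ loc_unif c /\
    forall (beta : R) (N i k : nat), 0 < beta ->
      (i < N)%N -> (1 <= k)%N -> (k.*2 <= N)%N ->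
      PNbeta s beta N
        (fun X => `| N%:R * trep (X`_((i + k) %% N) - X`_i) - k%:R |
                    <= k%:R `^ (s / 2 + eps))
      >= 1 - C beta * expR (- c beta * k%:R `^ delta).
Proof.
have [C0 [C00 rig]] := arc_rigidity hs heps.
pose c0 := s ^+ 3 / 64 / 16.
have [s0 s1] := andP hs; have [g0 [g1 ge]] := fluct_exp_bounds.
have c00 : 0 < c0 by rewrite !divr_gt0// exprn_gt0.
exists (fun=> C0), (fun beta => c0 * inv_temp beta); split; [|split; [|split]].
- by move=> beta b0; rewrite C00 mulr_gt0// inv_temp_gt0.
- by move=> a b a0 ab; exists C0, C0; split => // *; rewrite lexx.
- exact: loc_unif_mul_inv_temp.
move=> beta N i k b0 iN k1 kN2.
have kN : (k < N)%N by apply: leq_trans kN2; rewrite -addnn -[X in (X < _)%N]addn0 ltn_add2l.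
have kR : 1 <= k%:R :> R by rewrite ler1n.
have mA : measurable_seq N (fun X => `| N%:R * trep (X`_((i + k) %% N) - X`_i) - k%:R |
    <= k%:R `^ (s / 2 + eps)).
  apply: measurable_seq_ler; last exact: measurable_seq_cst.
  apply: (@measurable_seq_comp _ _ _ RR RR); first exact: normr_measurable.
  apply: measurable_seqB; last exact: measurable_seq_cst.
  by apply: measurable_seqM; [exact: measurable_seq_cst|exact: measurable_seq_arc].
have mB : measurable_seq N (fun X => off N k (rot i X)).
  by apply: measurable_seq_rot; [exact: ltnW|exact: measurable_off].
apply: (PNbeta_ge hs b0 mA mB) => [X sX aX ch|].
  rewrite -ltNge /off (arclen_rot sX iN kN); apply: le_lt_trans.
  apply: (@le_trans _ _ (k%:R `^ γ)); last exact: ler_powR.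
  by have := powR_ge0 k%:R γ; lra.
rewrite /Pr (Ex_rot hs b0 (ltnW iN) (admissible_bool (measurable_off N k))).
apply: (le_trans (rig _ _ _ b0 k1 kN)).
rewrite ler_pM2l// ler_expR mulNr lerN2; apply: ler_wpM2l.
  by rewrite ltW// mulr_gt0// inv_temp_gt0.
by apply: ler_powR => //; exact: gap_exp_ge.2.
Qed.

Section CountTail.
Variables (beta C0 : R) (hb : 0 < beta) (C00 : 0 < C0).
Let c0 := s ^+ 3 / 64 / 16.
Let b := inv_temp beta.
Hypothesis rig : forall N k, (0 < k)%N -> (k < N)%N ->
  Pr beta N (off N k) <= C0 * expR (- (c0 * b * k%:R `^ τ)).
Variables (N : nat) (a l : R) (l0 : 0 < l < 1 / 4).
Let L := N%:R * l.
Let v := L `^ γ.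
Hypothesis v4 : 4 <= v.

Let L1 : 1 <= L.
Proof. by apply: ge1_of_powR => //; rewrite mulr_ge0// ltW//; case/andP: l0. Qed.

Let vL : v <= L.
Proof.
have [_ [g1 _]] := fluct_exp_bounds; have L0 : 0 <= L by apply: le_trans L1.
by rewrite -[leRHS](powRr1 L0); apply: ler_powR => //; exact: ltW.
Qed.

Let LN : 4 * L < N%:R.
Proof.
have [l1 l2] := andP l0; have N0 : 0 < N%:R :> R.
  rewrite ltr0n lt0n; apply/eqP => N0; move: L1; rewrite /L N0 mul0r; lra.
have -> : 4 * L = N%:R * (4 * l) by rewrite /L; ring.
by rewrite gtr_pMr//; lra.
Qed.

Let N0 : (0 < N)%N.
Proof. by rewrite -(ltr0n R); move: LN L1; lra. Qed.

(** The arcs used below have between L and 3 L gaps, so [off] allows them a deviation of at most 3 v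
    / 8. Rounding leaves a deviation of at least v - 1 above and v - 2 below, which is larger
    because v >= 4. *)
Let pow3 m : m%:R <= 3 * L -> m%:R `^ γ <= 3 * v.
Proof.
have [g0 [g1 _]] := fluct_exp_bounds.
have L0 : 0 <= L by apply: le_trans L1.
move=> mL; apply: (@le_trans _ _ ((3 * L) `^ γ)).
  by apply: ge0_ler_powR; rewrite ?nnegrE//; [exact: ltW|exact: mulr_ge0].
rewrite powRM//; apply: ler_wpM2r; first exact: powR_ge0.
rewrite -[leRHS](@powRr1 R 3)//; apply: ler_powR; [lra|exact: ltW].
Qed.

Let y := L `^ τ.

Let tail m : (0 < m)%N -> (m < N)%N -> L <= m%:R ->
  Pr beta N (off N m) <= C0 * expR (- (c0 * b * y)).
Proof.
move=> m0 mN Lm; apply: (le_trans (rig m0 mN)).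
have t0 := gap_exp_gt0 hs heps.
have [s0 _] := andP hs.
have L0 : 0 <= L by apply: le_trans L1.
rewrite ler_pM2l// ler_expR lerN2; apply: ler_wpM2l.
  by rewrite ltW// mulr_gt0 ?inv_temp_gt0// !divr_gt0// exprn_gt0.
by apply: ge0_ler_powR; rewrite ?nnegrE ?ler0n// ltW.
Qed.

Let c := a - l.
Let r := 2 * l.
Let NL : N%:R * r = 2 * L. Proof. by rewrite /r /L; ring. Qed.

Lemma count_le X : size X = N -> count_arc c r X <= N%:R.
Proof.
move=> sX; rewrite /count_arc -sX -sum1_size natr_sum.
by apply: ler_sum => x _; case: (_ && _).
Qed.

Lemma Pr_count_above :
  Pr beta N (fun X => 2 * L + v < count_arc c r X) <= 4 * L * (C0 * expR (- (c0 * b * y))).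
Proof.
have [l1 l2] := andP l0.
have ub : 0 <= 4 * L * (C0 * expR (- (c0 * b * y))).
  by rewrite !mulr_ge0 ?expR_ge0 ?(ltW C00)//; move: L1; lra.
(* If m >= N the event is empty, as there are only N points. Otherwise an arc of more than 2 L + v -
   1 gaps is shorter than 2 L. *)
pose m := Num.truncn (2 * L + v).
have pv : 0 <= 2 * L + v by move: L1 v4; lra.
have mle : m%:R <= 2 * L + v by rewrite truncn_le.
have mgt : 2 * L + v < m.+1%:R by exact: truncnS_gt.
rewrite -natr1 in mgt.
have mA (x : R) : measurable_seq N (fun X => x < count_arc c r X).
  by apply: measurable_seq_ltr; [exact: measurable_seq_cst|exact: measurable_count_arc].
have m0 : (0 < m)%N by rewrite -(ltr0n R); move: L1 v4; lra.
have [Nm|mN] := leqP N m.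
  apply: le_trans ub; rewrite -(@Ex_cst _ s beta hs hb N 0 (lexx _)).
  apply: (Ex_le hs hb); [exact: admissible_bool|exact: admissible_cst|].
  move=> X sX _ _; have := count_le sX; rewrite -(ler_nat R) in Nm.
  by case: ltP => // h; lra.
apply: (@le_trans _ _ (Pr beta N (fun X => m%:R < count_arc c r X))).
  by apply: (Pr_le hs hb) => // X _ _ _; exact: le_lt_trans.
have r01 : 0 <= r <= 1 by rewrite /r; lra.
apply: (le_trans (Pr_count_arc_gt hs hb c mN r01)).
rewrite NL.
have mB : measurable_seq N (fun X => arclen N m X < 2 * L).
  by apply: measurable_seq_ltr; [exact: measurable_arc|exact: measurable_seq_cst].
have mL : m%:R <= 3 * L by move: vL; lra.
have Lm : L <= m%:R by move: v4 L1; lra.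
have PB : Pr beta N (fun X => arclen N m X < 2 * L) <= C0 * expR (- (c0 * b * y)).
  apply: le_trans (tail m0 mN Lm); apply: (Pr_le hs hb) => //; first exact: measurable_off.
  move=> X _ _ _ h; rewrite /off; have := pow3 mL.
  by rewrite ltr0_norm; move: v4; lra.
have P0 : 0 <= C0 * expR (- (c0 * b * y)) by rewrite mulr_ge0 ?expR_ge0// ltW.
rewrite mulrA; apply: ler_pM => //.
- by rewrite mulr_ge0//; lra.
- exact: (Pr_ge0 hs hb).
have N1 : (1 : R) <= N%:R by rewrite ler1n.
have -> : 4 * L = (N%:R + N%:R) * r by rewrite /L /r; ring.
by apply: ler_wpM2r; rewrite -?natr1; lra.
Qed.

Lemma Pr_count_below :
  Pr beta N (fun X => count_arc c r X < 2 * L - v) <=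
  924 * L * ((C0 + 1) * expR (- (c0 * b * y / 2))).
Proof.
have [l1 l2] := andP l0.
(* After rounding up and one more gap for the root before c, an arc of at most 2 L - v + 2 gaps has
   length at least 2 L. *)
pose m := (Num.truncn (2 * L - v)).+1.
have pv : 0 <= 2 * L - v by move: L1 vL; lra.
have mle : m%:R <= 2 * L - v + 1 by rewrite /m -natr1 lerD2r; rewrite truncn_le.
have mgt : 2 * L - v < m%:R by exact: truncnS_gt.
have kE : m.+1%:R = m%:R + 1 :> R by rewrite natr1.
have kN : (m.+1 < N)%N by rewrite -(ltr_nat R) kE; move: LN L1 v4; lra.
have mA (x : R) : measurable_seq N (fun X => count_arc c r X < x).
  by apply: measurable_seq_ltr; [exact: measurable_count_arc|exact: measurable_seq_cst].
apply: (@le_trans _ _ (Pr beta N (fun X => count_arc c r X < m%:R))).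
  by apply: (Pr_le hs hb) => // X _ _ _ h; exact: lt_trans h mgt.
have r0 : 0 < r by rewrite /r; lra.
apply: (le_trans (Pr_count_arc_lt hs hb c kN r0)).
rewrite NL.
have mB : measurable_seq N (fun X => 2 * L <= arclen N m.+1 X).
  by apply: measurable_seq_ler; [exact: measurable_seq_cst|exact: measurable_arc].
have kL : m.+1%:R <= 3 * L by move: vL v4 L1; lra.
have Lk : L <= m.+1%:R by move: vL L1; lra.
have PB : Pr beta N (fun X => 2 * L <= arclen N m.+1 X) <= C0 * expR (- (c0 * b * y)).
  apply: le_trans (tail (ltn0Sn _) kN Lk); apply: (Pr_le hs hb) => //; first exact: measurable_off.
  move=> X _ _ _ h; rewrite /off; have := pow3 kL.
  by rewrite ger0_norm; move: v4; lra.
(* [Ex_arc_event] asks for a probability at most p^2, so the rate is halved; C0 <= (C0 + 1)^2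
   handles the constant. The final factor 924 is the product of 2, 154 and 3. *)
pose p := (C0 + 1) * expR (- (c0 * b * y / 2)).
have p0 : 0 < p by rewrite mulr_gt0 ?expR_gt0//; move: C00; lra.
have PBp : Pr beta N (fun X => 2 * L <= arclen N m.+1 X) <= p ^+ 2.
  apply: (le_trans PB); rewrite exprMn -expRM_natl.
  have -> : 2%:R * - (c0 * b * y / 2) = - (c0 * b * y) by field.
  by apply: ler_wpM2r; [exact: expR_ge0|move: C00; nra].
have E := Ex_arc_event hs hb (ltn0Sn _) kN p0 mB PBp.
have gA : admissible N (fun X => arclen N m.+1 X * (2 * L <= arclen N m.+1 X)%R%:R).
  by apply: admissibleM; [exact: admissible_arc|exact: admissible_bool].
have N1 : (1 : R) <= N%:R by rewrite ler1n.
have N2 : N.+1%:R / N%:R <= 2 :> R.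
  by rewrite ler_pdivrMr ?ltr0n// -natr1; lra.
apply: (@le_trans _ _ (2 * (154 * m.+1%:R * p))).
  have q0 : 0 <= N.+1%:R / N%:R :> R by rewrite divr_ge0.
  exact: (ler_pM q0 (Ex_ge0 hs hb gA) N2 E).
rewrite -/p mulrA; apply: ler_wpM2r; first exact: ltW.
by move: kL; lra.
Qed.

End CountTail.

(** A single term of the exponential series absorbs the polynomial prefactor. *)
Lemma pow_expN_le n x y : 0 < x -> 0 <= y -> y ^+ n * expR (- (x * y)) <= n`!%:R / x ^+ n.
Proof.
move=> x0 y0; have f0 : 0 < n`!%:R :> R by rewrite ltr0n fact_gt0.
rewrite expRN ler_pdivrMr ?expR_gt0// mulrAC ler_pdivlMr ?exprn_gt0//.
rewrite -ler_pdivrMl// mulrC -exprMn [y * x]mulrC.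
by apply: exp_ge_pow; rewrite mulr_ge0// ltW.
Qed.

Lemma count_fluctuations (delta := eps / (2 * (s + 2))) :
  exists C c : R -> R,
    (forall beta, 0 < beta -> 0 < C beta /\ 0 < c beta) /\
    loc_unif C /\ loc_unif c /\
    forall (beta : R) (N : nat) (a l : R), 0 < beta -> (1 <= N)%N ->
      0 < l < 1 / 4 ->
      PNbeta s beta N
        (fun X => `| \sum_(i < N) \1_(tarc a l) (X`_i) - 2 * N%:R * l |
                    <= (N%:R * l) `^ (s / 2 + eps))
      >= 1 - C beta * expR (- c beta * (N%:R * l) `^ delta).
Proof.
have [C0 [C00 rig]] := arc_rigidity hs heps.
have [s0 s1] := andP hs; have [g0 [g1 ge]] := fluct_exp_bounds.
have t0 := gap_exp_gt0 hs heps; have [dt _] := gap_exp_ge.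
have [n [n0 hn]] := le_pow_of_powR t0.
(* [c1] is half of the rate [c0 / 2] of the lower tail: one half absorbs the prefactor L, at the
   price of a power of 1 / b in the constant, and the other half is the final rate. *)
pose c0 := s ^+ 3 / 64 / 16; pose c1 := c0 / 4.
have c00 : 0 < c0 by rewrite !divr_gt0// exprn_gt0.
have c10 : 0 < c1 by rewrite divr_gt0.
pose M : R := 4 `^ (delta / γ).
pose F : R := n`!%:R / c1 ^+ n.
have F0 : 0 < F by rewrite divr_gt0 ?exprn_gt0// ltr0n fact_gt0.
(* 928 = 4 + 924 adds the prefactors of L in the two tails; [K] stays abstract until the final
   identity. *)
have [K K0 KE] : exists2 K : R, 0 < K & K = 928 by exists 928; [lra|reflexivity].
pose A := K * (C0 + 1) * F + expR (c1 * M).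
have C1 : 0 < C0 + 1 by lra.
have KC := mulr_gt0 K0 C1; have AF := mulr_gt0 KC F0.
have A0 : 0 < A by rewrite addr_gt0// expR_gt0.
exists (fun beta => A * (inv_temp beta)^-1 ^+ n), (fun beta => c1 * inv_temp beta).
split; [|split; [|split]].
- move=> beta b0; have ib := inv_temp_gt0 b0.
  by split; rewrite mulr_gt0// exprn_gt0// invr_gt0.
- exact: loc_unif_mul_inv_temp_exp.
- exact: loc_unif_mul_inv_temp.
move=> beta N a l b0 N1 l0; have ib := inv_temp_gt0 b0.
have [l1 l2] := andP l0; have N0 : 0 < N%:R :> R by rewrite ltr0n.
set b := inv_temp beta in ib *; set L := N%:R * l.
have L0 : 0 < L by rewrite mulr_gt0.
have bn : 1 <= b^-1 ^+ n by apply: exprn_ege1; rewrite invf_ge1// inv_temp_le1.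
have sumE X : size X = N ->
    \sum_(i < N) \1_(tarc a l) X`_i = count_arc (a - l) (2 * l) X.
  move=> sX; rewrite /count_arc (big_nth 0) big_mkord sX.
  by apply: eq_bigr => i _; rewrite indic_tarc.
have mc := @measurable_count_arc R N (a - l) (2 * l).
have mA : measurable_seq N (fun X =>
    `| \sum_(i < N) \1_(tarc a l) (X`_i) - 2 * N%:R * l | <= L `^ (s / 2 + eps)).
  apply: (@eq_measurable_seq R _ _ N (fun X =>
    `| count_arc (a - l) (2 * l) X - 2 * N%:R * l | <= L `^ (s / 2 + eps))).
    by move=> X sX; rewrite sumE.
  apply: measurable_seq_ler; last exact: measurable_seq_cst.
  apply: (@measurable_seq_comp _ _ _ RR RR); first exact: normr_measurable.
  by apply: measurable_seqB => //; exact: measurable_seq_cst.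
(* If L^fluct_exp < 4, then L^delta is at most M, and the summand exp (c1 M) of [A] makes the bound
   trivial. *)
have [v4|v4] := leP 4 (L `^ γ); last first.
  have mT : measurable_seq N (fun _ : seq R => true) by exact: measurable_seq_cst.
  apply: (PNbeta_ge hs b0 mA mT) => [X _ _ _ _ //|]; apply: (le_trans (Pr_le1 hs b0 mT)).
  have LM : L `^ delta <= M.
    have -> : delta = γ * (delta / γ) by field; rewrite gt_eqF.
    rewrite powRrM; apply: ge0_ler_powR; rewrite ?nnegrE ?powR_ge0 ?(ltW v4)//.
    by rewrite divr_ge0 ?(ltW g0)// /delta divr_ge0; case/andP: heps => *; lra.
  have cb : c1 * b * L `^ delta <= c1 * M.
    rewrite -mulrA ler_pM2l//; apply: le_trans LM.
    by rewrite ler_piMl ?powR_ge0// inv_temp_le1.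
  apply: (@le_trans _ _ (expR (c1 * M) * expR (- (c1 * b) * L `^ delta))).
    by rewrite -expRD -[leLHS]expR0 ler_expR mulNr subr_ge0.
  apply: ler_wpM2r; first exact: expR_ge0.
  apply: (@le_trans _ _ A); first by rewrite lerDr ltW.
  by rewrite ler_peMr// ltW.
have L1 := ge1_of_powR (ltW L0) v4.
have rig' N' k : (0 < k)%N -> (k < N')%N -> Pr beta N' (off N' k) <= C0 * expR (- (c0 * b * k%:R `^ τ)).
  exact: rig.
pose y := L `^ τ.
have y0 : 0 <= y by exact: powR_ge0.
have up := Pr_count_above b0 C00 rig' a l0 v4.
have lo := Pr_count_below b0 C00 rig' a l0 v4.
rewrite -/c0 -/b -/L -/y in up lo.
have mU : measurable_seq N (fun X => 2 * L + L `^ γ < count_arc (a - l) (2 * l) X).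
  by apply: measurable_seq_ltr => //; exact: measurable_seq_cst.
have mD : measurable_seq N (fun X => count_arc (a - l) (2 * l) X < 2 * L - L `^ γ).
  by apply: measurable_seq_ltr => //; exact: measurable_seq_cst.
have mB : measurable_seq N (fun X => (2 * L + L `^ γ < count_arc (a - l) (2 * l) X) ||
    (count_arc (a - l) (2 * l) X < 2 * L - L `^ γ)).
  by move=> d T X mX; apply: measurable_or; [exact: mU|exact: mD].
have vg : L `^ γ <= L `^ (s / 2 + eps) by exact: ler_powR.
apply: (PNbeta_ge hs b0 mA mB) => [X sX aX ch|].
  rewrite sumE// -mulrA -/L -ltNge => h; apply/orP.
  have := le_lt_trans vg h; rewrite lter_normr => /orP[] h'; [left|right]; lra.
apply: (le_trans (Pr_or hs b0 mB mU mD (fun X _ _ _ h => h))).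
apply: (le_trans (lerD up lo)).
pose E := expR (- (c1 * b * y)).
have E0 : 0 < E by exact: expR_gt0.
have E1 : E <= 1 by rewrite expR_le1 oppr_le0 !mulr_ge0// ltW.
have E2 : expR (- (c0 * b * y / 2)) = E * E.
  by rewrite -expRD /c1; congr expR; field.
have E4 : expR (- (c0 * b * y)) = E * E * (E * E).
  by rewrite -E2 -expRD; congr expR; field.
have EE0 : 0 < E * E by rewrite mulr_gt0.
have EE1 : E * E <= 1 by rewrite mulr_ile1// ltW.
have EEE : E * E * (E * E) <= E * E by rewrite ler_piMr// ltW.
have LE : L * E <= F * b^-1 ^+ n.
  apply: (@le_trans _ _ (y ^+ n * E)); first by rewrite ler_pM2r// hn.
  apply: (le_trans (pow_expN_le n (mulr_gt0 c10 ib) y0)).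
  by rewrite /F exprMn invfM exprVn mulrA.
apply: (@le_trans _ _ (K * (C0 + 1) * (L * E) * E)).
  rewrite E2 E4.
  have h1 : C0 * (E * E * (E * E)) <= (C0 + 1) * (E * E).
    by apply: ler_pM; rewrite ?(ltW C00) ?lerDl// ltW// mulr_gt0.
  have h2 : 4 * L * (C0 * (E * E * (E * E))) <= 4 * L * ((C0 + 1) * (E * E)).
    by apply: ler_wpM2l h1; rewrite ltW// mulr_gt0//; lra.
  apply: (le_trans (lerD h2 (lexx _))).
  by rewrite le_eqVlt; apply/orP; left; apply/eqP; rewrite KE; ring.
apply: ler_pM.
- exact: ltW (mulr_gt0 KC (mulr_gt0 L0 E0)).
- exact: ltW.
- apply: (@le_trans _ _ (K * (C0 + 1) * (F * b^-1 ^+ n))).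
    by rewrite ler_pM2l.
  rewrite mulrA; apply: ler_wpM2r; first by apply: le_trans bn.
  by rewrite lerDl expR_ge0.
- rewrite ler_expR mulNr lerN2 ler_pM2l ?mulr_gt0//.
  exact: ler_powR.
Qed.

End Fluctuations.

Unset Implicit Arguments.

Theorem theorem1p1 (R : realType) (s : R) (hs : 0 < s < 1) :
  (forall eps : R, 0 < eps < 1 ->
    let delta := eps / (4 * (s + 2)) in
    exists C c : R -> R,
      (forall beta, 0 < beta -> 0 < C beta /\ 0 < c beta) /\
      loc_unif C /\ loc_unif c /\
      forall (beta : R) (N i k : nat), 0 < beta ->
        (i < N)%N -> (1 <= k)%N -> (k.*2 <= N)%N ->
        PNbeta s beta N
          (fun X => `| N%:R * trep (X`_((i + k) %% N) - X`_i) - k%:R |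
                      <= k%:R `^ (s / 2 + eps))
        >= 1 - C beta * expR (- c beta * k%:R `^ delta)) /\
  (forall eps : R, 0 < eps < 1 ->
    let delta := eps / (2 * (s + 2)) in
    exists C c : R -> R,
      (forall beta, 0 < beta -> 0 < C beta /\ 0 < c beta) /\
      loc_unif C /\ loc_unif c /\
      forall (beta : R) (N : nat) (a l : R), 0 < beta -> (1 <= N)%N ->
        0 < l < 1 / 4 ->
        PNbeta s beta N
          (fun X => `| \sum_(i < N) \1_(tarc a l) (X`_i) - 2 * N%:R * l |
                      <= (N%:R * l) `^ (s / 2 + eps))
        >= 1 - C beta * expR (- c beta * (N%:R * l) `^ delta)).
Proof.
by split=> eps heps; [exact: arc_fluctuations|exact: count_fluctuations].
Qed.
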